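(* Up to isomorphism there are exactly four real $3$-step nilpotent Lie algebras $\mathfrak{g}$ of dimension $7$ with $H^2_{3\text{-}nil}(\mathfrak{g},\mathfrak{g})=0$, namely $\mathfrak{g}_{137B}$, $\mathfrak{g}_{137B_1}$, $\mathfrak{g}_{247H}$ and $\mathfrak{g}_{247H_1}$. Consequently these four Lie algebras are rigid in $\mathcal{N}_{7,3}$. The dimensions of their $GL_7(\mathbb{R})$-orbits are, respectively, $36$, $36$, $38$, $38$.
   Context: In structure tables, $xy$ denotes the bracket $[x,y]$ of elements of the basis $a,b,c,d,e,f,g$ of a $7$-dimensional real vector space; brackets not listed and not determined by skew-symmetry are zero. $\mathfrak{g}_{137B}$: $ab=e$, $ae=g$, $cd=f$, $cf=g$, $bd=g$. $\mathfrak{g}_{137B_1}$: $ac=e$, $ad=f$, $ae=g$, $bc=-f$, $bd=e$, $bf=g$, $cd=g$. $\mathfrak{g}_{247H}$: $ab=d$, $ac=e$, $ad=f$, $bd=f$, $be=g$, $cd=g$, $ce=f$. $\mathfrak{g}_{247H_1}$: the (unique up to isomorphism) real Lie algebra that is not isomorphic to $\mathfrak{g}_{247H}$ over $\mathbb{R}$ but whose complexification is isomorphic to that of $\mathfrak{g}_{247H}$. For an $n$-dimensional real vector space $\mathfrak{g}$ and $\sigma\in\Lambda^2\mathfrak{g}^*\otimes\mathfrak{g}$ put $J(\sigma)(x,y,z)=\sum_{cyclic}\sigma(\sigma(x,y),z)$, $N_1(\sigma)(x_1,x_2)=\sigma(x_1,x_2)$ and $N_k(\sigma)(x_1,\dots,x_{k+1})=\sigma(N_{k-1}(\sigma)(x_1,\dots,x_k),x_{k+1})$.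 $\mathcal{N}_{n,k}=\{\sigma: J(\sigma)=0,\ N_k(\sigma)=0\}$ is the variety of (at most) $k$-step nilpotent Lie algebra structures on $\mathfrak{g}$. $GL(\mathfrak{g})$ acts by $(g\cdot\mu)(x,y)=g(\mu(g^{-1}x,g^{-1}y))$, and $\mu$ is rigid in $\mathcal{N}_{n,k}$ if its orbit is open in $\mathcal{N}_{n,k}$. For $\mu\in\mathcal{N}_{n,k}$, $H^2_{k\text{-}nil}(\mathfrak{g},\mathfrak{g})=\big(\mathrm{Ker}(d^2_\mu)\cap\mathrm{Ker}(dN_k|_\mu)\big)/\mathrm{Im}(d^1_\mu)$, where $d^1_\mu,d^2_\mu$ are the Chevalley–Eilenberg differentials with adjoint coefficients (on $\mathfrak{g}^*\otimes\mathfrak{g}$ and $\Lambda^2\mathfrak{g}^*\otimes\mathfrak{g}$) and $dN_k|_\mu$ is the differential of the map $N_k$ at $\mu$. *)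

(* Defs.v *)
From HB Require Import structures.
From mathcomp Require Import all_boot all_order all_algebra.
From mathcomp Require Import complex.
From mathcomp Require Import all_classical all_reals all_analysis.

Set Implicit Arguments.
Unset Strict Implicit.
Unset Printing Implicit Defensive.

Import Order.TTheory GRing.Theory Num.Theory.
Import numFieldNormedType.Exports.

Local Open Scope classical_set_scope.
Local Open Scope ring_scope.

(* Bilinear maps V x V -> V on V = F^n (column vectors), stored as the matrix
   of the induced linear map V (x) V -> V: the column of index
   [mxvec_index i j] is the value at (e_i, e_j). *)
Notation bilin F n := 'M[F]_(n, n * n).

Section Algebra.
Variables (F : fieldType) (n : nat).
Local Notation V := 'cV[F]_n.
Implicit Types (mu nu s : bilin F n) (x y z : V).

Definition bracket mu x y : V := mu *m (mxvec (x *m y^T))^T.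

Definition of_bilinear (f : V -> V -> V) : bilin F n :=
  \matrix_(k, p)
    let ij := enum_val (cast_ord (esym (mxvec_cast n n)) p) in
    f (delta_mx ij.1 0) (delta_mx ij.2 0) k 0.

Lemma bracket_sum mu x y :
  bracket mu x y =
  \sum_i \sum_j (x i 0 * y j 0) *: col (mxvec_index i j) mu.
Proof.
apply/colP => k; rewrite /bracket !mxE.
rewrite (reindex (uncurry (@mxvec_index n n))); last first.
  exact: curry_mxvec_bij.
rewrite summxE.
transitivity (\sum_i \sum_j
   mu k (mxvec_index i j) * (mxvec (x *m y^T))^T (mxvec_index i j) 0).
  by rewrite pair_big /=; apply: eq_bigr => -[i j].
apply: eq_bigr => i _; rewrite summxE; apply: eq_bigr => j _.
by rewrite !mxE mxvecE !mxE big_ord1 mxE mulrC.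
Qed.

Lemma of_bilinearK (f : V -> V -> V) :
  (forall y, linear (f^~ y)) -> (forall x, linear (f x)) ->
  forall x y, bracket (of_bilinear f) x y = f x y.
Proof.
move=> fl fr x y; rewrite bracket_sum.
have suml (I : finType) (c : I -> F) (v : I -> V) w :
    f (\sum_i c i *: v i) w = \sum_i c i *: f (v i) w.
  have f0 : f 0 w = 0 by have := fl w (-1) 0 0; rewrite !scaleN1r oppr0 addr0 addNr.
  apply: (big_ind2 (fun u u' => f u w = u')) => [//|u u' t t' <- <-|i _].
    by have := fl w 1 u t; rewrite !scale1r.
  by have := fl w (c i) (v i) 0; rewrite f0 !addr0.
have sumr (I : finType) (c : I -> F) (v : I -> V) w :
    f w (\sum_i c i *: v i) = \sum_i c i *: f w (v i).
  have f0 : f w 0 = 0 by have := fr w (-1) 0 0; rewrite !scaleN1r oppr0 addr0 addNr.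
  apply: (big_ind2 (fun u u' => f w u = u')) => [//|u u' t t' <- <-|i _].
    by have := fr w 1 u t; rewrite !scale1r.
  by have := fr w (c i) (v i) 0; rewrite f0 !addr0.
have cE (u : V) : u = \sum_i u i 0 *: delta_mx i 0.
  by rewrite {1}(matrix_sum_delta u); apply: eq_bigr => i _; rewrite big_ord1.
rewrite [in RHS](cE x) suml; apply: eq_bigr => i _.
rewrite [in RHS](cE y) sumr scaler_sumr; apply: eq_bigr => j _.
rewrite scalerA; congr (_ *: _); apply/colP => k.
by rewrite !mxE /mxvec_index cast_ordK enum_rankK.
Qed.

(* Membership in Lambda^2 g^* (x) g, in a form valid in any characteristic. *)
Definition alternating s := forall x, bracket s x x = 0.

Definition jacobiator s x y z : V :=
  bracket s (bracket s x y) z + bracket s (bracket s y z) x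
  + bracket s (bracket s z x) y.

Definition is_lie s := alternating s /\ forall x y z, jacobiator s x y z = 0.

(* N_k(s)(x_0, ..., x_k): only the first k + 1 terms of x are used. *)
Fixpoint nbracket k s (x : nat -> V) : V :=
  if k is k'.+1 then bracket s (nbracket k' s x) (x k) else x 0%N.

Definition nil_variety k : set (bilin F n) :=
  [set s | is_lie s /\ forall x : nat -> V, nbracket k s x = 0].

Definition nil_step k s := nil_variety k s /\ ~ nil_variety k.-1 s.

Definition isomorphic mu nu := exists2 g : 'M[F]_n, g \in unitmx &
  forall x y, g *m bracket mu x y = bracket nu (g *m x) (g *m y).

Definition gl_act (g : 'M[F]_n) mu : bilin F n :=
  of_bilinear (fun x y => g *m bracket mu (invmx g *m x) (invmx g *m y)).

Definition gl_orbit mu : set (bilin F n) :=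
  [set gl_act g mu | g in [set g | g \in unitmx]].

Definition d1 mu (phi : 'M[F]_n) : bilin F n :=
  of_bilinear (fun x y => bracket mu x (phi *m y) - bracket mu y (phi *m x)
                          - phi *m bracket mu x y).

Definition d2 mu s x y z : V :=
  bracket mu x (bracket s y z) - bracket mu y (bracket s x z)
  + bracket mu z (bracket s x y)
  - bracket s (bracket mu x y) z + bracket s (bracket mu x z) y
  - bracket s (bracket mu y z) x.

Definition B2 mu : set (bilin F n) := range (d1 mu).

(* An entry (i, j, v) of a table stands for [e_i, e_j] = v = - [e_j, e_i];
   the pairs {i, j} in a table must be distinct. *)
Definition of_table (t : seq ('I_n * 'I_n * V)) : bilin F n :=
  of_bilinear (fun x y => \sum_(e <- t)
    (x e.1.1 0 * y e.1.2 0 - x e.1.2 0 * y e.1.1 0) *: e.2).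

End Algebra.

Section Tables.
Variable F : fieldType.
Local Notation a := (@inord 6 0).
Local Notation b := (@inord 6 1).
Local Notation c := (@inord 6 2).
Local Notation d := (@inord 6 3).
Local Notation e := (@inord 6 4).
Local Notation f := (@inord 6 5).
Local Notation g := (@inord 6 6).
Definition evec (i : 'I_7) : 'cV[F]_7 := delta_mx i 0.

Definition g137B : bilin F 7 := of_table
  [:: (a, b, evec e); (a, e, evec g); (c, d, evec f); (c, f, evec g); (b, d, evec g)].

Definition g137B1 : bilin F 7 := of_table
  [:: (a, c, evec e); (a, d, evec f); (a, e, evec g); (b, c, - evec f);
      (b, d, evec e); (b, f, evec g); (c, d, evec g)].

Definition g247H : bilin F 7 := of_table
  [:: (a, b, evec d); (a, c, evec e); (a, d, evec f); (b, d, evec f);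
      (b, e, evec g); (c, d, evec g); (c, e, evec f)].

End Tables.

Section Real.
Variable R : realType.

Definition complexification n (mu : bilin R n) : bilin R[i] n :=
  map_mx (real_complex R) mu.

Definition is_g247H1 (h : bilin R 7) :=
  [/\ is_lie h, ~ isomorphic h (g247H R)
    & isomorphic (complexification h) (complexification (g247H R))].

(* The condition dN_k|_mu (s) = 0 in the space of (k+1)-linear maps is tested
   on each argument tuple x, evaluation at x being linear. *)
Definition Z2_nil n k (mu : bilin R n) : set (bilin R n) :=
  [set s | [/\ alternating s, forall x y z, d2 mu s x y z = 0
    & forall x : nat -> 'cV[R]_n,
        'd (fun t : bilin R n => nbracket k t x) mu s = 0]].

(* The quotient Z2 / B2, as the set of cosets s + B2 with s in Z2. *)
Definition H2_nil n k (mu : bilin R n) : set (set (bilin R n)) :=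
  [set [set t | B2 mu (t - s)] | s in Z2_nil k mu].

(* The zero coset is B2 itself. *)
Definition H2_nil_eq0 n k (mu : bilin R n) := H2_nil k mu = [set B2 mu].

Definition rigid n k (mu : bilin R n) :=
  nil_variety k mu /\
  exists2 U : set (bilin R n), open U & gl_orbit mu = nil_variety k `&` U.

(* S is an embedded C^1 submanifold of dimension m: every point of S lies in
   the image of an injective C^1 immersion phi, defined on an open U in R^m,
   which is a homeomorphism onto an open subset of S. *)
Definition submanifold (W : normedModType R) (m : nat) (S : set W) :=
  forall p, S p -> exists (U : set 'rV[R]_m) (phi : 'rV[R]_m -> W),
    [/\ open U /\ (phi @` U) p,
        {in U &, injective phi},
        forall u, U u -> differentiable phi u
          /\ forall v, {for u, continuous (fun w => 'd phi w v)},
        forall u, U u -> forall v, 'd phi u v = 0 -> v = 0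
      & forall U', open U' -> U' `<=` U ->
          exists2 O, open O & phi @` U' = O `&` S].

End Real.

(* Main.v *)
Require Import Defs.
From HB Require Import structures.
From mathcomp Require Import all_boot all_order all_algebra.
From mathcomp Require Import complex.
From mathcomp Require Import all_classical all_reals all_analysis.
From mathcomp Require Import ring lra zify.

Set Implicit Arguments.
Unset Strict Implicit.
Unset Printing Implicit Defensive.

Import Order.TTheory GRing.Theory Num.Theory.
Import numFieldNormedType.Exports.

Local Open Scope classical_set_scope.
Local Open Scope ring_scope.

(** Over the reals or the complex numbers write N137(eps) and N247(eps), with eps = 1 or -1,
    for two families of structures built from the quadratic algebra generated by a square
    root of eps. The four algebras are N137(1), N137(-1), N247(1) and N247(-1).

    Rigidity and dimensions. If every cocycle is a coboundary, choose a linear section [X] of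
    the differential [d1 mu] onto the cocycles. The map sending u to (1 + X u)^-1 . mu has the
    derivative [d1 mu \o X] at 0, and it is a chart of the orbit. The equations of the variety
    are satisfied to the first order by the cocycles only, so near [mu] the whole variety is
    in the image of the chart: the orbit is open in the variety, and it is a submanifold of
    the dimension of the space of cocycles ([local_chart], [orbit_chart],
    [rigid_of_rigid_cocycles], [orbit_submanifold]). The chart comes from
    strict differentiability and the contraction principle. For the four tables, that cocycles are coboundaries is a linear system with coefficients 1 and -1, which yields to
    the rule that the last unknown of an equation vanishes when the others do
    ([slice_of_check]).

    Classification. Let [mu] be of step three, with all cocycles coboundaries. In a basis
    adapted to the lower central series ([filtered_exists]), with steps of dimensions p, q and
    r, the possible types (p, q, r) are (3,1,3), (3,2,2), (3,3,1), (4,1,2), (4,2,1) and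
    (5,1,1). The Jacobi identity excludes the first. On each of the others the structures
    form explicit families, and since the orbit of [mu] is open, [mu] is isomorphic to all the
    structures near it on a line of the variety ([robust_line]); on such a line a polynomial
    which does not vanish identically can be assumed not to vanish. Lines lead from (4,1,2) to
    (3,2,2) and from (5,1,1) to (4,2,1), and generic structures of the types (4,2,1) and
    (3,2,2) have the normal forms N137(eps) and N247(eps), where eps is the sign of a
    discriminant ([T421_generic], [T322_generic]). For (3,3,1) the structure is a traceless
    3 x 3 matrix A up to conjugation and scaling; a deformation of A which is not orthogonal to
    tr(A^2) A^2 - tr(A^3) A is a cocycle and not a coboundary ([T331_not_robust]).

    Separation. The triple brackets lie on a line for N137 only, and for eps = 1 the zero
    divisors of the quadratic algebra give two elements x, y with [x, [y, t]] and
    [y, [x, t]] identically zero but [x, [x, t]] and [y, [y, t]] not ([has_split_pair]).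

    Real forms. A square root of -1 makes N247(-1) isomorphic to N247(1). Conversely, if the
    complexification of h is that of N247(1), it has no cohomology; the real part of a complex
    potential of a real cocycle is a real potential, so h has none either
    ([rigid_cocycles_real]), and the classification leaves N247(1) and N247(-1) only. *)

Notation alternating := Defs.alternating.

(** * Brackets, cocycles and coboundaries *)

Section Brackets.
Variables (F : fieldType) (n : nat).
Local Notation V := 'cV[F]_n.
Implicit Types (mu nu s t : bilin F n) (x y z u v w : V).

Lemma bracketDl mu x y z : bracket mu (x + y) z = bracket mu x z + bracket mu y z.
Proof. by rewrite /bracket mulmxDl linearD [(_ + _)^T]linearD mulmxDr. Qed.
Lemma bracketDr mu x y z : bracket mu x (y + z) = bracket mu x y + bracket mu x z.
Proof. by rewrite /bracket [(y + z)^T]linearD mulmxDr linearD [(_ + _)^T]linearD mulmxDr. Qed.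
Lemma bracketZl mu k x z : bracket mu (k *: x) z = k *: bracket mu x z.
Proof. by rewrite /bracket -scalemxAl linearZ [(_ *: _)^T]linearZ -scalemxAr. Qed.
Lemma bracketZr mu k x z : bracket mu x (k *: z) = k *: bracket mu x z.
Proof. by rewrite /bracket [(k *: z)^T]linearZ -scalemxAr linearZ [(_ *: _)^T]linearZ -scalemxAr. Qed.
Lemma bracketNl mu x z : bracket mu (- x) z = - bracket mu x z.
Proof. by rewrite -(scaleN1r x) bracketZl scaleN1r. Qed.
Lemma bracketNr mu x z : bracket mu x (- z) = - bracket mu x z.
Proof. by rewrite -(scaleN1r z) bracketZr scaleN1r. Qed.
Lemma bracketBl mu x y z : bracket mu (x - y) z = bracket mu x z - bracket mu y z.
Proof. by rewrite bracketDl bracketNl. Qed.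
Lemma bracketBr mu x y z : bracket mu x (y - z) = bracket mu x y - bracket mu x z.
Proof. by rewrite bracketDr bracketNr. Qed.
Lemma bracket0l mu z : bracket mu 0 z = 0.
Proof. by rewrite -(scale0r (0 : V)) bracketZl !scale0r. Qed.
Lemma bracket0r mu z : bracket mu z 0 = 0.
Proof. by rewrite -(scale0r (0 : V)) bracketZr !scale0r. Qed.
Lemma bracket_suml mu (I : Type) (r : seq I) (f : I -> V) z :
  bracket mu (\sum_(i <- r) f i) z = \sum_(i <- r) bracket mu (f i) z.
Proof.
by elim/big_rec2: _ => [|i a b _ <-]; rewrite ?bracket0l // bracketDl.
Qed.
Lemma bracket_sumr mu (I : Type) (r : seq I) (f : I -> V) z :
  bracket mu z (\sum_(i <- r) f i) = \sum_(i <- r) bracket mu z (f i).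
Proof.
by elim/big_rec2: _ => [|i a b _ <-]; rewrite ?bracket0r // bracketDr.
Qed.

Lemma bracketDm mu nu x y : bracket (mu + nu) x y = bracket mu x y + bracket nu x y.
Proof. by rewrite /bracket mulmxDl. Qed.
Lemma bracketZm k nu x y : bracket (k *: nu) x y = k *: bracket nu x y.
Proof. by rewrite /bracket -scalemxAl. Qed.
Lemma bracketNm nu x y : bracket (- nu) x y = - bracket nu x y.
Proof. by rewrite /bracket mulNmx. Qed.
Lemma bracketBm mu nu x y : bracket (mu - nu) x y = bracket mu x y - bracket nu x y.
Proof. by rewrite bracketDm bracketNm. Qed.
Lemma bracket0m x y : bracket 0 x y = 0.
Proof. by rewrite /bracket mul0mx. Qed.

Lemma colvecE x : x = \sum_i x i 0 *: delta_mx i 0.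
Proof.
by rewrite {1}(matrix_sum_delta x); apply: eq_bigr => i _; rewrite big_ord1.
Qed.

Lemma bracket_delta mu i j :
  bracket mu (delta_mx i 0) (delta_mx j 0) = col (mxvec_index i j) mu.
Proof.
by rewrite /bracket trmx_delta mul_delta_mx mxvec_delta trmx_delta colE.
Qed.

Lemma bracket_ext mu nu :
  (forall i j, bracket mu (delta_mx i 0) (delta_mx j 0)
             = bracket nu (delta_mx i 0) (delta_mx j 0)) -> mu = nu.
Proof.
move=> H; apply/matrixP => k p; case/mxvec_indexP: p => i j.
by have := H i j; rewrite !bracket_delta => /colP /(_ k); rewrite !mxE.
Qed.

Lemma bracket_inj mu nu :
  (forall x y, bracket mu x y = bracket nu x y) -> mu = nu.
Proof. by move=> H; apply: bracket_ext => i j. Qed.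

Lemma alternatingC s x y : alternating s -> bracket s x y = - bracket s y x.
Proof.
move=> A; have := A (x + y).
rewrite bracketDl !bracketDr !A addr0 add0r => /eqP.
by rewrite addr_eq0 => /eqP.
Qed.

(** In contrast to [mxE], these rules do not unfold the coordinates of a bracket. *)
Lemma entD u v i : (u + v) i 0 = u i 0 + v i 0. Proof. by rewrite mxE. Qed.
Lemma entN u i : (- u) i 0 = - u i 0. Proof. by rewrite mxE. Qed.
Lemma entZ k u i : (k *: u) i 0 = k * u i 0. Proof. by rewrite mxE. Qed.
Lemma ent0 i : (0 : V) i 0 = 0. Proof. by rewrite mxE. Qed.
Definition entE := (entD, entN, entZ, ent0).

End Brackets.

Ltac vring :=
  repeat (move: (bracket _ _ _) => ?);
  repeat (move: (_ *m _) => ?);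
  apply/colP => ?; rewrite ?entE; ring.

Section Action.
Variables (F : fieldType) (n : nat).
Local Notation V := 'cV[F]_n.
Implicit Types (mu nu s t : bilin F n) (x y z u v w : V) (g X : 'M[F]_n).

Lemma gl_actE g mu x y :
  bracket (gl_act g mu) x y = g *m bracket mu (invmx g *m x) (invmx g *m y).
Proof.
rewrite /gl_act of_bilinearK // => [{}y|{}x] k a b.
  by rewrite mulmxDr -scalemxAr bracketDl bracketZl mulmxDr -scalemxAr.
by rewrite mulmxDr -scalemxAr bracketDr bracketZr mulmxDr -scalemxAr.
Qed.

Lemma d1E mu X x y : bracket (d1 mu X) x y
  = bracket mu x (X *m y) - bracket mu y (X *m x) - X *m bracket mu x y.
Proof.
rewrite /d1 of_bilinearK // => [{}y|{}x] k a b;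
  rewrite !(mulmxDr, =^~ scalemxAr, bracketDl, bracketDr, bracketZl, bracketZr);
  vring.
Qed.

Lemma isomorphic_refl mu : isomorphic mu mu.
Proof. by exists 1%:M => [|x y]; rewrite ?unitmx1 ?mul1mx. Qed.

Lemma isomorphic_sym mu nu : isomorphic mu nu -> isomorphic nu mu.
Proof.
case=> g gu H; exists (invmx g) => [|x y]; first by rewrite unitmx_inv.
apply: (can_inj (mulKmx gu)).
by rewrite mulKVmx // H !mulKVmx.
Qed.

Lemma isomorphic_trans mu nu s :
  isomorphic mu nu -> isomorphic nu s -> isomorphic mu s.
Proof.
case=> g gu H [h hu K]; exists (h *m g) => [|x y].
  by rewrite unitmx_mul hu gu.
by rewrite -!mulmxA H K.
Qed.

Lemma gl_orbitP mu nu : gl_orbit mu nu <-> isomorphic mu nu.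
Proof.
split=> [[g /= gu <-]|[g gu H]].
  by exists g => // x y; rewrite gl_actE !mulKmx.
exists g => //; apply: bracket_inj => x y.
by rewrite gl_actE H !mulKVmx.
Qed.

Lemma nbracket_morph k g mu nu (x : nat -> V) :
  (forall x y, g *m bracket mu x y = bracket nu (g *m x) (g *m y)) ->
  g *m nbracket k mu x = nbracket k nu (fun i => g *m x i).
Proof. by move=> H; elim: k => //= k IH; rewrite H IH. Qed.

Lemma nil_variety_iso k mu nu :
  isomorphic mu nu -> nil_variety k mu -> nil_variety k nu.
Proof.
move=> /isomorphic_sym [g gu H] [[A J] N].
have g0 u : g *m u = 0 -> u = 0.
  by move=> E; apply: (can_inj (mulKmx gu)); rewrite E mulmx0.
split; first split.
- by move=> x; apply: g0; rewrite H A.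
- move=> x y z; apply: g0.
  by rewrite /jacobiator !mulmxDr !H; apply: J.
- by move=> x; apply: g0; rewrite (nbracket_morph _ _ H).
Qed.

Lemma nil_step_iso k mu nu : isomorphic mu nu -> nil_step k mu -> nil_step k nu.
Proof.
move=> I [N NN]; split; first exact: nil_variety_iso N.
by move=> M; apply: NN; apply: nil_variety_iso M; apply: isomorphic_sym.
Qed.

(** The derivative of [nbracket k ^~ x] at [mu] in the direction [s]. *)
Fixpoint dnbracket k mu s (x : nat -> V) : V :=
  if k is k'.+1 then
    bracket s (nbracket k' mu x) (x k) + bracket mu (dnbracket k' mu s x) (x k)
  else 0.

(** The cocycles that define the cohomology of the variety, with the analytic differential
    replaced by its algebraic expression, so that they make sense over any field. *)
Definition cocycle k mu s :=
  [/\ alternating s, forall x y z, d2 mu s x y z = 0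
    & forall x : nat -> V, dnbracket k mu s x = 0].

Definition rigid_cocycles k mu := forall s, cocycle k mu s -> B2 mu s.

Lemma dnbracket_morph k g mu nu s t (x : nat -> V) :
  (forall x y, g *m bracket mu x y = bracket nu (g *m x) (g *m y)) ->
  (forall x y, g *m bracket s x y = bracket t (g *m x) (g *m y)) ->
  g *m dnbracket k mu s x = dnbracket k nu t (fun i => g *m x i).
Proof.
move=> H K; elim: k => [|k IH] /=; first by rewrite mulmx0.
by rewrite mulmxDr K H IH (nbracket_morph _ _ H).
Qed.

Lemma cocycle_morph k g mu nu s t : g \in unitmx ->
  (forall x y, g *m bracket mu x y = bracket nu (g *m x) (g *m y)) ->
  (forall x y, g *m bracket s x y = bracket t (g *m x) (g *m y)) ->
  cocycle k mu s -> cocycle k nu t.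
Proof.
move=> gu H K [A D N].
have gK u : g *m (invmx g *m u) = u by rewrite mulKVmx.
split.
- by move=> x; rewrite -[x]gK -K A mulmx0.
- move=> x y z; rewrite -[x]gK -[y]gK -[z]gK.
  transitivity (g *m d2 mu s (invmx g *m x) (invmx g *m y) (invmx g *m z)).
    by rewrite /d2 !(mulmxDr, mulmxN) !(H, K).
  by rewrite D mulmx0.
- move=> x; transitivity (g *m dnbracket k mu s (fun i => invmx g *m x i)).
    rewrite (dnbracket_morph _ _ H K); congr dnbracket.
    by apply/funext => i; rewrite gK.
  by rewrite N mulmx0.
Qed.

Lemma d1_morph g mu nu X : g \in unitmx ->
  (forall x y, g *m bracket mu x y = bracket nu (g *m x) (g *m y)) ->
  forall x y, g *m bracket (d1 mu X) x y
    = bracket (d1 nu (g *m X *m invmx g)) (g *m x) (g *m y).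
Proof.
move=> gu H x y; rewrite !d1E -!mulmxA !mulKmx // !mulmxBr !H.
by rewrite -(H x y) mulKmx.
Qed.

Lemma morph_gl_act g s : g \in unitmx ->
  forall x y, g *m bracket s x y = bracket (gl_act g s) (g *m x) (g *m y).
Proof. by move=> gu x y; rewrite gl_actE !mulKmx. Qed.

Lemma rigid_cocycles_iso k mu nu :
  isomorphic mu nu -> rigid_cocycles k mu -> rigid_cocycles k nu.
Proof.
move=> [g gu H] B s Zs.
have gi : invmx g \in unitmx by rewrite unitmx_inv.
have Hi x y : invmx g *m bracket nu x y = bracket mu (invmx g *m x) (invmx g *m y).
  by apply: (can_inj (mulKmx gu)); rewrite mulKVmx // H !mulKVmx.
have [X _ E] := B _ (cocycle_morph gi Hi (morph_gl_act s gi) Zs).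
exists (g *m X *m invmx g) => //; apply: bracket_inj => x y.
rewrite -[x](mulKVmx gu) -[y](mulKVmx gu) -(d1_morph X gu H) E gl_actE.
by rewrite invmxK !mulKVmx.
Qed.

Lemma cocycle0 k mu : cocycle k mu 0.
Proof.
split=> [x|x y z|x]; first exact: bracket0m.
  by rewrite /d2 !bracket0m !bracket0r !(subr0, addr0).
by elim: k => //= k ->; rewrite bracket0m bracket0l addr0.
Qed.

Lemma cocycleB k mu s t : cocycle k mu s -> cocycle k mu t -> cocycle k mu (s - t).
Proof.
move=> [A D N] [A' D' N']; split=> [x|x y z|x].
- by rewrite bracketBm A A' subr0.
- transitivity (d2 mu s x y z - d2 mu t x y z); last by rewrite D D' subr0.
  by rewrite /d2 !(bracketBm, bracketBr, bracketBl); vring.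
- transitivity (dnbracket k mu s x - dnbracket k mu t x); last by rewrite N N' subr0.
  elim: k {D D' N N'} => [|k IH] /=; first by rewrite subr0.
  by rewrite IH !(bracketBm, bracketBr, bracketBl); vring.
Qed.

Lemma jacobiL mu x y z : is_lie mu ->
  bracket mu x (bracket mu y z)
  = bracket mu y (bracket mu x z) + bracket mu (bracket mu x y) z.
Proof.
move=> [A J]; have := J x y z; rewrite /jacobiator.
rewrite [bracket mu (bracket mu y z) x](alternatingC _ _ A).
rewrite [bracket mu (bracket mu z x) y](alternatingC _ _ A).
rewrite [bracket mu z x](alternatingC _ _ A) bracketNr opprK.
move=> E; apply/eqP; rewrite -subr_eq0 -oppr_eq0; apply/eqP; rewrite -[RHS]E.
by vring.
Qed.

Definition subst_arg (x : nat -> V) i v := fun j => if j == i then v else x j.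

(** The derivative of the equivariance of [nbracket] under the linear group: the left hand
    side is its variation along a coboundary, the right hand side the variation of its
    arguments. *)
Lemma dnbracket_d1 k mu X (x : nat -> V) : alternating mu ->
  dnbracket k mu (d1 mu X) x + X *m nbracket k mu x
  = \sum_(i < k.+1) nbracket k mu (subst_arg x i (X *m x i)).
Proof.
move=> A; have ext j (a b : nat -> V) :
    (forall i, (i <= j)%N -> a i = b i) -> nbracket j mu a = nbracket j mu b.
  elim: j => [|j IH] H /=; first exact: H.
  by rewrite H // IH // => i ij; apply: H; rewrite (leq_trans ij).
elim: k => [|k IH]; first by rewrite big_ord1 /= add0r /subst_arg eqxx.
rewrite big_ord_recr /= d1E.
have -> : nbracket k mu (subst_arg x k.+1 (X *m x k.+1)) = nbracket k mu x.
  by apply: ext => i ik; rewrite /subst_arg ltn_eqF.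
under eq_bigr => i _ do rewrite {2}/subst_arg gtn_eqF //.
rewrite -bracket_suml -IH bracketDl /subst_arg eqxx.
rewrite [bracket mu (x k.+1) _](alternatingC _ _ A).
by vring.
Qed.

Lemma cocycle_d1 k mu X : nil_variety k mu -> cocycle k mu (d1 mu X).
Proof.
move=> [[A J] N]; split=> [x|x y z|x].
- by rewrite d1E subrr A mulmx0 subr0.
- have L a b c := jacobiL a b c (conj A J).
  have JX : X *m bracket mu (bracket mu x y) z
      = X *m bracket mu (bracket mu x z) y - X *m bracket mu (bracket mu y z) x.
    have /(congr1 (mulmx X)) := J x y z; rewrite /jacobiator mulmx0 !mulmxDr.
    rewrite [bracket mu z x](alternatingC _ _ A) bracketNl mulmxN => E.
    by apply/eqP; rewrite -subr_eq0 -[X in _ == X]E; apply/eqP; vring.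
  rewrite /d2 !d1E !(bracketBm, bracketBr, bracketBl) JX.
  rewrite [bracket mu z (X *m bracket mu x y)](alternatingC _ _ A).
  rewrite [bracket mu y (X *m bracket mu x z)](alternatingC _ _ A).
  rewrite [bracket mu x (X *m bracket mu y z)](alternatingC _ _ A).
  rewrite !(L x y (_ *m _)) !(L x z (_ *m _)) !(L y z (_ *m _)).
  vring.
- have := dnbracket_d1 k X x A; rewrite N mulmx0 addr0 => ->.
  by apply: big1 => i _; apply: N.
Qed.

End Action.

Section Slice.
Variables (F : fieldType) (n : nat).
Implicit Types (mu nu s : bilin F n) (X Y : 'M[F]_n).

Lemma d1_linear mu : linear (d1 mu).
Proof.
move=> k X Y; apply: bracket_inj => x y.
rewrite bracketDm bracketZm !d1E !mulmxDl -!scalemxAl !bracketDr !bracketZr.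
vring.
Qed.

(** A slice: a linear section of [d1 mu], of dimension [m], onto the cocycles. *)
Definition slice m k mu := exists X : {linear 'rV[F]_m -> 'M[F]_n},
  (forall u, d1 mu (X u) = 0 -> u = 0)
  /\ forall s, cocycle k mu s -> exists u, s = d1 mu (X u).

Lemma slice_iso m k mu nu : isomorphic mu nu -> slice m k mu -> slice m k nu.
Proof.
move=> [g gu H] [X [Xinj Xsurj]].
have gi : invmx g \in unitmx by rewrite unitmx_inv.
have Hi x y : invmx g *m bracket nu x y = bracket mu (invmx g *m x) (invmx g *m y).
  by apply: (can_inj (mulKmx gu)); rewrite mulKVmx // H !mulKVmx.
have dE u : d1 nu (g *m X u *m invmx g) = gl_act g (d1 mu (X u)).
  apply: bracket_inj => x y.
  by rewrite gl_actE (d1_morph (X u) gu H) !mulKVmx.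
exists (mulmxr (invmx g) \o mulmx g \o X : {linear _ -> _}); split=> [u|s Zs] /=.
  rewrite dE => E; apply: Xinj; apply: bracket_inj => x y.
  have := congr1 (fun b => invmx g *m bracket b (g *m x) (g *m y)) E.
  by rewrite gl_actE !mulKmx // !bracket0m mulmx0.
have [u E] := Xsurj _ (cocycle_morph gi Hi (morph_gl_act s gi) Zs).
exists u; rewrite dE -E; apply: bracket_inj => x y.
by rewrite !gl_actE invmxK !mulKVmx.
Qed.

Lemma slice_of_rigid k mu : rigid_cocycles k mu -> exists m, slice m k mu.
Proof.
move=> H.
pose dl : {linear 'M[F]_n -> bilin F n} :=
  HB.pack (d1 mu) (GRing.isLinear.Build _ _ _ _ _ (@d1_linear mu)).
pose D := lin_mx dl.
have [S ES] : exists S, row_base D = S *m D.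
  by apply/submxP; rewrite eq_row_base.
have dE u : d1 mu (vec_mx (u *m S)) = vec_mx (u *m row_base D).
  rewrite ES mulmxA; apply: (can_inj mxvecK); rewrite vec_mxK.
  by rewrite -[X in _ = X *m D]vec_mxK (mul_vec_lin dl).
exists (\rank D), (vec_mx \o mulmxr S : {linear _ -> _}); split=> [u|s Zs] /=.
  rewrite dE => /(congr1 mxvec); rewrite vec_mxK linear0 => E.
  by apply: (row_free_inj (row_base_free D)); rewrite E mul0mx.
have [Y _ E] := H _ Zs.
have : (mxvec s <= row_base D)%MS.
  by rewrite eq_row_base -E; apply/submxP; exists (mxvec Y); rewrite (mul_vec_lin dl).
case/submxP => u Eu; exists u.
by rewrite dE -Eu mxvecK.
Qed.

End Slice.

(** * Strict differentiability and charts *)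

Section StrictDifferential.
Variable R : realType.
Implicit Types E F G H : normedModType R.

Definition bounded_map E F (L : E -> F) := exists2 C : R, 0 <= C & forall v, `|L v| <= C * `|v|.

(** Strict differentiability at [p] with derivative [L]. In this form, injectivity
    and openness near [p] follow directly from those of [L]. *)
Definition sdiff E F (f L : E -> F) (p : E) := forall e : R, 0 < e ->
  exists2 d : R, 0 < d & forall x y, `|x - p| < d -> `|y - p| < d ->
    `|f x - f y - L (x - y)| <= e * `|x - y|.

Lemma sdiff_scale E F (f L : E -> F) p (C : R) : 0 <= C ->
  (forall e : R, 0 < e -> exists2 d : R, 0 < d & forall x y,
    `|x - p| < d -> `|y - p| < d ->
    `|f x - f y - L (x - y)| <= C * e * `|x - y|) -> sdiff f L p.
Proof.
move=> C0 H e e0.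
have C1 : 0 < C + 1 by lra.
have [|d d0 Hd] := H (e / (C + 1)); first exact: divr_gt0.
exists d => // x y xd yd; apply: le_trans (Hd x y xd yd) _.
rewrite ler_wpM2r // mulrCA ler_piMr ?(ltW e0) // ler_pdivrMr // mul1r.
by lra.
Qed.

Lemma sdiff_ext E F (f g L M : E -> F) p : f =1 g -> L =1 M -> sdiff f L p -> sdiff g M p.
Proof. by move=> /funext -> /funext ->. Qed.

Lemma sdiff_lin E F (L : {linear E -> F}) p : sdiff L L p.
Proof.
move=> e e0; exists 1 => // x y _ _.
by rewrite linearB subrr normr0 mulr_ge0 // ltW.
Qed.

Lemma sdiff_cst E F (c : F) p : sdiff (fun _ : E => c) (fun => 0) p.
Proof.
move=> e e0; exists 1 => // x y _ _.
by rewrite !subrr normr0 mulr_ge0 // ltW.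
Qed.

Lemma sdiffD E F (f g L M : E -> F) p : sdiff f L p -> sdiff g M p ->
  sdiff (fun x => f x + g x) (fun v => L v + M v) p.
Proof.
move=> Hf Hg; apply: (@sdiff_scale _ _ _ _ _ 2) => // e e0.
have [d d0 Hd] := Hf e e0; have [d' d'0 Hd'] := Hg e e0.
exists (Num.min d d') => [|x y]; first by rewrite lt_min d0.
rewrite !lt_min => /andP[xd xd'] /andP[yd yd'].
have -> : f x + g x - (f y + g y) - (L (x - y) + M (x - y))
  = (f x - f y - L (x - y)) + (g x - g y - M (x - y)).
  by rewrite !opprD (addrACA (f x)) (addrACA (f x - f y)).
apply: le_trans (ler_normD _ _) _.
by have := Hd x y xd yd; have := Hd' x y xd' yd'; lra.
Qed.

Lemma sdiff_lip E F (f L : E -> F) p : bounded_map L -> sdiff f L p ->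
  exists C d : R, [/\ 0 <= C, 0 < d & forall x y, `|x - p| < d -> `|y - p| < d ->
    `|f x - f y| <= C * `|x - y|].
Proof.
move=> [C C0 HC] Hf; have [d d0 Hd] := Hf 1 ltr01.
exists (C + 1), d; split=> [|//|x y xd yd]; first lra.
rewrite -[f x - f y](subrK (L (x - y))).
apply: le_trans (ler_normD _ _) _.
by have := Hd x y xd yd; have := HC (x - y); lra.
Qed.

Lemma sdiff_comp E F G (f L : E -> F) (g M : F -> G) p :
  bounded_map L -> bounded_map M -> (forall x y, M (x - y) = M x - M y) ->
  sdiff f L p -> sdiff g M (f p) -> sdiff (g \o f) (M \o L) p.
Proof.
move=> bL bM MB Hf Hg.
have [K [d1 [K0 d10 Hd1]]] := sdiff_lip bL Hf.
case: bM => C C0 HC.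
apply: (@sdiff_scale _ _ _ _ _ (K + C)); first exact: addr_ge0.
move=> e e0; have [d2 d20 Hd2] := Hf e e0; have [d3 d30 Hd3] := Hg e e0.
have K1 : 0 < K + 1 by lra.
exists (Num.min (Num.min d1 d2) (d3 / (K + 1))) => [|x y].
  by rewrite !lt_min d10 d20 divr_gt0.
rewrite !lt_min => /andP[/andP[x1 x2] x3] /andP[/andP[y1 y2] y3].
have near z : `|z - p| < d1 -> `|z - p| < d3 / (K + 1) -> `|f z - f p| < d3.
  move=> z1; rewrite ltr_pdivlMr // => z3.
  apply: le_lt_trans (Hd1 _ _ z1 _) _; first by rewrite subrr normr0.
  by have := normr_ge0 (z - p); lra.
have -> : g (f x) - g (f y) - M (L (x - y)) =
    (g (f x) - g (f y) - M (f x - f y)) + M (f x - f y - L (x - y)).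
  by rewrite [M (_ - L _)]MB addrA subrK.
apply: le_trans (ler_normD _ _) _.
have A := Hd3 _ _ (near _ x1 x3) (near _ y1 y3).
have B := HC (f x - f y - L (x - y)).
have D := Hd2 _ _ x2 y2; have D1 := Hd1 _ _ x1 y1.
rewrite !mulrDl; apply: lerD.
  by apply: le_trans A _; rewrite [K * e]mulrC -mulrA ler_wpM2l // ltW.
by apply: le_trans B _; rewrite -mulrA ler_wpM2l.
Qed.

Lemma sdiff_bilin E F G H (f L : E -> F) (g M : E -> G) (B : F -> G -> H) (C : R) p :
  (forall x y z, B (x - y) z = B x z - B y z) ->
  (forall x y z, B z (x - y) = B z x - B z y) ->
  0 <= C -> (forall x y, `|B x y| <= C * `|x| * `|y|) ->
  bounded_map L -> bounded_map M -> sdiff f L p -> sdiff g M p ->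
  sdiff (fun x => B (f x) (g x)) (fun v => B (L v) (g p) + B (f p) (M v)) p.
Proof.
move=> Bl Br C0 HB bL bM Hf Hg.
have [K [d1 [K0 d10 Hd1]]] := sdiff_lip bL Hf.
have [K' [d2 [K'0 d20 Hd2]]] := sdiff_lip bM Hg.
case: bL => CL CL0 HL.
pose G0 := `|g p| + K'; pose F0 := `|f p|.
have G00 : 0 <= G0 by apply: addr_ge0.
apply: (@sdiff_scale _ _ _ _ _ (C * (G0 + CL * K' + K * K' + F0))).
  apply: mulr_ge0 => //; apply: addr_ge0; last exact: normr_ge0.
  by apply: addr_ge0; [apply: addr_ge0|]; rewrite // mulr_ge0.
move=> e e0; have [d3 d30 Hd3] := Hf e e0; have [d4 d40 Hd4] := Hg e e0.
exists (Num.min (Num.min (Num.min d1 d2) (Num.min d3 d4)) (Num.min 1 e)) => [|x y].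
  by rewrite !lt_min d10 d20 d30 d40 e0 ltr01.
rewrite !lt_min.
move=> /andP[/andP[/andP[x1 x2] /andP[x3 x4]] /andP[x5 x6]].
move=> /andP[/andP[/andP[y1 y2] /andP[y3 y4]] /andP[y5 y6]].
have p1 : `|p - p| < d1 by rewrite subrr normr0.
have p2 : `|p - p| < d2 by rewrite subrr normr0.
have -> : B (f x) (g x) - B (f y) (g y) - (B (L (x - y)) (g p) + B (f p) (M (x - y)))
  = B (f x - f y - L (x - y)) (g x) + B (L (x - y)) (g x - g p)
    + (B (f y - f p) (g x - g y) + B (f p) (g x - g y - M (x - y))).
  rewrite !(Bl, Br).
  set a := B (f x) (g x); set b := B (f y) (g y); set c := B (f y) (g x).
  set t := B (L _) (g x); set u := B (L _) (g p); set w := _ - B (f p) (g y).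
  by rewrite !subrKA addrACA subrKA -opprD.
have gx : `|g x| <= G0.
  rewrite -[g x](subrK (g p)) addrC; apply: le_trans (ler_normD _ _) _.
  rewrite lerD2l; apply: le_trans (Hd2 _ _ x2 p2) _.
  by rewrite ler_piMr // ltW.
have b1 : `|B (f x - f y - L (x - y)) (g x)| <= C * G0 * e * `|x - y|.
  apply: le_trans (HB _ _) _; rewrite -!mulrA ler_wpM2l // mulrC.
  by apply: ler_pM => //; apply: Hd3.
have b2 : `|B (L (x - y)) (g x - g p)| <= C * (CL * K') * e * `|x - y|.
  apply: le_trans (HB _ _) _.
  have -> : C * (CL * K') * e * `|x - y| = C * (CL * `|x - y|) * (K' * e) by ring.
  apply: ler_pM => //; rewrite ?mulr_ge0 // ?ler_wpM2l //.
  by apply: le_trans (Hd2 _ _ x2 p2) _; rewrite ler_wpM2l // ltW.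
have b3 : `|B (f y - f p) (g x - g y)| <= C * (K * K') * e * `|x - y|.
  apply: le_trans (HB _ _) _.
  have -> : C * (K * K') * e * `|x - y| = C * (K * e) * (K' * `|x - y|) by ring.
  apply: ler_pM => //; rewrite ?mulr_ge0 // ?ler_wpM2l ?Hd2 //.
  by apply: le_trans (Hd1 _ _ y1 p1) _; rewrite ler_wpM2l // ltW.
have b4 : `|B (f p) (g x - g y - M (x - y))| <= C * F0 * e * `|x - y|.
  apply: le_trans (HB _ _) _.
  by rewrite -[_ * e * _]mulrA ler_wpM2l ?mulr_ge0 // Hd4.
apply: le_trans (ler_normD _ _) _.
have := ler_normD (B (f x - f y - L (x - y)) (g x)) (B (L (x - y)) (g x - g p)).
have := ler_normD (B (f y - f p) (g x - g y)) (B (f p) (g x - g y - M (x - y))).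
rewrite mulrDr !mulrDl mulrDr !mulrDl mulrDr !mulrDl.
lra.
Qed.

(** A strict derivative at [p] is close to the derivatives at the points near [p]; this is
    the continuity of the derivative. *)
Lemma sdiff_near E F (f L M : E -> F) p u (e d : R) :
  (forall k v, L (k *: v) = k *: L v) -> (forall k v, M (k *: v) = k *: M v) ->
  0 < e -> (forall x y, `|x - p| < d -> `|y - p| < d ->
    `|f x - f y - L (x - y)| <= e * `|x - y|) ->
  `|u - p| < d -> sdiff f M u -> forall v, `|M v - L v| <= 2 * e * `|v|.
Proof.
move=> LZ MZ e0 Hd ud Hu v; have [d' d'0 Hd'] := Hu e e0.
have v1 : 0 < `|v| + 1 by have := normr_ge0 v; lra.
have m0 : 0 < Num.min d' (d - `|u - p|) by rewrite lt_min d'0 subr_gt0.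
have [t t0 tv] : exists2 t : R, 0 < t & `|t *: v| < Num.min d' (d - `|u - p|).
  have t0 : 0 < Num.min d' (d - `|u - p|) / (2 * (`|v| + 1)).
    by rewrite divr_gt0 // mulr_gt0.
  exists (Num.min d' (d - `|u - p|) / (2 * (`|v| + 1))) => //.
  rewrite normrZ gtr0_norm // -mulrA gtr_pMr // mulrC ltr_pdivrMr ?mulr_gt0 //.
  by have := normr_ge0 v; lra.
move: tv; rewrite lt_min => /andP[tv1 tv2].
have H1 := Hd' (u + t *: v) u; have H2 := Hd (u + t *: v) u.
move: H1 H2; rewrite [u + _]addrC addrK subrr normr0 => /(_ tv1 d'0) H1.
have -> : t *: v + u - p = t *: v + (u - p) by rewrite addrA.
have ud2 : `|t *: v + (u - p)| < d by apply: le_lt_trans (ler_normD _ _) _; lra.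
move=> /(_ ud2 ud) H2.
have : `|t *: (M v - L v)| <= 2 * e * `|t *: v|.
  rewrite scalerBr -MZ -LZ.
  have -> : M (t *: v) - L (t *: v) = (f (t *: v + u) - f u - L (t *: v))
      - (f (t *: v + u) - f u - M (t *: v)).
    by rewrite [- (_ - M _)]opprB [RHS]addrC subrKA.
  by apply: le_trans (ler_normB _ _) _; lra.
rewrite !normrZ gtr0_norm // => H1'; rewrite -(ler_pM2l t0); lra.
Qed.

Lemma sdiff_diff E F (f : E -> F) (L : {linear E -> F}) p :
  bounded_map L -> sdiff f L p -> differentiable f p /\ 'd f p = L :> (E -> F).
Proof.
move=> [C C0 HC] Hf.
have Lc : continuous L.
  apply: bounded_linear_continuous; apply/linear_boundedP.
  exists C; split=> [|r Cr x]; first exact: num_real.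
  by apply: le_trans (HC x) _; rewrite ler_wpM2r // ltW.
have Ho : f \o shift p = cst (f p) + L +o_ 0 id.
  apply/eqaddoP => e e0; have [d d0 Hd] := Hf e e0.
  near=> x; have xd : `|x| < d by near: x; apply: nbhs0_lt.
  have := Hd (x + p) p; rewrite addrK subrr normr0 => /(_ xd d0).
  by rewrite /= !fctE /= opprD addrA.
have E1 := diff_unique Lc Ho.
by split=> //; apply/diff_locallyP; rewrite E1.
Unshelve. all: by end_near. Qed.

End StrictDifferential.

Section MatrixBounds.
Variable R : realType.

Lemma coord_norm m n (x : 'M[R]_(m, n)) i j : `|x i j| <= `|x|.
Proof.
rewrite [leRHS]/Num.norm /= mx_normrE.
exact: (le_bigmax _ (fun ij : 'I_m * 'I_n => `|x ij.1 ij.2|) (i, j)).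
Qed.

Lemma mx_linear_bounded m n (E : normedModType R) (L : {linear 'M[R]_(m, n) -> E}) :
  bounded_map L.
Proof.
exists (\sum_i \sum_j `|L (delta_mx i j)|) => [|x].
  by apply: sumr_ge0 => i _; apply: sumr_ge0.
rewrite {1}[x]matrix_sum_delta linear_sum mulr_suml.
apply: le_trans (ler_norm_sum _ _ _) _; apply: ler_sum => i _.
rewrite linear_sum mulr_suml.
apply: le_trans (ler_norm_sum _ _ _) _; apply: ler_sum => j _.
by rewrite linearZ normrZ mulrC ler_wpM2l // coord_norm.
Qed.

Lemma mx_bilinear_bounded m n p q (H : normedModType R)
    (B : 'M[R]_(m, n) -> 'M[R]_(p, q) -> H) :
  (forall y, linear (B^~ y)) -> (forall x, linear (B x)) ->
  exists2 C : R, 0 <= C & forall x y, `|B x y| <= C * `|x| * `|y|.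
Proof.
move=> Bl Br.
pose Bx x : {linear 'M[R]_(p, q) -> H} :=
  HB.pack (B x) (GRing.isLinear.Build _ _ _ _ _ (Br x)).
pose By y : {linear 'M[R]_(m, n) -> H} :=
  HB.pack (B^~ y) (GRing.isLinear.Build _ _ _ _ _ (Bl y)).
have /choice [c Hc] : forall ij : 'I_m * 'I_n, exists C : R,
    0 <= C /\ forall y, `|B (delta_mx ij.1 ij.2) y| <= C * `|y|.
  move=> ij; have [C C0 HC] := mx_linear_bounded (Bx (delta_mx ij.1 ij.2)).
  by exists C.
exists (\sum_i \sum_j c (i, j)) => [|x y].
  by apply: sumr_ge0 => i _; apply: sumr_ge0 => j _; case: (Hc (i, j)).
have -> : B x y = By y x by [].
rewrite {1}[x]matrix_sum_delta linear_sum !mulr_suml.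
apply: le_trans (ler_norm_sum _ _ _) _; apply: ler_sum => i _.
rewrite linear_sum !mulr_suml.
apply: le_trans (ler_norm_sum _ _ _) _; apply: ler_sum => j _.
rewrite linearZ normrZ mulrAC mulrC; apply: ler_pM => //.
  by have [_ /(_ y)] := Hc (i, j).
exact: coord_norm.
Qed.

End MatrixBounds.

(** The contraction principle asks for a complete normed module. *)
HB.instance Definition _ (R : realType) m n := Complete.copy 'M[R]_(m, n) _.

Section Chart.
Variables (R : realType) (m a b : nat).
Local Notation E := 'rV[R]_m.
Local Notation W := 'M[R]_(a, b).

(** Here [P] is a left inverse of the derivative at 0, so that [P \o phi] is the identity up
    to a contraction of ratio 1/2: it is injective, and open by the contraction principle.
    Since [P] separates the points of [S] near [phi 0], the image of an open set [U'] is the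
    trace on [S] of the open set of the [x] near [phi 0] with [P x] in [P @` (phi @` U')]. *)
Lemma local_chart (S : set W) (phi : E -> W) (L : E -> {linear E -> W})
    (P : {linear W -> E}) (d0 : R) :
  0 < d0 -> (forall u, `|u| < d0 -> sdiff phi (L u) u) ->
  (forall v, P (L 0 v) = v) -> (forall u, `|u| < d0 -> S (phi u)) ->
  (exists2 d : R, 0 < d & forall x y, S x -> S y ->
     `|x - phi 0| < d -> `|y - phi 0| < d -> P x = P y -> x = y) ->
  exists U : set E, [/\ open U /\ U 0, forall u, U u -> `|u| < d0,
    {in U &, injective phi},
    forall u, U u -> differentiable phi u
      /\ forall v, {for u, continuous (fun w => 'd phi w v)}
    & (forall u, U u -> forall v, 'd phi u v = 0 -> v = 0)
  /\ forall U', open U' -> U' `<=` U -> exists2 O, open O & phi @` U' = O `&` S].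
Proof.
move=> d00 Hphi PL HS [d1 d10 HI].
have [CP CP0 HP] := mx_linear_bounded P.
have bL u : bounded_map (L u) := mx_linear_bounded (L u).
have CP1 : 0 < CP + 1 by lra.
pose e : R := 1 / (4 * (CP + 1)).
have e0 : 0 < e by rewrite divr_gt0 // mulr_gt0.
have ee : e * (4 * (CP + 1)) = 1.
  by rewrite /e mul1r mulVf // lt0r_neq0 // mulr_gt0.
have CPe : CP * (2 * e) <= 1 / 2 by lra.
have z0 : `|0 : E| < d0 by rewrite normr0.
have [r1 r10 Hr1] := Hphi 0 z0 e e0.
have [C [d2 [C0 d20 Hd2]]] := sdiff_lip (bL 0) (Hphi 0 z0).
have C1 : 0 < C + 1 by lra.
have [r [r0 Hr]] : exists r : R, 0 < r /\ forall u : E, `|u| < r ->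
    [/\ `|u| < d0, `|u - 0| < r1 & `|phi u - phi 0| < d1].
  exists (Num.min (Num.min d0 r1) (Num.min d2 (d1 / (C + 1)))); split.
    by rewrite !lt_min d00 r10 d20 divr_gt0.
  move=> u; rewrite !lt_min => /andP[/andP[u0 u1] /andP[u2]].
  rewrite ltr_pdivlMr // => u3.
  split=> //; first by rewrite subr0.
  apply: le_lt_trans (Hd2 _ _ _ _) _; rewrite ?subr0 ?normr0 //.
  by have := normr_ge0 u; lra.
pose psi u := P (phi u).
have Hpsi x y : `|x| < r -> `|y| < r -> `|psi x - psi y - (x - y)| <= 1 / 2 * `|x - y|.
  move=> /Hr[_ x1 _] /Hr[_ y1 _].
  rewrite -[x - y]PL -!linearB; apply: le_trans (HP _) _.
  rewrite PL; have H := Hr1 x y x1 y1.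
  apply: le_trans (ler_wpM2l CP0 H) _; rewrite mulrA; apply: ler_wpM2r => //.
  have : 0 <= CP * e by rewrite mulr_ge0 // ltW.
  by lra.
pose U := [set u : E | `|u| < r].
have UE : U = ball (0 : E) r.
  by rewrite -ball_normE; apply/seteqP; split=> u /=; rewrite sub0r normrN.
have dphi u : U u -> differentiable phi u.
  by move=> /Hr[u0 _ _]; have [] := sdiff_diff (bL u) (Hphi u u0).
have dE u v : U u -> L u v = 'd phi u v.
  by move=> /Hr[u0 _ _]; have [_ H] := sdiff_diff (bL u) (Hphi u u0); rewrite H.
have LZ u k v : L u (k *: v) = k *: L u v by rewrite linearZ.
exists U; split.
- by rewrite UE; split; [exact: ball_open|exact: ballxx].
- by move=> u /Hr[].
- move=> x y; rewrite !inE => Ux Uy E1.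
  have := Hpsi x y Ux Uy; rewrite /psi E1 subrr sub0r normrN => H.
  have := normr_ge0 (x - y) => H0.
  by apply/eqP; rewrite -subr_eq0 -normr_eq0; apply/eqP; lra.
- move=> u Uu; split; first exact: dphi.
  have FF : Filter (nbhs u) := nbhs_filter u.
  move=> v; apply/(@cvgrPdist_le _ _ _ (nbhs u) FF) => eps eps0.
  have [u0 _ _] := Hr u Uu.
  have k0 : 0 < eps / (2 * (`|v| + 1)).
    by rewrite divr_gt0 // mulr_gt0 //; have := normr_ge0 v; lra.
  have [d d_0 Hd] := Hphi u u0 _ k0.
  have nU : nbhs u U by rewrite UE; apply: open_nbhs_nbhs; split;
    [exact: ball_open|rewrite -UE].
  near=> w.
  have Uw : U w by near: w.
  have wd : `|w - u| < d.
    by rewrite distrC; near: w; apply: cvgr_dist_lt.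
  suff : `|L u v - L w v| <= eps by rewrite (dE u v Uu) (dE w v Uw).
  have [w0 _ _] := Hr w Uw.
  have := sdiff_near (LZ u) (LZ w) k0 Hd wd (Hphi w w0) v.
  rewrite distrC => /le_trans; apply.
  rewrite mulrCA invfM // !mulrA mulfK // -mulrA ler_piMr ?(ltW eps0) //.
  by rewrite mulrC ler_pdivrMr ?mul1r; have := normr_ge0 v; lra.
split.
  move=> u Uu v; rewrite -(dE u v Uu) => Lv.
  have [u0 u1 _] := Hr u Uu.
  have := sdiff_near (LZ 0) (LZ u) e0 Hr1 u1 (Hphi u u0) v.
  rewrite Lv sub0r normrN => H.
  have := HP (L 0 v); rewrite PL => H'.
  have := ler_wpM2l CP0 H; rewrite mulrA => H''.
  have := ler_wpM2r (normr_ge0 v) CPe => H3.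
  have := normr_ge0 v => H4.
  by apply/eqP; rewrite -normr_eq0; apply/eqP; lra.
move=> U' oU' U'U.
have oV : open (psi @` U').
  rewrite openE => _ [u0 U'u0 <-].
  have [eta eta0 Heta] : exists2 eta : R, 0 < eta &
      forall u : E, `|u - u0| <= eta -> U' u.
    have : nbhs u0 U' by apply: open_nbhs_nbhs.
    move=> /nbhs_ballP[eta /= eta0 He].
    exists (eta / 2) => [|u uu]; first by rewrite divr_gt0.
    apply: He; rewrite -ball_normE /= distrC; apply: le_lt_trans uu _; lra.
  apply/nbhs_ballP; exists (eta / 2); first by rewrite /= divr_gt0.
  move=> t; rewrite -ball_normE /= => Ht.
  pose K := [set u : E | `|u - u0| <= eta].
  have KU u : K u -> `|u| < r by move=> /Heta /U'U.
  pose g u := u - psi u + t.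
  have Ku0 : K u0 by rewrite /K /= subrr normr0 ltW.
  have gK : set_fun K K g.
    move=> u Ku; rewrite /K /=.
    have -> : g u - u0 = (t - psi u0) - (psi u - psi u0 - (u - u0)).
      rewrite /g; move: (psi u) (psi u0) => v w.
      by apply/matrixP => i j; rewrite !mxE; ring.
    apply: le_trans (ler_normB _ _) _.
    have := Hpsi u u0 (KU _ Ku) (KU _ Ku0); rewrite distrC in Ht.
    by have : `|u - u0| <= eta by []; lra.
  pose f : {fun K >-> K} := HB.pack g (isFun.Build _ _ K K g gK).
  have h2 : 0 <= 1 / 2 :> R by lra.
  have fc : is_contraction f.
    exists (NngNum h2); split=> /=; first lra.
    move=> [x y] [/= Kx Ky].
    have -> : g x - g y = - (psi x - psi y - (x - y)).
      rewrite /g; move: (psi x) (psi y) => v w.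
      by apply/matrixP => i j; rewrite !mxE; ring.
    by rewrite normrN; apply: Hpsi; apply: KU.
  have clK : closed K.
    have -> : K = (fun u => `|u - u0|) @^-1` [set c : R | c <= eta] by [].
    apply: closed_comp; last exact: closed_le.
    move=> u _; have FF : Filter (nbhs u) := nbhs_filter u.
    apply/(@cvgrPdist_le _ _ _ (nbhs u) FF) => eps eps0; near=> w.
    apply: le_trans (ler_dist_dist _ _) _.
    have -> : u - u0 - (w - u0) = u - w by rewrite opprB subrKA.
    by near: w; apply: cvgr_dist_le.
  have [p Kp fp] := banach_fixed_point fc clK (ex_intro _ u0 Ku0).
  exists p; first exact: Heta.
  have {fp} : p = p - psi p + t := fp.
  move: (psi p) => q E2; apply/matrixP => i j.
  by have := congr1 (fun M : 'rV_m => M i j) E2; rewrite !mxE; lra.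
have Pc : continuous P.
  apply: bounded_linear_continuous; apply/linear_boundedP.
  exists CP; split=> [|k Ck x]; first exact: num_real.
  by apply: le_trans (HP x) _; rewrite ler_wpM2r // ltW.
exists (ball (phi 0) d1 `&` P @^-1` (psi @` U')).
  apply: openI; first exact: ball_open.
  by apply: open_comp => // x _; apply: Pc.
apply/seteqP; split=> [_ [u U'u <-]|x [[]]].
  have [u0 _ u2] := Hr u (U'U _ U'u).
  split; last exact: HS.
  split; last by exists u.
  by rewrite -ball_normE /= distrC.
rewrite -ball_normE /= distrC => xd [u U'u Eu] Sx.
have [u0 _ u2] := Hr u (U'U _ U'u).
exists u => //; apply: HI => //; exact: HS.
Unshelve. all: by end_near. Qed.
End Chart.

(** * Open orbits *)

Definition linear_map (R : realType) (E F : lmodType R) (f : E -> F) (lf : linear f) :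
  {linear E -> F} := HB.pack f (GRing.isLinear.Build _ _ _ _ _ lf).

Section InverseMatrix.
Variables (R : realType) (n : nat).

Lemma mulmx_bounded p q r : exists2 C : R, 0 <= C &
  forall (A : 'M[R]_(p, q)) (B : 'M[R]_(q, r)), `|A *m B| <= C * `|A| * `|B|.
Proof.
apply: mx_bilinear_bounded => A k B D.
  by rewrite mulmxDl scalemxAl.
by rewrite mulmxDr scalemxAr.
Qed.

Lemma unitmx_near (h0 : 'M[R]_n) : h0 \in unitmx -> exists2 d : R, 0 < d &
  forall h, `|h - h0| < d -> h \in unitmx /\ `|invmx h| <= 2 * `|invmx h0|.
Proof.
move=> h0u; have [C C0 HC] := mulmx_bounded n n n.
pose K := C * C * `|invmx h0|.
have K0 : 0 <= K by rewrite !mulr_ge0.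
have K1 : 0 < 2 * (K + 1) by lra.
have key A : `|A| < 1 / (2 * (K + 1)) -> forall B : 'M[R]_n,
    `|B *m (A *m invmx h0)| <= 1 / 2 * `|B|.
  rewrite ltr_pdivlMr // => Ah B; apply: le_trans (HC _ _) _.
  have := ler_wpM2l (mulr_ge0 C0 (normr_ge0 B)) (HC A (invmx h0)).
  move=> /le_trans; apply.
  have -> : C * `|B| * (C * `|A| * `|invmx h0|) = (K * `|A|) * `|B|.
    by rewrite /K; ring.
  by apply: ler_wpM2r => //; have := normr_ge0 A; lra.
exists (1 / (2 * (K + 1))) => [|h hh]; first by rewrite divr_gt0.
have H v : `|v| <= 1 / 2 * `|v| -> v = 0 :> 'M[R]_n.
  move=> H; apply/eqP; rewrite -normr_eq0; apply/eqP.
  by have := normr_ge0 v; lra.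
have hu : h \in unitmx.
  rewrite -row_free_unit -kermx_eq0; apply/eqP; apply: H.
  have E : kermx h = - (kermx h *m ((h - h0) *m invmx h0)).
    by rewrite mulmxBl mulmxV // mulmxBr mulmxA mulmx_ker mul0mx mulmx1 sub0r opprK.
  by rewrite {1}E normrN key.
split=> //.
have E : invmx h = invmx h0 - invmx h *m ((h - h0) *m invmx h0).
  by rewrite mulmxBl mulmxV // mulmxBr mulmxA mulVmx // mul1mx mulmx1 opprB subrKC.
have := key _ hh (invmx h).
have := ler_normB (invmx h0) (invmx h *m ((h - h0) *m invmx h0)).
by rewrite -E; lra.
Qed.

Lemma sdiff_invmx (h0 : 'M[R]_n) : h0 \in unitmx ->
  sdiff (@invmx _ n) (fun k => - (invmx h0 *m k *m invmx h0)) h0.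
Proof.
move=> h0u; have [C C0 HC] := mulmx_bounded n n n.
have [d d0 Hd] := unitmx_near h0u.
pose a := `|invmx h0|; have a0 : 0 <= a := normr_ge0 _.
have HC3 (x y z : 'M[R]_n) : `|x *m y *m z| <= C * C * `|x| * `|y| * `|z|.
  apply: le_trans (HC _ _) _.
  by have := ler_wpM2r (normr_ge0 z) (ler_wpM2l C0 (HC x y)); lra.
have cont h : `|h - h0| < d -> `|invmx h - invmx h0| <= 2 * C * C * a * a * `|h - h0|.
  move=> hd; have [hu hb] := Hd h hd.
  have -> : invmx h - invmx h0 = - (invmx h *m (h - h0) *m invmx h0).
    by rewrite mulmxBr mulVmx // mulmxBl mul1mx -mulmxA mulmxV // mulmx1 opprB.
  rewrite normrN; apply: le_trans (HC3 _ _ _) _.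
  have := ler_wpM2l (mulr_ge0 C0 C0) hb => H.
  have := ler_wpM2r (normr_ge0 (h - h0)) H => {}H.
  by have := ler_wpM2r a0 H; rewrite -/a; lra.
apply: (@sdiff_scale _ _ _ _ _ _ (C * C * (2 * a + a) * (2 * C * C * a * a))).
  by rewrite !mulr_ge0 // addr_ge0 // mulr_ge0.
move=> e e0; exists (Num.min d e) => [|h k]; first by rewrite lt_min d0.
rewrite !lt_min => /andP[hd he] /andP[kd ke].
have [hu hb] := Hd h hd; have [ku kb] := Hd k kd.
have -> : invmx h - invmx k - - (invmx h0 *m (h - k) *m invmx h0)
  = - ((invmx h - invmx h0) *m (h - k) *m invmx k)
    - invmx h0 *m (h - k) *m (invmx k - invmx h0).
  have -> : invmx h - invmx k = - (invmx h *m (h - k) *m invmx k).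
    by rewrite mulmxBr mulVmx // mulmxBl mul1mx -mulmxA mulmxV // mulmx1 opprB.
  rewrite ![(invmx h - invmx h0) *m _]mulmxBl [(_ - _) *m invmx k]mulmxBl.
  rewrite [invmx h0 *m (h - k) *m (_ - _)]mulmxBr.
  move: (invmx h *m _ *m _) (invmx h0 *m _ *m invmx k) (invmx h0 *m _ *m invmx h0).
  by move=> x y z; apply/matrixP => i j; rewrite !mxE; ring.
apply: le_trans (ler_normB _ _) _; rewrite normrN.
have H1 := HC3 (invmx h - invmx h0) (h - k) (invmx k).
have H2 := HC3 (invmx h0) (h - k) (invmx k - invmx h0).
have ch := cont h hd; have ck := cont k kd.
have B0 : 0 <= 2 * C * C * a * a by rewrite !mulr_ge0.
have e1 : `|invmx h - invmx h0| <= 2 * C * C * a * a * e.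
  by apply: le_trans ch _; apply: ler_wpM2l => //; apply: ltW.
have e2 : `|invmx k - invmx h0| <= 2 * C * C * a * a * e.
  by apply: le_trans ck _; apply: ler_wpM2l => //; apply: ltW.
have CC : 0 <= C * C by rewrite mulr_ge0.
have f1 : `|invmx h - invmx h0| * `|invmx k| <= 2 * C * C * a * a * e * (2 * a).
  exact: ler_pM.
have f2 : `|invmx h0| * `|invmx k - invmx h0| <= a * (2 * C * C * a * a * e).
  exact: ler_pM.
have g1 := ler_wpM2r (normr_ge0 (h - k)) (ler_wpM2l CC f1).
have g2 := ler_wpM2r (normr_ge0 (h - k)) (ler_wpM2l CC f2).
lra.
Qed.

End InverseMatrix.

Section OrbitMap.
Variables (R : realType) (n : nat) (mu : bilin R n).
Local Notation W := (bilin R n).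

(** The two arguments are separated in order to write the orbit map, quadratic in the
    matrix, as the diagonal of a bilinear map. *)
Definition pullback (h k : 'M[R]_n) : W :=
  of_bilinear (fun x y => bracket mu (h *m x) (k *m y)).

Lemma pullbackE h k x y : bracket (pullback h k) x y = bracket mu (h *m x) (k *m y).
Proof.
rewrite /pullback of_bilinearK // => [{}y|{}x] c a b.
  by rewrite mulmxDr -scalemxAr bracketDl bracketZl.
by rewrite mulmxDr -scalemxAr bracketDr bracketZr.
Qed.

Lemma pullback_linearl k : linear (pullback^~ k).
Proof.
move=> c g h; apply: bracket_inj => x y.
by rewrite bracketDm bracketZm !pullbackE mulmxDl -scalemxAl bracketDl bracketZl.
Qed.

Lemma pullback_linearr h : linear (pullback h).
Proof.
move=> c g k; apply: bracket_inj => x y.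
by rewrite bracketDm bracketZm !pullbackE mulmxDl -scalemxAl bracketDr bracketZr.
Qed.

Lemma bracket_mul (a : 'M[R]_n) (s : W) x y : bracket (a *m s) x y = a *m bracket s x y.
Proof. by rewrite /bracket mulmxA. Qed.

Lemma gl_act_pullback h : gl_act (invmx h) mu = invmx h *m pullback h h.
Proof.
by apply: bracket_inj => x y; rewrite gl_actE bracket_mul pullbackE invmxK.
Qed.

Variables (m : nat) (X : {linear 'rV[R]_m -> 'M[R]_n}).

(** The orbit is parametrized by the inverse of [1 + X u], which makes the derivative at 0
    the coboundary of [X u], without a sign. *)
Definition frame u : 'M[R]_n := 1%:M + X u.

Definition orbit_map u : W := gl_act (invmx (frame u)) mu.

Definition orbit_diff u v : W :=
  let h := frame u in
  - (invmx h *m X v *m invmx h) *m pullback h h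
  + invmx h *m (pullback (X v) h + pullback h (X v)).

Lemma orbit_diff_linear u : linear (orbit_diff u).
Proof.
move=> c v w; rewrite /orbit_diff linearD linearZ /=.
rewrite pullback_linearl pullback_linearr.
rewrite !(mulmxDr, mulmxDl, opprD, =^~ scalemxAr, =^~ scalemxAl, scalerDr).
rewrite -scalerN -scalemxAl.
repeat (move: (_ *m pullback _ _) => ?).
by apply/matrixP => i j; rewrite !mxE; ring.
Qed.

HB.instance Definition _ u := GRing.isLinear.Build _ _ _ _ _ (orbit_diff_linear u).

Lemma linear_sub (E F : lmodType R) (f : E -> F) : linear f -> forall x y, f (x - y) = f x - f y.
Proof.
move=> Hf x y; rewrite -[- y]scaleN1r addrC Hf scaleN1r addrC.
by [].
Qed.

Lemma sdiff_frame u : sdiff frame X u.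
Proof.
have := sdiffD (sdiff_cst (1%:M : 'M[R]_n) u) (sdiff_lin X u).
by apply: sdiff_ext => // v; rewrite add0r.
Qed.

Lemma orbit_map_sdiff u : frame u \in unitmx -> sdiff orbit_map (orbit_diff u) u.
Proof.
move=> hu; have bX : bounded_map X := mx_linear_bounded X.
pose inv_d (k : 'M[R]_n) := - (invmx (frame u) *m k *m invmx (frame u)).
have inv_dl : linear inv_d.
  move=> c v w; rewrite /inv_d mulmxDr mulmxDl opprD -scalemxAr -scalemxAl.
  by rewrite scalerN.
pose Id : {linear 'M[R]_n -> 'M[R]_n} :=
  linear_map inv_dl.
have bI : bounded_map inv_d := mx_linear_bounded Id.
have bIX : bounded_map (inv_d \o X) := mx_linear_bounded (Id \o X : {linear _ -> _}).
have sI : sdiff (fun v => invmx (frame v)) (inv_d \o X) u.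
  apply: (sdiff_comp bX bI (linear_sub inv_dl) (sdiff_frame u)).
  exact: sdiff_invmx.
have [C C0 HC] := mx_bilinear_bounded pullback_linearl pullback_linearr.
pose Cd v := pullback (X v) (frame u) + pullback (frame u) (X v).
have sC : sdiff (fun v => pullback (frame v) (frame v)) Cd u.
  apply: (sdiff_bilin (B := pullback) _ _ C0 HC bX bX (sdiff_frame u) (sdiff_frame u)).
    by move=> x y z; rewrite (linear_sub (pullback_linearl z)).
  by move=> x y z; rewrite (linear_sub (pullback_linearr z)).
have Cdl : linear Cd.
  move=> c v w; rewrite /Cd linearD linearZ /= pullback_linearl pullback_linearr.
  by rewrite scalerDr addrACA.
pose Cl : {linear 'rV[R]_m -> W} :=
  linear_map Cdl.
have bC : bounded_map Cd := mx_linear_bounded Cl.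
have [D D0 HD] := mulmx_bounded R n n (n * n).
have Dl (x y : 'M[R]_n) (z : W) : (x - y) *m z = x *m z - y *m z by rewrite mulmxBl.
have Dr (x y : W) (z : 'M[R]_n) : z *m (x - y) = z *m x - z *m y by rewrite mulmxBr.
have := sdiff_bilin Dl Dr D0 HD bIX bC sI sC.
by apply: sdiff_ext => // v; rewrite /orbit_map gl_act_pullback.
Qed.

Lemma orbit_diff0 v : alternating mu -> orbit_diff 0 v = d1 mu (X v).
Proof.
move=> A; apply: bracket_inj => x y.
rewrite /orbit_diff /frame linear0 addr0 invmx1 !mul1mx mulmx1.
rewrite !bracketDm mulNmx bracketNm bracket_mul !pullbackE !mul1mx d1E.
rewrite [bracket mu y _](alternatingC _ _ A).
vring.
Qed.

End OrbitMap.

Section Constraints.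
Variables (R : realType) (n : nat).
Local Notation W := (bilin R n).
Local Notation V := 'cV[R]_n.
Implicit Types (mu s t : W) (x y z : V).

Lemma bounded_mapD (E F : normedModType R) (f g : E -> F) :
  bounded_map f -> bounded_map g -> bounded_map (fun v => f v + g v).
Proof.
move=> [C C0 HC] [D D0 HD]; exists (C + D) => [|v]; first exact: addr_ge0.
apply: le_trans (ler_normD _ _) _; rewrite mulrDl.
by apply: lerD.
Qed.

Lemma bracket_mx_bounded y : exists2 C : R, 0 <= C &
  forall (t : W) (x : V), `|bracket t x y| <= C * `|t| * `|x|.
Proof.
apply: (mx_bilinear_bounded (B := fun (t : W) (x : V) => bracket t x y)).
  by move=> x c s t; rewrite bracketDm bracketZm.
by move=> t c u v; rewrite bracketDl bracketZl.
Qed.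

Lemma sdiff_bracket (f L : W -> V) y mu : bounded_map L -> sdiff f L mu ->
  let L' s := bracket s (f mu) y + bracket mu (L s) y in
  bounded_map L' /\ sdiff (fun t => bracket t (f t) y) L' mu.
Proof.
move=> bL Hf L'; have [C C0 HC] := bracket_mx_bounded y.
have bI : bounded_map (@id W) by exists 1 => // v; rewrite mul1r.
split; last first.
  apply: (sdiff_bilin (B := fun (t : W) (x : V) => bracket t x y) _ _ C0 HC bI bL) => //.
  - by move=> t s x; rewrite bracketBm.
  - by move=> u v t; rewrite bracketBl.
  - exact: (sdiff_lin (idfun : {linear W -> W})).
case: bL => D D0 HD; apply: bounded_mapD.
  exists (C * `|f mu|) => [|v]; first by rewrite mulr_ge0.
  by rewrite mulrAC; apply: HC.
exists (C * `|mu| * D) => [|v]; first by rewrite !mulr_ge0.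
apply: le_trans (HC _ _) _.
by have := ler_wpM2l (mulr_ge0 C0 (normr_ge0 mu)) (HD v); rewrite mulrA.
Qed.

Lemma sdiff_nbracket k (x : nat -> V) mu :
  bounded_map (dnbracket k mu ^~ x) /\
  sdiff (nbracket k ^~ x) (dnbracket k mu ^~ x) mu.
Proof.
elim: k => [|k [b IH]] /=; last exact: sdiff_bracket.
by split; [exists 0 => // v; rewrite normr0 mul0r|apply: sdiff_cst].
Qed.

Lemma dnbracket_linear k mu (x : nat -> V) : linear (dnbracket k mu ^~ x).
Proof.
move=> c s t; elim: k => [|k IH] /=; first by rewrite scaler0 addr0.
rewrite IH bracketDm bracketZm bracketDl bracketZl.
by rewrite scalerDr addrACA.
Qed.

Lemma diff_nbracket k (x : nat -> V) mu s :
  'd (fun t : W => nbracket k t x) mu s = dnbracket k mu s x.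
Proof.
have [b H] := sdiff_nbracket k x mu.
pose L : {linear W -> V} :=
  linear_map (dnbracket_linear k mu x).
by have [_ ->] := @sdiff_diff R W V _ L mu b H.
Qed.

Lemma Z2_nilP k mu s : Z2_nil k mu s <-> cocycle k mu s.
Proof.
by split=> [[A D N]|[A D N]]; split=> // x; have := N x; rewrite diff_nbracket.
Qed.

Lemma H2_nil_eq0P k mu : H2_nil_eq0 k mu <-> rigid_cocycles k mu.
Proof.
have B0 : B2 mu 0.
  exists 0 => //; apply: bracket_inj => x y.
  by rewrite d1E !mul0mx !bracket0r bracket0m !subr0.
have B2B s t : B2 mu s -> B2 mu t -> B2 mu (t - s).
  move=> [X _ <-] [Y _ <-]; exists (Y - X) => //.
  by rewrite (linear_sub (@d1_linear _ _ mu)).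
split=> [H s Zs|H].
  have : H2_nil k mu [set t | B2 mu (t - s)] by exists s => //; apply/Z2_nilP.
  by rewrite H => /= <-; rewrite /= subrr.
apply/seteqP; split=> [_ [s /Z2_nilP/H Bs <-]|_ ->] /=.
  apply/seteqP; split=> [t /= Bt|t Bt] /=; last exact: B2B.
  have Bs' : B2 mu (0 - s) by apply: B2B.
  by have := B2B _ _ Bs' Bt; rewrite sub0r opprK subrK.
exists 0; first by apply/Z2_nilP; apply: cocycle0.
by apply/seteqP; split=> t /=; rewrite subr0.
Qed.

Definition djacobiator mu s x y z : V :=
  (bracket s (bracket mu x y) z + bracket mu (bracket s x y) z)
  + (bracket s (bracket mu y z) x + bracket mu (bracket s y z) x)
  + (bracket s (bracket mu z x) y + bracket mu (bracket s z x) y).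

Lemma djacobiator_d2 mu s x y z : alternating mu -> alternating s ->
  djacobiator mu s x y z = - d2 mu s x y z.
Proof.
move=> A B; rewrite /djacobiator /d2.
rewrite [bracket s z x](alternatingC _ _ B) [bracket mu z x](alternatingC _ _ A).
rewrite !bracketNl.
rewrite [bracket mu (bracket s x y) z](alternatingC _ _ A).
rewrite [bracket mu (bracket s y z) x](alternatingC _ _ A).
rewrite [bracket mu (bracket s x z) y](alternatingC _ _ A).
vring.
Qed.

Lemma sdiff_eval x y mu : sdiff (fun t : W => bracket t x y) (fun s => bracket s x y) mu.
Proof.
have l : linear (fun t : W => bracket t x y).
  by move=> c s t; rewrite bracketDm bracketZm.
exact: (sdiff_lin (linear_map l : {linear W -> V})).
Qed.

Lemma sdiff_jacobiator x y z mu :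
  sdiff (fun t => jacobiator t x y z) (fun s => djacobiator mu s x y z) mu.
Proof.
have b u v : bounded_map (fun t : W => bracket t u v).
  have [C C0 HC] := bracket_mx_bounded v.
  exists (C * `|u|) => [|t]; first by rewrite mulr_ge0.
  by rewrite mulrAC.
have S u v w := (sdiff_bracket w (b u v) (sdiff_eval u v mu)).2.
exact: (sdiffD (sdiffD (S x y z) (S y z x)) (S z x y)).
Qed.

Lemma djacobiator_linear mu x y z : linear (fun s => djacobiator mu s x y z).
Proof.
move=> c s t; rewrite /djacobiator !(bracketDm, bracketZm, bracketDl, bracketZl).
vring.
Qed.

(** A direction which is not a cocycle is transverse to one of the equations of the
    variety. *)
Lemma noncocycle_constraint k mu s : nil_variety k mu -> ~ cocycle k mu s ->
  exists (g : W -> V) (Dg : {linear W -> V}),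
    [/\ sdiff g Dg mu, forall t, nil_variety k t -> g t = 0 & Dg s <> 0].
Proof.
move=> [[A _] _] nc; apply: contrapT => Hno.
have As : alternating s.
  move=> x; apply: contrapT => ne; apply: Hno.
  have l : linear (fun t : W => bracket t x x).
    by move=> c t u; rewrite bracketDm bracketZm.
  exists (fun t => bracket t x x),
    (linear_map l).
  by split=> //; [exact: sdiff_eval|move=> t [[]]].
apply: nc; split=> // [x y z|x]; apply: contrapT => ne; apply: Hno.
  exists (fun t => jacobiator t x y z), (linear_map (djacobiator_linear mu x y z)).
  split=> /=; [exact: sdiff_jacobiator|by move=> t [[]]|].
  by rewrite djacobiator_d2 // => /eqP; rewrite oppr_eq0 => /eqP.
exists (nbracket k ^~ x), (linear_map (dnbracket_linear k mu x)).
by split=> //=; [exact: (sdiff_nbracket _ _ _).2|move=> t []].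
Qed.

(** Equations of the variety are joined to [P] one at a time, each one cutting the kernel of
    the derivative [M] of the map [G] obtained so far, until [M] is injective. Then [G] is
    injective near [mu], and on the variety it depends on [P] only. *)
Lemma separation k mu m (P : {linear W -> 'rV[R]_m}) : nil_variety k mu ->
  (forall s, cocycle k mu s -> P s = 0 -> s = 0) ->
  exists2 d : R, 0 < d & forall x y : W, nil_variety k x -> nil_variety k y ->
    `|x - mu| < d -> `|y - mu| < d -> P x = P y -> x = y.
Proof.
move=> Nmu HP.
suff H N q (G : W -> 'rV[R]_q) (M : 'M[R]_(n * (n * n), q)) :
    (\rank (kermx M) <= N)%N -> sdiff G (fun s => mxvec s *m M) mu ->
    (forall x y : W, nil_variety k x -> nil_variety k y -> P x = P y -> G x = G y) ->
    (forall s, mxvec s *m M = 0 -> P s = 0) ->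
    exists2 d : R, 0 < d & forall x y : W, nil_variety k x -> nil_variety k y ->
      `|x - mu| < d -> `|y - mu| < d -> P x = P y -> x = y.
  pose M := lin1_mx (P \o vec_mx).
  have ME s : mxvec s *m M = P s by rewrite mul_rV_lin1 /= mxvecK.
  apply: (H _ m P M (leqnn _)) => // [|s]; last by rewrite ME.
  by apply: sdiff_ext (sdiff_lin P mu) => // s; rewrite ME.
elim: N q G M => [|N IH] q G M rkM HG GP MP.
  have freeM : row_free M.
    by rewrite -kermx_eq0 -mxrank_eq0 -leqn0.
  pose Q := vec_mx \o mulmxr (pinvmx M) : {linear 'rV[R]_q -> W}.
  have [C C0 HC] := mx_linear_bounded Q.
  have C1 : 0 < C + 1 by lra.
  have [e e0 ee] : exists2 e : R, 0 < e & e * (2 * (C + 1)) = 1.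
    exists (2 * (C + 1))^-1; first by rewrite invr_gt0 mulr_gt0.
    by rewrite mulVf // lt0r_neq0 // mulr_gt0.
  have [d d0 Hd] := HG e e0.
  exists d => // x y Nx Ny xd yd Pxy.
  have := Hd x y xd yd; rewrite (GP x y) // subrr sub0r normrN.
  have := HC (mxvec (x - y) *m M); rewrite /Q /= mulmxKp // mxvecK.
  move=> H1 H2; have D0 := normr_ge0 (x - y).
  have H3 := ler_wpM2l C0 H2; have H4 := mulr_ge0 (ltW e0) D0.
  have H5 : e * (2 * (C + 1)) * `|x - y| = `|x - y| by rewrite ee mul1r.
  by apply/eqP; rewrite -subr_eq0 -normr_eq0; apply/eqP; lra.
have [/eqP K0|/rowV0Pn[v]] := eqVneq (kermx M) 0.
  by apply: IH HG GP MP; rewrite (eqP K0) mxrank0.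
rewrite sub_kermx => /eqP vM v0.
pose s := vec_mx v : W.
have sM : mxvec s *m M = 0 by rewrite vec_mxK.
have [] := pselect (cocycle k mu s) => [Zs|/(noncocycle_constraint Nmu)].
  have : s = 0 by apply: HP => //; apply: MP.
  by move=> /(congr1 mxvec); rewrite vec_mxK linear0 => v00; rewrite v00 eqxx in v0.
move=> [g [Dg [sg g0 Dgs]]].
pose M2 := lin1_mx (trmx \o Dg \o vec_mx).
have M2E t : mxvec t *m M2 = (Dg t)^T by rewrite mul_rV_lin1 /= mxvecK.
have row_l : linear (fun A : 'rV[R]_q => row_mx A (0 : 'rV[R]_n)).
  by move=> c A B; rewrite scale_row_mx add_row_mx scaler0 addr0.
have row_r : linear (fun A : V => row_mx (0 : 'rV[R]_q) A^T).
  by move=> c A B; rewrite scale_row_mx add_row_mx scaler0 addr0 linearP.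
pose Rl : {linear 'rV[R]_q -> 'rV[R]_(q + n)} :=
  linear_map row_l.
pose Rr : {linear V -> 'rV[R]_(q + n)} :=
  linear_map row_r.
have bM : bounded_map (fun s : W => mxvec s *m M).
  exact: (mx_linear_bounded (mulmxr M \o mxvec : {linear W -> 'rV[R]_q})).
apply: (IH _ (fun t => row_mx (G t) (g t)^T) (row_mx M M2)).
- rewrite -ltnS; apply: leq_trans rkM; apply: rank_ltmx.
  rewrite ltmxE; apply/andP; split.
    by rewrite sub_kermx; have := mulmx_ker (row_mx M M2);
       rewrite mul_mx_row -row_mx0 => /eq_row_mx[-> _].
  apply/negP => H.
  have : (v <= kermx (row_mx M M2))%MS.
    by apply: submx_trans H; rewrite sub_kermx vM.
  rewrite sub_kermx mul_mx_row -row_mx0 => /eqP/eq_row_mx[_].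
  rewrite -[v]vec_mxK M2E => /(congr1 trmx); rewrite trmxK trmx0.
  exact: Dgs.
- have Sl := sdiff_comp bM (mx_linear_bounded Rl) (linear_sub row_l) HG (sdiff_lin Rl _).
  have Sr := sdiff_comp (mx_linear_bounded Dg) (mx_linear_bounded Rr)
    (linear_sub row_r) sg (sdiff_lin Rr _).
  apply: sdiff_ext (sdiffD Sl Sr) => t /=; rewrite add_row_mx addr0 add0r //.
  by rewrite mul_mx_row M2E.
- move=> x y Nx Ny Pxy; by rewrite (GP x y) // (g0 x) // (g0 y).
- move=> t; rewrite mul_mx_row -row_mx0 => /eq_row_mx[+ _]; exact: MP.
Qed.

End Constraints.

Section Charts.
Variables (R : realType) (n k m : nat).
Implicit Types mu nu : bilin R n.

(** The derivative of [u |-> (1 + X u)^-1 . mu] at 0 is the isomorphism [d1 mu \o X] onto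
    the cocycles, which contain the tangent directions of the variety. *)
Lemma orbit_chart mu : nil_variety k mu -> slice m k mu ->
  exists (U : set 'rV[R]_m) (phi : 'rV[R]_m -> bilin R n),
    [/\ open U /\ U 0 /\ phi 0 = mu, forall u, U u -> gl_orbit mu (phi u),
    {in U &, injective phi},
    forall u, U u -> differentiable phi u
      /\ forall v, {for u, continuous (fun w => 'd phi w v)}
    & (forall u, U u -> forall v, 'd phi u v = 0 -> v = 0)
  /\ forall U', open U' -> U' `<=` U ->
      exists2 O : set (bilin R n), open O & phi @` U' = O `&` nil_variety k].
Proof.
move=> Nmu [X [Xinj Xsurj]].
have A : alternating mu by case: Nmu => -[].
pose phi := orbit_map mu X.
have phi0 : phi 0 = mu.
  apply: bracket_inj => x y.
  by rewrite /phi /orbit_map /frame linear0 addr0 gl_actE invmxK invmx1 !mul1mx.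
pose dX : {linear 'rV[R]_m -> bilin R n} := orbit_diff mu X 0.
have dXE v : dX v = d1 mu (X v) by exact: orbit_diff0.
pose M := lin1_mx (mxvec \o dX).
have ME u : u *m M = mxvec (d1 mu (X u)) by rewrite mul_rV_lin1 /= dXE.
have freeM : row_free M.
  rewrite -kermx_eq0; apply/eqP/row_matrixP => i; rewrite row0; apply: Xinj.
  apply: (can_inj mxvecK); rewrite -ME linear0 -row_mul mulmx_ker row0.
  by [].
pose P := mulmxr (pinvmx M) \o mxvec : {linear bilin R n -> 'rV[R]_m}.
have PE u : P (d1 mu (X u)) = u by rewrite /P /= -ME mulmxKp.
have [d0 d00 Hu] := unitmx_near (unitmx1 R n).
have [C C0 HC] := mx_linear_bounded X.
have C1 : 0 < C + 1 by lra.
have frame_unit u : `|u| < d0 / (C + 1) -> frame X u \in unitmx.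
  rewrite ltr_pdivlMr // => ud; apply: (Hu _ _).1.
  rewrite /frame addrC addKr; apply: le_lt_trans (HC u) _.
  by have := normr_ge0 u; lra.
have orb u : `|u| < d0 / (C + 1) -> gl_orbit mu (phi u).
  by move=> /frame_unit fu; exists (invmx (frame X u)) => //=; rewrite unitmx_inv.
have [|u ud|v|u ud||U [oU Ud inj dif [imm img]]] :=
  @local_chart R m _ _ (nil_variety k) phi (orbit_diff mu X) P (d0 / (C + 1)).
- by rewrite divr_gt0.
- by apply: orbit_map_sdiff; apply: frame_unit.
- exact: etrans (congr1 P (dXE v)) (PE v).
- by apply: nil_variety_iso Nmu; apply/gl_orbitP; apply: orb.
- rewrite phi0; apply: separation => // s Zs Ps.
  have [u E] := Xsurj s Zs; move: Ps; rewrite E PE => ->.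
  by rewrite -dXE linear0.
exists U, phi; split=> //.
  by case: oU.
by move=> u /Ud; apply: orb.
Qed.

End Charts.

Section Rigidity.
Variables (R : realType) (n k : nat).
Implicit Types mu nu : bilin R n.

(** The hypothesis is invariant under isomorphism, so there is a chart at every point of
    the orbit. *)
Theorem rigid_of_rigid_cocycles mu :
  nil_variety k mu -> rigid_cocycles k mu -> rigid k mu.
Proof.
move=> Nmu Zmu; split=> //.
exists (\bigcup_(O in [set O : set (bilin R n) | open O /\ O `&` nil_variety k `<=` gl_orbit mu]) O).
  by apply: bigcup_open => O [].
apply/seteqP; split=> [nu onu|nu [Nnu [D [_ HD] Dnu]]]; last exact: HD.
have I : isomorphic mu nu by apply/gl_orbitP.
have Nnu := nil_variety_iso I Nmu; split=> //.
have [m sl] := slice_of_rigid (rigid_cocycles_iso I Zmu).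
have [U [phi [[oU [U0 phi0]] orb _ _ [_ img]]]] := orbit_chart Nnu sl.
have [D oD E] := img U oU (@subset_refl _ U).
exists D; last first.
  have : (phi @` U) nu by exists 0.
  by rewrite E => -[].
split=> // x; rewrite -E => -[u /orb/gl_orbitP J <-].
by apply/gl_orbitP; apply: isomorphic_trans I J.
Qed.

Theorem orbit_submanifold m mu :
  nil_variety k mu -> slice m k mu -> submanifold m (gl_orbit mu).
Proof.
move=> Nmu sl nu /gl_orbitP I.
have [U [phi [[oU [U0 phi0]] orb inj dif [imm img]]]] :=
  orbit_chart (nil_variety_iso I Nmu) (slice_iso I sl).
exists U, phi; split=> //; first by split=> //; exists 0.
move=> U' oU' U'U; have [D oD E] := img U' oU' U'U; exists D => //.
apply/seteqP; split=> [x|x [Dx /gl_orbitP J]]; last first.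
  by rewrite E; split=> //; apply: nil_variety_iso J Nmu.
move=> xU'; split; first by move: xU'; rewrite E => -[].
case: xU' => u /U'U/orb/gl_orbitP J <-.
by apply/gl_orbitP; apply: isomorphic_trans I J.
Qed.

End Rigidity.

(** * Signed formal sums and unit propagation *)

(** A linear form with coefficients 1 and -1: the pair [(b, z)] stands for [(-1) ^+ b] times
    the unknown [z]. *)
Definition lits (T : Type) := seq (bool * T).
Definition flip (T : Type) b (f : lits T) : lits T := [seq (b (+) l.1, l.2) | l <- f].

Section Eval.
Variables (F : numFieldType) (V : lmodType F) (T : eqType) (rho : T -> V).

Definition lit_val (l : bool * T) : V := (-1) ^+ l.1 *: rho l.2.
Definition ev (f : lits T) : V := \sum_(l <- f) lit_val l.

Lemma ev_nil : ev [::] = 0. Proof. exact: big_nil. Qed.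
Lemma ev_cat f g : ev (f ++ g) = ev f + ev g. Proof. exact: big_cat. Qed.
Lemma ev_flip b f : ev (flip b f) = (-1) ^+ b *: ev f.
Proof.
rewrite /ev big_map scaler_sumr; apply: eq_bigr => l _.
by rewrite /lit_val /= signr_addb scalerA.
Qed.
Lemma ev_flatten (I : Type) (r : seq I) (f : I -> lits T) :
  ev (flatten [seq f i | i <- r]) = \sum_(i <- r) ev (f i).
Proof. by elim: r => [|i r IH]; rewrite ?big_nil ?ev_nil // big_cons /= ev_cat IH. Qed.

Definition cancel (f : lits T) : lits T :=
  foldr (fun l g => if (~~ l.1, l.2) \in g then rem (~~ l.1, l.2) g else l :: g) [::] f.

Lemma ev_cancel f : ev (cancel f) = ev f.
Proof.
elim: f => //= l f IH; rewrite [RHS]/ev big_cons -/(ev f) -IH.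
case: ifP => [lf|_]; last by rewrite /ev big_cons.
rewrite /ev [in RHS](perm_big _ (perm_to_rem lf)) /= big_cons addrA.
by rewrite /lit_val /= -scalerDl; case: l.1; rewrite /= ?expr0 ?expr1 ?addrN ?addNr scale0r add0r.
Qed.

Definition unit_lit (f : lits T) : option T :=
  if f is (b, v) :: _ then
    if all (fun l => l.2 == v) f && (count (fun l => l.1) f != count (fun l => ~~ l.1) f)
    then Some v else None
  else None.

(** In characteristic 0, the only unknown of a vanishing form that is not yet known to vanish
    vanishes too. Repeated use of this single rule solves the linear systems below. *)
Definition propagate_form (zs : seq T) (f : lits T) : seq T :=
  if unit_lit [seq l <- f | l.2 \notin zs] is Some v then v :: zs else zs.

Definition propagate (n : nat) (fs : seq (lits T)) (zs : seq T) : seq T :=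
  iter n (fun z => foldl propagate_form z fs) zs.

Lemma unit_litP f v : unit_lit f = Some v -> ev f = 0 -> rho v = 0.
Proof.
case: f => // -[b w] f; rewrite /unit_lit; case: ifP => // /andP[/allP al ne] [<-{v}].
set g := (b, w) :: f in al ne *.
have -> : ev g = ((count (fun l => ~~ l.1) g)%:R - (count (fun l => l.1) g)%:R) *: rho w.
  rewrite /ev; move: g al {ne} => {b f}.
  elim=> [|l g IH] al; first by rewrite big_nil subrr scale0r.
  rewrite big_cons IH => [|x xg]; last by apply: al; rewrite inE xg orbT.
  rewrite /lit_val (eqP (al l (mem_head _ _))) -scalerDl /= !natrD.
  by congr (_ *: _); case: l.1; rewrite /= ?expr0 ?expr1; ring.
move=> /eqP; rewrite scaler_eq0 subr_eq0 eqr_nat eq_sym (negbTE ne) /=.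
by move/eqP.
Qed.

Lemma propagateP n fs zs : (forall f, f \in fs -> ev f = 0) ->
  (forall z, z \in zs -> rho z = 0) ->
  forall z, z \in propagate n fs zs -> rho z = 0.
Proof.
move=> H; rewrite /propagate; elim: n zs => [|n IH] zs Hz //=.
move: (iter n _ zs) (IH zs Hz) => {}zs {}Hz {IH}.
elim: fs H zs Hz => [|f fs IH] H zs Hz //=.
apply: IH => [g gf|z]; first by apply: H; rewrite inE gf orbT.
rewrite /propagate_form; case E: unit_lit => [v|]; last exact: Hz.
rewrite inE => /predU1P[->|]; last exact: Hz.
apply: (unit_litP E); rewrite -[RHS](H f (mem_head _ _)).
rewrite /ev big_filter [RHS](bigID (fun l => l.2 \notin zs)) /=.
rewrite [X in _ = _ + X]big1 ?addr0 // => l /negbNE /Hz.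
by rewrite /lit_val => ->; rewrite scaler0.
Qed.

End Eval.

(** * Structure tables with entries 1 and -1 *)

(** The entry [(i, j, (b, k))] stands for the bracket [(-1) ^+ b e_k] of [e_i] and [e_j]. *)
Definition table := seq (nat * nat * (bool * nat)).

Definition of_lits (F : fieldType) (t : table) : bilin F 7 := of_table
  [seq ((inord e.1.1, inord e.1.2),
        if e.2.1 then - evec F (inord e.2.2) else evec F (inord e.2.2)) | e <- t].

Definition brk (t : table) (i j : nat) : lits nat :=
  flatten [seq (if (e.1.1 == i) && (e.1.2 == j) then [:: e.2] else [::])
    ++ (if (e.1.1 == j) && (e.1.2 == i) then flip true [:: e.2] else [::]) | e <- t].

Definition table_ok (t : table) :=
  all (fun e => [&& e.1.1 < 7, e.1.2 < 7 & e.2.2 < 7]%N) t.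

(** A vector each coordinate of which is a linear form in the unknowns. *)
Definition fvec (T : Type) := nat -> lits T.

Section Formal.
Variables (t : table) (T : Type).

Definition fadd (U U' : fvec T) : fvec T := fun l => U l ++ U' l.
Definition fopp (U : fvec T) : fvec T := fun l => flip true (U l).
(* the brackets of e_i with U and of U with e_h in the algebra of the table *)
Definition fbrl i (U : fvec T) : fvec T := fun l =>
  flatten [seq flatten [seq (if x.2 == l then flip x.1 (U m) else [::]) | x <- brk t i m]
    | m <- iota 0 7].
Definition fbrr (U : fvec T) h : fvec T := fun l =>
  flatten [seq flatten [seq (if x.2 == l then flip x.1 (U m) else [::]) | x <- brk t m h]
    | m <- iota 0 7].
Definition flin (A : nat -> fvec T) (c : lits nat) : fvec T := fun l =>
  flatten [seq flip x.1 (A x.2 l) | x <- c].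

End Formal.

Definition key3 := (nat * nat * nat)%type.
Definition fs (i j : nat) : fvec key3 := fun k =>
  if (i < j)%N then [:: (false, (i, j, k))]
  else if (j < i)%N then [:: (true, (j, i, k))] else [::].
Definition fX (j : nat) : fvec (nat * nat) := fun k => [:: (false, (k, j))].

Section Forms.
Variable t : table.
Let s2 (c : lits nat) j := flin (fs^~ j) c.
Let brk2 (c : lits nat) k : lits nat :=
  flatten [seq flip x.1 (brk t x.2 k) | x <- c].

Definition d2_fvec i j k : fvec key3 :=
  fadd (fadd (fadd (fbrl t i (fs j k)) (fopp (fbrl t j (fs i k))))
             (fadd (fbrl t k (fs i j)) (fopp (s2 (brk t i j) k))))
       (fadd (s2 (brk t i k) j) (fopp (s2 (brk t j k) i))).

Definition dn_fvec i j k h : fvec key3 :=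
  fadd (s2 (brk2 (brk t i j) k) h)
    (fbrr t (fadd (s2 (brk t i j) k) (fbrr t (fs i j) k)) h).

Definition d1_fvec i j : fvec (nat * nat) :=
  fadd (fadd (fbrl t i (fX j)) (fopp (fbrl t j (fX i)))) (fopp (flin fX (brk t i j))).

Definition over (T : Type) (f : nat -> seq T) : seq T := flatten [seq f i | i <- iota 0 7].

Definition cocycle_forms : seq (lits key3) :=
  [seq f <- over (fun i => over (fun j => over (fun k => over (fun l =>
        if (i < j < k)%N then [:: d2_fvec i j k l] else [::]))))
     ++ over (fun i => over (fun j => if (i < j)%N then over (fun k => over (fun h =>
          over (fun l => [:: dn_fvec i j k h l]))) else [::]))
  | f != [::]].

Definition d1_forms : seq (lits (nat * nat)) :=
  over (fun i => over (fun j => over (fun l =>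
    if (i < j)%N then [:: d1_fvec i j l] else [::]))).

(** Combinations of equations in which enough unknowns cancel for the propagation to
    proceed. *)
Definition d1_combos (cs : seq (lits key3)) : seq (lits (nat * nat)) :=
  [seq cancel (flatten [seq flip x.1 (d1_fvec x.2.1.1 x.2.1.2 x.2.2) | x <- c]) | c <- cs].

Definition covers (T : eqType) (zs ks : seq T) := all (fun z => z \in zs) ks.

Definition keys3 : seq key3 :=
  over (fun i => over (fun j => over (fun k => if (i < j)%N then [:: (i, j, k)] else [::]))).
Definition keys2 : seq (nat * nat) := over (fun i => over (fun j => [:: (i, j)])).

(** [P] lists the pivots among the coordinates of a cocycle, [Fr] the entries of a matrix
    that vanish on the slice, and [cs] the auxiliary combinations of equations. *)
Definition slice_check (P : seq key3) (Fr : seq (nat * nat)) (cs : seq (lits key3)) :=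
  [&& table_ok t,
      all (fun p => (p.1 < 7) && (p.2 < 7))%N Fr,
      covers (propagate 6 cocycle_forms P) keys3,
      all (fun c => all (fun x : bool * key3 => [&& x.2.1.1 < 7, x.2.1.2 < 7 & x.2.2 < 7]%N) c) cs &
      covers (propagate 8 (d1_forms ++ d1_combos cs) Fr) keys2].
End Forms.

Definition t137B : table := [:: (0,1,(false,4)); (0,4,(false,6)); (2,3,(false,5));
  (2,5,(false,6)); (1,3,(false,6))]%N.
Definition t137B1 : table := [:: (0,2,(false,4)); (0,3,(false,5)); (0,4,(false,6));
  (1,2,(true,5)); (1,3,(false,4)); (1,5,(false,6)); (2,3,(false,6))]%N.
Definition t247 (b : bool) : table := [:: (0,1,(false,3)); (0,2,(false,4)); (0,3,(false,5));
  (1,3,(false,5)); (1,4,(false,6)); (2,3,(false,6)); (2,4,(b,5))]%N.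

(** Witnesses for [slice_check]; the numbers 36, 36, 38 and 38 of pivots are the dimensions
    of the four orbits. *)
Definition P137B : seq key3 := [:: (0,1,1); (0,1,4); (0,1,5); (0,1,6); (0,2,4); (0,2,5);
  (0,2,6); (0,3,4); (0,3,5); (0,3,6); (0,4,6); (0,5,6); (0,6,6); (1,2,5); (1,2,6); (1,3,1);
  (1,3,4); (1,3,5); (1,3,6); (1,4,4); (1,4,6); (1,5,4); (1,6,4); (2,3,1); (2,3,2); (2,3,3);
  (2,3,5); (2,3,6); (2,4,5); (2,4,6); (2,5,3); (2,5,5); (2,5,6); (3,5,6); (4,5,6); (5,6,6)]%N.
Definition Fr137B : seq (nat * nat) := [:: (1,0); (4,0); (4,2); (4,4); (5,1); (5,2); (6,0);
  (6,1); (6,2); (6,3); (6,4); (6,5); (6,6)]%N.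
Definition cs137B : seq (lits key3) := [:: [:: (false,(2,3,5)); (false,(2,5,6))]]%N.
Lemma check137B : slice_check t137B P137B Fr137B cs137B.
Proof. by vm_compute. Qed.

Definition P137B1 : seq key3 := [:: (0,1,4); (0,1,5); (0,1,6); (0,2,0); (0,2,4); (0,2,6);
  (0,3,4); (0,3,5); (0,3,6); (0,4,1); (0,4,4); (0,4,5); (0,4,6); (0,5,6); (1,2,2); (1,2,3);
  (1,2,4); (1,2,5); (1,2,6); (1,3,5); (1,3,6); (1,4,4); (1,4,6); (1,5,4); (1,5,6); (1,6,5);
  (2,3,6); (2,4,6); (2,5,5); (2,5,6); (2,6,6); (3,4,6); (3,5,5); (3,5,6); (3,6,5); (4,5,6)]%N.
Definition Fr137B1 : seq (nat * nat) := [:: (3,1); (3,3); (4,0); (4,1); (4,2); (4,3); (4,5);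
  (5,1); (6,0); (6,1); (6,2); (6,3); (6,4)]%N.
Definition cs137B1 : seq (lits key3) := [:: [:: (false,(0,4,6)); (false,(0,2,4));
  (true,(2,3,6))]; [:: (false,(0,2,4)); (true,(1,3,4)); (true,(1,2,5))]; [:: (false,(0,2,5));
  (true,(1,3,5)); (false,(1,2,4))]]%N.
Lemma check137B1 : slice_check t137B1 P137B1 Fr137B1 cs137B1.
Proof. by vm_compute. Qed.

Definition P247H : seq key3 := [:: (0,1,2); (0,1,4); (0,1,5); (0,1,6); (0,2,1); (0,2,3);
  (0,2,4); (0,2,5); (0,2,6); (0,3,3); (0,3,5); (0,3,6); (0,4,5); (0,4,6); (1,2,4); (1,2,5);
  (1,2,6); (1,3,1); (1,3,3); (1,3,5); (1,3,6); (1,4,3); (1,4,4); (1,4,5); (1,4,6); (1,6,5);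
  (2,3,0); (2,3,5); (2,3,6); (2,4,0); (2,4,2); (2,4,3); (2,4,4); (2,4,5); (2,4,6); (3,4,6);
  (4,6,5); (4,6,6)]%N.
Definition Fr247H : seq (nat * nat) := [:: (3,0); (3,2); (3,3); (5,0); (5,1); (5,2); (5,3);
  (6,0); (6,1); (6,2); (6,3)]%N.
Definition cs247H : seq (lits key3) := [:: [:: (false,(0,3,5)); (true,(1,3,5));
  (false,(0,1,3))]; [:: (false,(0,2,4)); (false,(2,4,5))]; [:: (false,(0,4,5)); (true,(0,3,6));
  (false,(2,4,6)); (true,(0,2,3))]; [:: (false,(0,1,4)); (false,(1,3,6))]]%N.
Lemma check247H : slice_check (t247 false) P247H Fr247H cs247H.
Proof. by vm_compute. Qed.

Definition P247H1 : seq key3 := [:: (0,1,2); (0,1,3); (0,1,4); (0,1,5); (0,1,6); (0,2,0);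
  (0,2,5); (0,2,6); (0,3,3); (0,3,5); (0,3,6); (0,4,3); (0,4,5); (0,4,6); (0,5,5); (1,2,3);
  (1,2,4); (1,2,5); (1,2,6); (1,3,3); (1,3,5); (1,3,6); (1,4,0); (1,4,5); (1,4,6); (1,5,6);
  (1,6,5); (2,3,4); (2,3,5); (2,3,6); (2,4,0); (2,4,5); (2,4,6); (3,4,6); (3,6,6); (4,5,5);
  (4,5,6); (4,6,6)]%N.
Definition Fr247H1 : seq (nat * nat) := [:: (0,0); (3,2); (4,2); (5,0); (5,1); (5,2); (6,0);
  (6,1); (6,2); (6,3); (6,4)]%N.
Definition cs247H1 : seq (lits key3) := [:: [:: (true,(0,3,5)); (false,(1,3,5))];
  [:: (false,(0,2,4)); (true,(2,4,5))]; [:: (false,(0,4,5)); (false,(0,3,6)); (false,(2,4,6));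
  (true,(0,2,3))]; [:: (false,(0,1,4)); (false,(1,3,6))]]%N.
Lemma check247H1 : slice_check (t247 true) P247H1 Fr247H1 cs247H1.
Proof. by vm_compute. Qed.

(** * Soundness of the propagation *)

Section Soundness.
Variables (F : numFieldType) (t : table).
Hypothesis tok : table_ok t.
Local Notation V := 'cV[F]_7.
Local Notation mu := (of_lits F t).
Local Notation e i := (evec F (@inord 6 i)).

Lemma sum_iota7 (G : nat -> V) : \sum_(i < 7) G i = \sum_(m <- iota 0 7) G m.
Proof. by rewrite -(big_mkord predT) /index_iota subn0. Qed.

Lemma vec_iota (u : V) : u = \sum_(m <- iota 0 7) u (inord m) 0 *: e m.
Proof.
rewrite -sum_iota7 {1}[u]colvecE; apply: eq_bigr => i _.
by rewrite inord_val.
Qed.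

Lemma evec_coord i j : (i < 7)%N -> (j < 7)%N -> e i (inord j) 0 = (i == j)%:R.
Proof.
move=> i7 j7; rewrite /evec mxE eqxx andbT -val_eqE /= !inordK //.
by rewrite eq_sym.
Qed.

Lemma bracket_brk i j : (i < 7)%N -> (j < 7)%N ->
  bracket mu (e i) (e j) = ev (fun k => e k) (brk t i j).
Proof.
move=> i7 j7; rewrite /of_lits /of_table of_bilinearK => [|y k a b|x k a b].
- rewrite /brk ev_flatten big_map !big_seq; apply: eq_bigr => x xt.
  have /and3P[x1 x2 x3] := allP tok x xt.
  rewrite ev_cat !evec_coord //= scalerBl.
  have sgE : (if x.2.1 then - e x.2.2 else e x.2.2) = lit_val (fun k => e k) x.2.
    by rewrite /lit_val; case: x.2.1; rewrite ?expr0 ?expr1 ?scaleN1r ?scale1r.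
  have one (b : bool) : b%:R *: lit_val (fun k => e k) x.2
      = ev (fun k => e k) (if b then [:: x.2] else [::]).
    by case: b; rewrite ?scale1r ?scale0r ?ev_nil // /ev big_seq1.
  rewrite sgE -!natrM !mulnb !one; congr (_ + _).
    by rewrite [(x.1.1 == _)]eq_sym [(x.1.2 == _)]eq_sym.
  rewrite [(x.1.1 == _)]eq_sym [(x.1.2 == _)]eq_sym andbC.
  case: ifP => _; rewrite ?ev_nil ?oppr0 //.
  by rewrite /ev !big_seq1 /lit_val /= signrN scaleNr.
- rewrite scaler_sumr -big_split; apply: eq_bigr => x _ /=.
  by rewrite !mxE scalerA -scalerDl; congr (_ *: _); ring.
- rewrite scaler_sumr -big_split; apply: eq_bigr => x' _ /=.
  by rewrite !mxE scalerA -scalerDl; congr (_ *: _); ring.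
Qed.

Definition short (c : lits nat) := all (fun x => x.2 < 7)%N c.

Lemma short_flip b c : short (flip b c) = short c.
Proof. by rewrite /short all_map; apply: eq_all. Qed.

Lemma short_brk i j : short (brk t i j).
Proof.
have := tok; rewrite /short /brk /table_ok.
elim: t => //= y t' IH /andP[/and3P[_ _ y3] /IH H]; rewrite !all_cat H andbT.
by do 2![case: ifP => _ /=]; rewrite ?y3.
Qed.

Variables (T : eqType) (rho : T -> F^o).

(* [U] lists the coordinates of [u] as linear forms in [rho] *)
Definition represents (U : fvec T) (u : V) :=
  forall l, (l < 7)%N -> u (inord l) 0 = ev rho (U l).

Lemma rep_add U u U' u' : represents U u -> represents U' u' ->
  represents (fadd U U') (u + u').
Proof. by move=> H H' l l7; rewrite mxE H // H' // -ev_cat. Qed.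

Lemma rep_opp U u : represents U u -> represents (fopp U) (- u).
Proof. by move=> H l l7; rewrite mxE H // /fopp ev_flip expr1 scaleN1r. Qed.

Lemma rep_comb (c : nat -> lits nat) U u : (forall m, short (c m)) -> represents U u ->
  represents
    (fun l => flatten [seq flatten [seq (if x.2 == l then flip x.1 (U m) else [::]) | x <- c m]
                      | m <- iota 0 7])
    (\sum_(m <- iota 0 7) u (inord m) 0 *: ev (fun k => e k) (c m)).
Proof.
move=> cs H l l7; rewrite ev_flatten summxE !big_seq; apply: eq_bigr => m.
rewrite mem_iota add0n => m7.
rewrite ev_flatten mxE H // /ev summxE mulr_sumr big_seq [RHS]big_seq.
apply: eq_bigr => x xc; have x7 : (x.2 < 7)%N by exact: (allP (cs m)).
rewrite -/(ev rho _) /lit_val mxE evec_coord //.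
case: eqP => _; last by rewrite big_nil !mulr0.
by rewrite -[RHS]/(ev rho _) ev_flip mulr1 mulrC.
Qed.

Lemma rep_brl i U u : (i < 7)%N -> represents U u ->
  represents (fbrl t i U) (bracket mu (e i) u).
Proof.
move=> i7 H; rewrite [X in represents _ (bracket _ _ X)]vec_iota bracket_sumr.
rewrite (eq_big_seq (fun m => u (inord m) 0 *: ev (fun k => e k) (brk t i m))) => [|m].
  by apply: rep_comb => // m; apply: short_brk.
by rewrite mem_iota add0n => m7; rewrite bracketZr bracket_brk.
Qed.

Lemma rep_brr h U u : (h < 7)%N -> represents U u ->
  represents (fbrr t U h) (bracket mu u (e h)).
Proof.
move=> i7 H; rewrite [X in represents _ (bracket _ X _)]vec_iota bracket_suml.
rewrite (eq_big_seq (fun m => u (inord m) 0 *: ev (fun k => e k) (brk t m h))) => [|m].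
  by apply: rep_comb => // m; apply: short_brk.
by rewrite mem_iota add0n => m7; rewrite bracketZl bracket_brk.
Qed.

Lemma rep_lin (A : nat -> fvec T) (a : nat -> V) c : short c ->
  (forall i, (i < 7)%N -> represents (A i) (a i)) ->
  represents (flin A c) (ev a c).
Proof.
move=> /allP sc H l l7; rewrite /flin ev_flatten /ev summxE.
rewrite big_seq [RHS]big_seq; apply: eq_bigr => x xc.
by rewrite -/(ev rho _) /lit_val mxE ev_flip H //; apply: sc.
Qed.

End Soundness.

Section CocycleForms.
Variables (F : numFieldType) (t : table).
Hypothesis tok : table_ok t.
Local Notation V := 'cV[F]_7.
Local Notation mu := (of_lits F t).
Local Notation e i := (evec F (@inord 6 i)).
Implicit Types (s : bilin F 7) (X : 'M[F]_7).

Lemma linear_ev (f : V -> V) (T : eqType) (a : T -> V) (c : lits T) : linear f ->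
  f (ev a c) = ev (f \o a) c.
Proof.
move=> lf; have f0 : f 0 = 0 by have := lf (-1) 0 0; rewrite !scaleN1r oppr0 addr0 addNr.
rewrite /ev; elim: c => [|l c IH]; first by rewrite !big_nil.
by rewrite !big_cons /lit_val lf IH.
Qed.

Definition scoord s (p : key3) : F^o := bracket s (e p.1.1) (e p.1.2) (inord p.2) 0.
Definition Xcoord X (p : nat * nat) : F^o := X (inord p.1) (inord p.2).

Lemma rep_fs s i j : alternating s -> represents (scoord s) (fs i j) (bracket s (e i) (e j)).
Proof.
move=> A l l7; rewrite /fs; case: ltngtP => [ij|ji|->]; rewrite /ev ?big_seq1 ?big_nil.
- by rewrite /lit_val expr0 scale1r.
- by rewrite /lit_val expr1 scaleN1r /scoord /= (alternatingC _ _ A) mxE.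
- by rewrite A mxE.
Qed.

Lemma bracket_linearl s y : linear (bracket s ^~ y).
Proof. by move=> c u v; rewrite bracketDl bracketZl. Qed.

Lemma rep_s2 s (c : lits nat) j : short c -> alternating s ->
  represents (scoord s) (flin (fs^~ j) c) (bracket s (ev (fun k => e k) c) (e j)).
Proof.
move=> sc A; rewrite (linear_ev _ _ (bracket_linearl s (e j))).
by apply: rep_lin => // i _; apply: rep_fs.
Qed.

Lemma d2_rep s i j k : (i < 7)%N -> (j < 7)%N -> (k < 7)%N -> alternating s ->
  represents (scoord s) (d2_fvec t i j k) (d2 mu s (e i) (e j) (e k)).
Proof.
move=> i7 j7 k7 A; rewrite /d2 (bracket_brk F tok i7 j7) (bracket_brk F tok i7 k7).
rewrite (bracket_brk F tok j7 k7).
set S1 := bracket s (ev _ (brk t i j)) _; set S2 := bracket s (ev _ (brk t i k)) _.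
set S3 := bracket s (ev _ (brk t j k)) _.
rewrite -[_ - S1]addrA -[_ + S2 - S3]addrA.
have sb a b : short (brk t a b) by apply: short_brk.
have sL a b c : (a < 7)%N ->
    represents (scoord s) (fbrl t a (fs b c)) (bracket mu (e a) (bracket s (e b) (e c))).
  by move=> a7; apply: rep_brl => //; apply: rep_fs.
have s2 a b c : represents (scoord s) (flin (fs^~ c) (brk t a b))
    (bracket s (ev (fun k => e k) (brk t a b)) (e c)) by apply: rep_s2.
apply: rep_add; last by apply: rep_add; [|apply: rep_opp]; apply: s2.
apply: rep_add; last by apply: rep_add; [apply: sL|apply: rep_opp; apply: s2].
by apply: rep_add; [|apply: rep_opp]; apply: sL.
Qed.

Lemma bracket_ev c k : (k < 7)%N -> short c ->
  bracket mu (ev (fun k => e k) c) (e k)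
  = ev (fun k => e k) (flatten [seq flip x.1 (brk t x.2 k) | x <- c]).
Proof.
move=> k7 sc; rewrite (linear_ev _ _ (bracket_linearl mu (e k))) ev_flatten.
rewrite /ev big_seq [RHS]big_seq; apply: eq_bigr => x xc.
rewrite -/(ev _ _) ev_flip /lit_val /= (bracket_brk F tok) //.
exact: (allP sc).
Qed.

Lemma short_bind c k : short (flatten [seq flip x.1 (brk t x.2 k) | x <- c]).
Proof.
rewrite /short; elim: c => //= x c IH.
by rewrite all_cat IH andbT; rewrite -/(short _) short_flip short_brk.
Qed.

Lemma dn_rep s i j k h : (i < 7)%N -> (j < 7)%N -> (k < 7)%N -> (h < 7)%N ->
  alternating s ->
  represents (scoord s) (dn_fvec t i j k h)
    (dnbracket 3 mu s (fun p => e (nth 0%N [:: i; j; k; h] p))).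
Proof.
move=> i7 j7 k7 h7 A /=; rewrite bracket0l addr0.
rewrite (bracket_brk F tok i7 j7) bracket_ev ?short_brk //.
apply: rep_add; first by apply: rep_s2 => //; apply: short_bind.
apply: rep_brr => //; apply: rep_add; first by apply: rep_s2 => //; apply: short_brk.
by apply: rep_brr => //; apply: rep_fs.
Qed.

Lemma rep_fX X j : (j < 7)%N -> represents (Xcoord X) (fX j) (X *m e j).
Proof.
move=> j7 l l7; rewrite /evec -colE mxE /ev /fX big_seq1 /lit_val expr0 scale1r.
by [].
Qed.

Lemma d1_rep X i j : (i < 7)%N -> (j < 7)%N ->
  represents (Xcoord X) (d1_fvec t i j) (bracket (d1 mu X) (e i) (e j)).
Proof.
move=> i7 j7; rewrite d1E (bracket_brk F tok i7 j7).
apply: rep_add; first apply: rep_add.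
- by apply: rep_brl => //; apply: rep_fX.
- by apply: rep_opp; apply: rep_brl => //; apply: rep_fX.
apply: rep_opp; rewrite (linear_ev _ _ (_ : linear (mulmx X))).
  by apply: rep_lin => [|l l7]; [apply: short_brk|apply: rep_fX].
by move=> c u v; rewrite mulmxDr scalemxAr.
Qed.

Lemma overP (T : eqType) (g : nat -> seq T) f : f \in over g ->
  exists2 i, (i < 7)%N & f \in g i.
Proof. by case/flatten_mapP => i; rewrite mem_iota => i7 fi; exists i. Qed.

Lemma mem_over (T : eqType) (g : nat -> seq T) f i :
  (i < 7)%N -> f \in g i -> f \in over g.
Proof. by move=> i7 fi; apply/flatten_mapP; exists i => //; rewrite mem_iota. Qed.

Lemma cocycle_forms_eq0 s f : cocycle 3 mu s -> f \in cocycle_forms t ->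
  ev (scoord s) f = 0.
Proof.
move=> [A D N]; rewrite mem_filter => /andP[_]; rewrite mem_cat => /orP[].
  case/overP => i i7; case/overP => j j7; case/overP => k k7; case/overP => l l7.
  case: ifP => // _; rewrite inE => /eqP ->.
  by rewrite -(d2_rep i7 j7 k7 A l7) D mxE.
move=> /overP[i i7] /overP[j j7]; case: ifP => // _.
move=> /overP[k k7] /overP[h h7] /overP[l l7]; rewrite inE => /eqP ->.
by rewrite -(dn_rep i7 j7 k7 h7 A l7) N mxE.
Qed.

Lemma mem_keys3 i j k : (i < j)%N -> (j < 7)%N -> (k < 7)%N -> (i, j, k) \in keys3.
Proof.
move=> ij j7 k7; apply: (mem_over (i := i)); first exact: ltn_trans ij j7.
by apply: (mem_over (i := j)) => //; apply: (mem_over (i := k)) => //; rewrite ij inE.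
Qed.

Lemma keys2P z : z \in keys2 -> (z.1 < 7)%N && (z.2 < 7)%N.
Proof.
rewrite /keys2; case/overP => i i7; case/overP => j j7.
by rewrite inE => /eqP ->; rewrite /= i7.
Qed.

Lemma scoord_eq0 s : alternating s -> (forall p, p \in keys3 -> scoord s p = 0) -> s = 0.
Proof.
move=> A H; apply: bracket_ext => i j; rewrite bracket0m; apply/colP => l.
have := rep_fs i j A (ltn_ord l); rewrite /evec !inord_val => ->.
rewrite mxE /fs; case: ltngtP => [ij|ji|_]; rewrite /ev ?big_nil // big_seq1;
  by rewrite /lit_val H ?scaler0 // mem_keys3.
Qed.

Lemma scoord_linear p : linear (scoord^~ p).
Proof. by move=> c s u; rewrite /scoord bracketDm bracketZm !mxE. Qed.

(** Propagation shows that a cocycle with vanishing coordinates [P] vanishes, and that a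
    matrix with vanishing coordinates [Fr] and zero coboundary vanishes. With as many
    coordinates outside [Fr] as in [P], both injections are bijections. *)
Lemma slice_of_check P Fr cs : slice_check t P Fr cs ->
  let S := [seq z <- keys2 | z \notin Fr] in
  uniq S -> size S = size P -> nil_variety 3 mu -> slice (size P) 3 mu.
Proof.
move=> /and5P[_ /allP HF /allP cov3 /allP Hcs /allP cov2] S uS sS Nmu.
set m := size P.
have A : alternating mu by case: Nmu => -[].
pose Xf (u : 'rV[F]_m) := \sum_(p < m) u 0 p *:
  delta_mx (inord (nth (0, 0)%N S p).1) (inord (nth (0, 0)%N S p).2) : 'M[F]_7.
have Xl : linear Xf.
  move=> c u v; rewrite /Xf scaler_sumr -big_split; apply: eq_bigr => p _ /=.
  by rewrite !mxE scalerDl scalerA.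
pose X : {linear 'rV[F]_m -> 'M[F]_7} := HB.pack Xf (GRing.isLinear.Build _ _ _ _ _ Xl).
have Slt z : z \in S -> (z.1 < 7)%N && (z.2 < 7)%N.
  by rewrite mem_filter => /andP[_ /keys2P].
have XE u z : (z.1 < 7)%N -> (z.2 < 7)%N ->
    Xcoord (X u) z = \sum_(p < m) u 0 p * (z == nth (0, 0)%N S p)%:R.
  move=> z1 z2; rewrite /Xcoord /= /Xf summxE; apply: eq_bigr => p _.
  have pS : (p < size S)%N by rewrite sS.
  have /andP[p1 p2] := Slt _ (mem_nth (0, 0)%N pS).
  rewrite !mxE; congr (_ * _); rewrite -!val_eqE /= !inordK //.

have Xinj u : d1 mu (X u) = 0 -> u = 0.
  move=> E.
  have X0 z : z \in keys2 -> Xcoord (X u) z = 0.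
    move=> zk; apply: (propagateP (rho := Xcoord (X u))) (cov2 z zk) => [f|y yF].
      have d0 i j l : (i < 7)%N -> (j < 7)%N -> (l < 7)%N ->
          ev (Xcoord (X u)) (d1_fvec t i j l) = 0.
        by move=> i7 j7 l7; rewrite -(d1_rep _ i7 j7 l7) E bracket0m mxE.
      rewrite mem_cat => /orP[|].
        rewrite /d1_forms; case/overP => i i7; case/overP => j j7; case/overP => l l7.
        by case: ifP => // _; rewrite inE => /eqP ->; apply: d0.
      case/mapP => c cc ->; rewrite ev_cancel ev_flatten big_seq; apply: big1 => x xc.
      have /and3P[x1 x2 x3] := allP (Hcs c cc) x xc.
      by rewrite ev_flip d0 // scaler0.
    have /andP[y1 y2] := HF y yF; rewrite XE //; apply: big1 => p _.
    have pS : (p < size S)%N by rewrite sS.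
    have := mem_nth (0, 0)%N pS; rewrite mem_filter => /andP[+ _].
    by case: eqP => [<-|]; rewrite ?yF ?mulr0.
  apply/rowP => p; rewrite mxE.
  have pS : (p < size S)%N by rewrite sS.
  have /andP[p1 p2] := Slt _ (mem_nth (0, 0)%N pS).
  have : Xcoord (X u) (nth (0, 0)%N S p) = 0.
    by apply: X0; have := mem_nth (0, 0)%N pS; rewrite mem_filter => /andP[].
  rewrite XE // (bigD1 p) //= eqxx mulr1 big1 ?addr0 // => q qp.
  by rewrite nth_uniq ?sS // -val_eqE /= eq_sym in qp *; rewrite (negbTE qp) mulr0.
have s0 s : cocycle 3 mu s -> (forall p, p \in P -> scoord s p = 0) -> s = 0.
  move=> Zs HsP; apply: scoord_eq0; first by case: Zs.
  move=> z zk; apply: (propagateP (rho := scoord s)) (cov3 z zk) => [f|//].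
  exact: cocycle_forms_eq0.
pose piv s : 'rV[F]_m := \row_(q < m) scoord s (nth (0, 0, 0)%N P q).
have pl : linear (fun u => piv (d1 mu (X u))).
  move=> c u v; apply/rowP => q.
  by rewrite !mxE linearP d1_linear scoord_linear.
pose pL : {linear 'rV[F]_m -> 'rV[F]_m} := HB.pack (fun u => piv (d1 mu (X u)))
  (GRing.isLinear.Build _ _ _ _ _ pl).
have piv0 s : cocycle 3 mu s -> piv s = 0 -> s = 0.
  move=> Zs E; apply: s0 => // p pP.
  have := congr1 (fun r : 'rV_m => r 0 (Ordinal (etrans (index_mem p P) pP))) E.
  by rewrite !mxE /= nth_index.
pose N := lin1_mx pL.
have NE u : u *m N = piv (d1 mu (X u)) by rewrite mul_rV_lin1.
have Nu : N \in unitmx.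
  rewrite -row_free_unit -kermx_eq0; apply/eqP/row_matrixP => i; rewrite row0.
  apply: Xinj; apply: piv0; first exact: cocycle_d1.
  by rewrite -NE -row_mul mulmx_ker row0.
exists X; split=> // s Zs; exists (piv s *m invmx N).
set u := _ *m _; apply/eqP; rewrite -subr_eq0; apply/eqP; apply: piv0.
  exact: (cocycleB Zs (cocycle_d1 (X u) Nmu)).
have Eu : piv (d1 mu (X u)) = piv s by rewrite -NE /u mulmxKV.
apply/rowP => q; have := congr1 (fun r : 'rV_m => r 0 q) Eu; rewrite !mxE => E2.
have := scoord_linear (nth (0, 0, 0)%N P q) (-1) (d1 mu (X u)) s.
rewrite (scaleN1r (d1 _ _)) [- _ + s]addrC => ->.
by rewrite E2 scaleN1r addNr.
Qed.

End CocycleForms.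

(** * Algebras with a basis of seven vectors *)

Notation o7 i := (@inord 6 i).

Section Frames.
Variable F : fieldType.
Local Notation V := 'cV[F]_7.
Local Notation E i := (evec F (o7 i)).
Implicit Types (mu nu : bilin F 7) (x y u v : V).

Lemma bracket_of_table t x y : bracket (of_table t) x y =
  \sum_(e <- t) (x e.1.1 0 * y e.1.2 0 - x e.1.2 0 * y e.1.1 0) *: e.2 :> V.
Proof.
rewrite /of_table of_bilinearK // => [{}y|{}x] k a b;
  rewrite scaler_sumr -big_split; apply: eq_bigr => e _ /=;
  by rewrite !mxE scalerA -scalerDl; congr (_ *: _); ring.
Qed.

Lemma alternating_of_table t : alternating (of_table t : bilin F 7).
Proof.
by move=> x; rewrite bracket_of_table big1 // => e _; rewrite mulrC subrr scale0r.
Qed.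

Lemma Ecoord i j : (i < 7)%N -> (j < 7)%N -> E i (o7 j) 0 = (i == j)%:R.
Proof.
move=> i7 j7; rewrite /evec mxE eqxx andbT -val_eqE /= !inordK //.
by rewrite eq_sym.
Qed.

Lemma vec7P u v : (forall k, (k < 7)%N -> u (o7 k) 0 = v (o7 k) 0) -> u = v.
Proof. by move=> H; apply/colP => k; rewrite -[k]inord_val H. Qed.

Lemma vec7E u : u = \sum_(k < 7) u (o7 k) 0 *: E k.
Proof. by rewrite {1}[u]colvecE; apply: eq_bigr => k _; rewrite inord_val. Qed.

Lemma sum7 (W : nmodType) (f : nat -> W) : \sum_(i < 7) f i =
  f 0%N + f 1%N + f 2%N + f 3%N + f 4%N + f 5%N + f 6%N.
Proof. by rewrite !big_ord_recr big_ord0 /= add0r. Qed.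

Definition frame_mx (b : seq V) : 'M[F]_7 := \matrix_(i, j) (nth 0 b j) i 0.

Lemma frame_mxE b j : (j < 7)%N -> frame_mx b *m E j = nth 0 b j.
Proof. by move=> j7; rewrite /evec -colE; apply/colP => i; rewrite !mxE inordK. Qed.

Lemma frame_mx_sum b u : frame_mx b *m u = \sum_(k < 7) u (o7 k) 0 *: nth 0 b k.
Proof.
rewrite {1}[u]vec7E mulmx_sumr; apply: eq_bigr => k _.
by rewrite -scalemxAr frame_mxE.
Qed.

Lemma frame_mx7 b0 b1 b2 b3 b4 b5 b6 u : frame_mx [:: b0; b1; b2; b3; b4; b5; b6] *m u =
  u (o7 0) 0 *: b0 + u (o7 1) 0 *: b1 + u (o7 2) 0 *: b2 + u (o7 3) 0 *: b3
  + u (o7 4) 0 *: b4 + u (o7 5) 0 *: b5 + u (o7 6) 0 *: b6.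
Proof.
by rewrite frame_mx_sum
  (sum7 (fun k => u (o7 k) 0 *: nth 0 [:: b0; b1; b2; b3; b4; b5; b6] k)).
Qed.

Lemma frame_mx7_eq0 b0 b1 b2 b3 b4 b5 b6 u : frame_mx [:: b0; b1; b2; b3; b4; b5; b6] *m u = 0 ->
  forall i, u (o7 0) 0 * b0 i 0 + u (o7 1) 0 * b1 i 0 + u (o7 2) 0 * b2 i 0
    + u (o7 3) 0 * b3 i 0 + u (o7 4) 0 * b4 i 0 + u (o7 5) 0 * b5 i 0 + u (o7 6) 0 * b6 i 0 = 0.
Proof.
by move=> /(congr1 (fun v : V => v _ 0)) H i; rewrite -[RHS](ent0 F i) -(H i) frame_mx7 !entE.
Qed.

Definition frame_hom nu mu (b : seq V) := forall i j, (i < j < 7)%N ->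
  bracket mu (nth 0 b i) (nth 0 b j) = frame_mx b *m bracket nu (E i) (E j).

Lemma frame_morph nu mu b : alternating nu -> alternating mu -> frame_hom nu mu b ->
  forall x y, frame_mx b *m bracket nu x y = bracket mu (frame_mx b *m x) (frame_mx b *m y).
Proof.
move=> An Am H x y; set g := frame_mx b.
have HE i j : (i < 7)%N -> (j < 7)%N ->
    g *m bracket nu (E i) (E j) = bracket mu (g *m E i) (g *m E j).
  move=> i7 j7; rewrite !frame_mxE //; case: (ltngtP i j) => [ij|ji|->].
  - by rewrite H // ij.
  - rewrite (alternatingC _ _ An) (alternatingC _ _ Am) mulmxN H //.
    by rewrite ji.
  - by rewrite An Am mulmx0.
rewrite [x]vec7E [y]vec7E bracket_suml !mulmx_sumr bracket_suml.
apply: eq_bigr => i _; rewrite !bracket_sumr mulmx_sumr; apply: eq_bigr => j _.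
by rewrite !(bracketZl, bracketZr) -!scalemxAr !(bracketZl, bracketZr) HE.
Qed.

Lemma unitmx_inj (g : 'M[F]_7) : (forall x, g *m x = 0 -> x = 0) -> g \in unitmx.
Proof.
move=> H; rewrite -unitmx_tr -row_free_unit -kermx_eq0; apply/eqP/row_matrixP => i.
rewrite row0; apply: trmx_inj; rewrite trmx0; apply: H.
rewrite -{1}[g]trmxK -trmx_mul -row_mul mulmx_ker.
by rewrite row0 trmx0.
Qed.

Lemma frame_iso nu mu b : alternating nu -> alternating mu -> frame_hom nu mu b ->
  (forall x, frame_mx b *m x = 0 -> x = 0) -> isomorphic nu mu.
Proof.
move=> An Am H I; exists (frame_mx b); first exact: unitmx_inj.
exact: frame_morph.
Qed.

End Frames.

Section Vec7.
Variable F : fieldType.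
Local Notation E i := (evec F (o7 i)).
Definition vec7 (l : seq F) : 'cV[F]_7 := \col_i nth 0 l i.

Lemma vec7_coord l k : (k < 7)%N -> vec7 l (o7 k) 0 = nth 0 l k.
Proof. by move=> k7; rewrite mxE inordK. Qed.

Definition minor2 (x y : 'cV[F]_7) i j := x (o7 i) 0 * y (o7 j) 0 - x (o7 j) 0 * y (o7 i) 0.

Lemma minor2E j k i l : (i < 7)%N -> (j < 7)%N -> (k < 7)%N -> (l < 7)%N ->
  minor2 (E i) (E j) k l = ((i == k) && (j == l))%:R - ((i == l) && (j == k))%:R.
Proof. by move=> i7 j7 k7 l7; rewrite /minor2 !Ecoord // -!natrM !mulnb. Qed.

Definition low p (x : 'cV[F]_7) := forall k, (k < p)%N -> x (o7 k) 0 = 0.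

Lemma low_le p q x : (p <= q)%N -> low q x -> low p x.
Proof. by move=> pq H k kp; apply: H; apply: leq_trans kp pq. Qed.

Lemma low0 p : low p (0 : 'cV[F]_7). Proof. by move=> k _; rewrite mxE. Qed.
Lemma lowD p (u v : 'cV[F]_7) : low p u -> low p v -> low p (u + v).
Proof. by move=> H K k kp; rewrite mxE H // K // addr0. Qed.
Lemma lowZ p a (u : 'cV[F]_7) : low p u -> low p (a *: u).
Proof. by move=> H k kp; rewrite mxE H // mulr0. Qed.
Lemma lowN p (u : 'cV[F]_7) : low p u -> low p (- u).
Proof. by move=> H k kp; rewrite mxE H // oppr0. Qed.
Lemma low_E p k : (p <= k < 7)%N -> low p (E k).
Proof.
case/andP=> pk k7 j jp; rewrite Ecoord ?gtn_eqF ?(leq_trans jp) //.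
exact: ltnW (leq_ltn_trans pk k7).
Qed.
Lemma low7 (u : 'cV[F]_7) : low 7 u -> u = 0.
Proof. by move=> H; apply: vec7P => k k7; rewrite H // mxE. Qed.

Lemma nil3_low (mu : bilin F 7) p q : (forall x y, low p (bracket mu x y)) ->
  (forall x y, low p x -> low q (bracket mu x y)) ->
  (forall x y, low q x -> bracket mu x y = 0) ->
  forall x : nat -> 'cV[F]_7, nbracket 3 mu x = 0.
Proof. by move=> H1 H2 H3 x /=; apply: H3; apply: H2; apply: H1. Qed.
Definition central (mu : bilin F 7) x := forall y, bracket mu x y = 0.

Lemma central_r (mu : bilin F 7) x y : alternating mu -> central mu y -> bracket mu x y = 0.
Proof. by move=> A C; rewrite (alternatingC _ _ A) C oppr0. Qed.

End Vec7.
Arguments minor2 {F} x y (i j)%_N.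

Ltac low_tac := let k := fresh "k" in move=> k;
  (do 7?[case: k => [|k]; first by rewrite vec7_coord]); by [].

Ltac coords := let k := fresh "k" in let k7 := fresh "k7" in
  apply: vec7P => k k7; rewrite ?entE ?vec7_coord ?Ecoord //;
  move: k k7 => -[|[|[|[|[|[|[|//]]]]]]] _ //=.

Definition zsimp (R : comNzRingType) (V : lmodType R) := (@mulr1n R, @mulr0n R, @subr0 R, @sub0r R,
  @oppr0 R, @mulr0 R, @mul0r R, @mulr1 R, @mul1r R, @addr0 R, @add0r R, @scale0r R V,
  @scale1r R V, @addr0 V, @add0r V, @scaleN1r R V).

Ltac hom_tac TE := let i := fresh "i" in let j := fresh "j" in
  move=> i j /andP[]; rewrite TE frame_mx7 !vec7_coord //= !zsimp;
  (do 7?[case: i => [|i]] => //); (do 7?[case: j => [|j]] => // _ _);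
  rewrite !minor2E //= ?zsimp //; exact: central_r.

Section Families.
Variable F : fieldType.
Local Notation V := 'cV[F]_7.
Local Notation E i := (evec F (o7 i)).
Implicit Types x y : V.

(** Three generators, the middle step spanned by e_3 and e_4, with e_5, e_6 and the bracket
    of e_1 and e_2 central. The Jacobi identity is the symmetry in e_1 and e_2 of the
    pair of quadratic forms q, r. *)
Definition T322 (p5 p6 m1 m2 m3 m4 q1 r1 q2 r2 q3 r3 : F) : bilin F 7 := of_table
  [:: (o7 0, o7 1, E 3); (o7 0, o7 2, E 4); (o7 1, o7 2, p5 *: E 5 + p6 *: E 6);
      (o7 0, o7 3, m1 *: E 5 + m2 *: E 6); (o7 0, o7 4, m3 *: E 5 + m4 *: E 6);
      (o7 1, o7 3, q1 *: E 5 + r1 *: E 6); (o7 1, o7 4, q2 *: E 5 + r2 *: E 6);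
      (o7 2, o7 3, q2 *: E 5 + r2 *: E 6); (o7 2, o7 4, q3 *: E 5 + r3 *: E 6)].

Lemma T322E p5 p6 m1 m2 m3 m4 q1 r1 q2 r2 q3 r3 x y :
  bracket (T322 p5 p6 m1 m2 m3 m4 q1 r1 q2 r2 q3 r3) x y = vec7
    [:: 0; 0; 0; minor2 x y 0 1; minor2 x y 0 2;
      p5 * minor2 x y 1 2 + m1 * minor2 x y 0 3 + m3 * minor2 x y 0 4 + q1 * minor2 x y 1 3 + q2 * (minor2 x y 1 4 + minor2 x y 2 3) + q3 * minor2 x y 2 4;
      p6 * minor2 x y 1 2 + m2 * minor2 x y 0 3 + m4 * minor2 x y 0 4 + r1 * minor2 x y 1 3 + r2 * (minor2 x y 1 4 + minor2 x y 2 3) + r3 * minor2 x y 2 4].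
Proof.
rewrite bracket_of_table !big_cons big_nil /= -!/(minor2 x y _ _).
by coords; ring.
Qed.

Lemma T322_level p5 p6 m1 m2 m3 m4 q1 r1 q2 r2 q3 r3 u z : low 3 u ->
  bracket (T322 p5 p6 m1 m2 m3 m4 q1 r1 q2 r2 q3 r3) u z = vec7
    [:: 0; 0; 0; 0; 0;
      - (u (o7 3) 0 * (m1 * z (o7 0) 0 + q1 * z (o7 1) 0 + q2 * z (o7 2) 0)
         + u (o7 4) 0 * (m3 * z (o7 0) 0 + q2 * z (o7 1) 0 + q3 * z (o7 2) 0));
      - (u (o7 3) 0 * (m2 * z (o7 0) 0 + r1 * z (o7 1) 0 + r2 * z (o7 2) 0)
         + u (o7 4) 0 * (m4 * z (o7 0) 0 + r2 * z (o7 1) 0 + r3 * z (o7 2) 0))].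
Proof.
move=> H; rewrite T322E; coords; rewrite /minor2 ?(H 0%N) ?(H 1%N) ?(H 2%N) //; ring.
Qed.

Lemma T322_low p5 p6 m1 m2 m3 m4 q1 r1 q2 r2 q3 r3 x y :
  low 3 (bracket (T322 p5 p6 m1 m2 m3 m4 q1 r1 q2 r2 q3 r3) x y).
Proof. by rewrite T322E; low_tac. Qed.

Lemma T322_nil p5 p6 m1 m2 m3 m4 q1 r1 q2 r2 q3 r3 :
  nil_variety 3 (T322 p5 p6 m1 m2 m3 m4 q1 r1 q2 r2 q3 r3).
Proof.
split; first (split; first exact: alternating_of_table).
  move=> x y z; rewrite /jacobiator ![bracket _ (bracket _ _ _) _]T322_level; try exact: T322_low.
  by rewrite !T322E; coords; rewrite ?vec7_coord //= /minor2; ring.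
apply: (nil3_low (p := 3) (q := 5)) => [x y|x y lx|x y lx]; first exact: T322_low.
  by rewrite T322_level //; low_tac.
rewrite T322_level; last exact: low_le lx.
by rewrite (lx 3%N) // (lx 4%N) //; coords; ring.
Qed.

(** Four generators, middle step spanned by e_4 and e_5, on which e_0 and e_1 act as a dual
    basis. The Jacobi identity is the symmetry in e_0 and e_1 of the brackets s, t, u. *)
Definition T421 (s1 s2 t1 t2 u1 u2 p q d : F) : bilin F 7 := of_table
  [:: (o7 0, o7 2, s1 *: E 4 + t1 *: E 5); (o7 0, o7 3, s2 *: E 4 + t2 *: E 5);
      (o7 1, o7 2, t1 *: E 4 + u1 *: E 5); (o7 1, o7 3, t2 *: E 4 + u2 *: E 5);
      (o7 0, o7 1, p *: E 4 + q *: E 5); (o7 2, o7 3, d *: E 6);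
      (o7 0, o7 4, E 6); (o7 1, o7 5, E 6)].

Lemma T421E s1 s2 t1 t2 u1 u2 p q d x y :
  bracket (T421 s1 s2 t1 t2 u1 u2 p q d) x y = vec7
    [:: 0; 0; 0; 0; s1 * minor2 x y 0 2 + s2 * minor2 x y 0 3 + t1 * minor2 x y 1 2 + t2 * minor2 x y 1 3 + p * minor2 x y 0 1;
      t1 * minor2 x y 0 2 + t2 * minor2 x y 0 3 + u1 * minor2 x y 1 2 + u2 * minor2 x y 1 3 + q * minor2 x y 0 1;
      d * minor2 x y 2 3 + minor2 x y 0 4 + minor2 x y 1 5].
Proof.
rewrite bracket_of_table !big_cons big_nil /= -!/(minor2 x y _ _).
by coords; ring.
Qed.

Lemma T421_level s1 s2 t1 t2 u1 u2 p q d u z : low 4 u ->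
  bracket (T421 s1 s2 t1 t2 u1 u2 p q d) u z = vec7
    [:: 0; 0; 0; 0; 0; 0; - (u (o7 4) 0 * z (o7 0) 0 + u (o7 5) 0 * z (o7 1) 0)].
Proof.
move=> H; rewrite T421E; coords;
  rewrite /minor2 ?(H 0%N) ?(H 1%N) ?(H 2%N) ?(H 3%N) //; ring.
Qed.

Lemma T421_low s1 s2 t1 t2 u1 u2 p q d x y :
  low 4 (bracket (T421 s1 s2 t1 t2 u1 u2 p q d) x y).
Proof. by rewrite T421E; low_tac. Qed.

Lemma T421_nil s1 s2 t1 t2 u1 u2 p q d : nil_variety 3 (T421 s1 s2 t1 t2 u1 u2 p q d).
Proof.
split; first (split; first exact: alternating_of_table).
  move=> x y z; rewrite /jacobiator ![bracket _ (bracket _ _ _) _]T421_level; try exact: T421_low.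
  by rewrite !T421E; coords; rewrite ?vec7_coord //= /minor2; ring.
apply: (nil3_low (p := 4) (q := 6)) => [x y|x y lx|x y lx]; first exact: T421_low.
  by rewrite T421_level //; low_tac.
rewrite T421_level; last exact: low_le lx.
by rewrite (lx 4%N) // (lx 5%N) //; coords; ring.
Qed.

(** In both families below, eps is the square of the generator of a quadratic algebra: its
    product gives the brackets of e_0, e_1 with e_2, e_3 here, and the brackets of e_1, e_2
    with e_3, e_4 in the second family. *)
Definition N137 (eps : F) : bilin F 7 := of_table
  [:: (o7 0, o7 2, E 4); (o7 0, o7 3, E 5); (o7 1, o7 2, E 5); (o7 1, o7 3, eps *: E 4);
      (o7 0, o7 4, E 6); (o7 1, o7 5, eps *: E 6); (o7 2, o7 3, E 6)].

Lemma N137E eps x y :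
  bracket (N137 eps) x y = vec7
    [:: 0; 0; 0; 0; minor2 x y 0 2 + eps * minor2 x y 1 3; minor2 x y 0 3 + minor2 x y 1 2; minor2 x y 0 4 + eps * minor2 x y 1 5 + minor2 x y 2 3].
Proof.
rewrite bracket_of_table !big_cons big_nil /= -!/(minor2 x y _ _).
by coords; ring.
Qed.

Definition N247 (eps : F) : bilin F 7 := of_table
  [:: (o7 0, o7 1, E 3); (o7 0, o7 2, E 4); (o7 0, o7 3, E 5); (o7 1, o7 3, E 5);
      (o7 1, o7 4, E 6); (o7 2, o7 3, E 6); (o7 2, o7 4, eps *: E 5)].

Lemma N247E eps x y :
  bracket (N247 eps) x y = vec7
    [:: 0; 0; 0; minor2 x y 0 1; minor2 x y 0 2; minor2 x y 0 3 + minor2 x y 1 3 + eps * minor2 x y 2 4; minor2 x y 1 4 + minor2 x y 2 3].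
Proof.
rewrite bracket_of_table !big_cons big_nil /= -!/(minor2 x y _ _).
by coords; ring.
Qed.

End Families.

Ltac ker_tac TE K := rewrite -[RHS]K !TE frame_mx7 !vec7_coord //= /minor2;
  rewrite ?vec7_coord ?entE ?Ecoord //=; try by vring.

Section FrameLemmas.
Variable F : fieldType.
Local Notation V := 'cV[F]_7.
Local Notation E i := (evec F (o7 i)).
Implicit Types (mu : bilin F 7) (x y : V).

Lemma T322_frame mu b0 b1 b2 b3 b4 b5 b6 p5 p6 m1 m2 m3 m4 q1 r1 q2 r2 q3 r3 :
  alternating mu -> central mu b5 -> central mu b6 ->
  bracket mu b0 b1 = b3 -> bracket mu b0 b2 = b4 ->
  bracket mu b1 b2 = p5 *: b5 + p6 *: b6 ->
  bracket mu b0 b3 = m1 *: b5 + m2 *: b6 -> bracket mu b0 b4 = m3 *: b5 + m4 *: b6 ->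
  bracket mu b1 b3 = q1 *: b5 + r1 *: b6 -> bracket mu b1 b4 = q2 *: b5 + r2 *: b6 ->
  bracket mu b2 b3 = q2 *: b5 + r2 *: b6 -> bracket mu b2 b4 = q3 *: b5 + r3 *: b6 ->
  bracket mu b3 b4 = 0 ->
  frame_hom (T322 p5 p6 m1 m2 m3 m4 q1 r1 q2 r2 q3 r3) mu [:: b0; b1; b2; b3; b4; b5; b6].
Proof.
by move=> A c5 c6 H01 H02 H12 H03 H04 H13 H14 H23 H24 H34; hom_tac T322E.
Qed.

Lemma T421_frame mu b0 b1 b2 b3 b4 b5 b6 s1 s2 t1 t2 u1 u2 p q d :
  alternating mu -> central mu b6 ->
  bracket mu b0 b1 = p *: b4 + q *: b5 ->
  bracket mu b0 b2 = s1 *: b4 + t1 *: b5 -> bracket mu b0 b3 = s2 *: b4 + t2 *: b5 ->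
  bracket mu b1 b2 = t1 *: b4 + u1 *: b5 -> bracket mu b1 b3 = t2 *: b4 + u2 *: b5 ->
  bracket mu b2 b3 = d *: b6 ->
  bracket mu b0 b4 = b6 -> bracket mu b0 b5 = 0 ->
  bracket mu b1 b4 = 0 -> bracket mu b1 b5 = b6 ->
  bracket mu b2 b4 = 0 -> bracket mu b2 b5 = 0 ->
  bracket mu b3 b4 = 0 -> bracket mu b3 b5 = 0 -> bracket mu b4 b5 = 0 ->
  frame_hom (T421 s1 s2 t1 t2 u1 u2 p q d) mu [:: b0; b1; b2; b3; b4; b5; b6].
Proof.
by move=> A c6 H01 H02 H03 H12 H13 H23 H04 H05 H14 H15 H24 H25 H34 H35 H45; hom_tac T421E.
Qed.

Lemma frame_kernel nu mu b x y : alternating nu -> alternating mu -> frame_hom nu mu b ->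
  frame_mx b *m x = 0 -> frame_mx b *m bracket nu x y = 0.
Proof. by move=> An Am H Hx; rewrite (frame_morph An Am H) Hx bracket0l. Qed.

(** A morphism out of a nilpotent algebra is injective as soon as it is injective
    on the centre, here spanned by the last basis vectors; hence the relations of
    the table and the independence of the central images already give an isomorphism. *)
Lemma N137_iso eps mu b0 b1 b2 b3 b4 b5 b6 : eps != 0 ->
  alternating mu -> central mu b6 -> b6 != 0 ->
  bracket mu b0 b1 = 0 -> bracket mu b0 b2 = b4 -> bracket mu b0 b3 = b5 ->
  bracket mu b1 b2 = b5 -> bracket mu b1 b3 = eps *: b4 -> bracket mu b2 b3 = b6 ->
  bracket mu b0 b4 = b6 -> bracket mu b0 b5 = 0 ->
  bracket mu b1 b4 = 0 -> bracket mu b1 b5 = eps *: b6 ->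
  bracket mu b2 b4 = 0 -> bracket mu b2 b5 = 0 ->
  bracket mu b3 b4 = 0 -> bracket mu b3 b5 = 0 -> bracket mu b4 b5 = 0 ->
  isomorphic (N137 eps) mu.
Proof.
move=> e0 A c6 z0 H01 H02 H03 H12 H13 H23 H04 H05 H14 H15 H24 H25 H34 H35 H45.
have An : alternating (N137 eps) by apply: alternating_of_table.
have H : frame_hom (N137 eps) mu [:: b0; b1; b2; b3; b4; b5; b6].
  by hom_tac N137E.
apply: (frame_iso An A H) => x Hx.
have K y := frame_kernel y An A H Hx.
have K2 y w := frame_kernel w An A H (K y).
have c0 c : c *: b6 = 0 -> c = 0.
  by move/eqP; rewrite scaler_eq0 (negbTE z0) orbF => /eqP.
have /c0 x0 : x (o7 0) 0 *: b6 = 0 by ker_tac (@N137E F) (K2 (E 2) (- E 0)).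
have /c0/eqP : (eps * x (o7 1) 0) *: b6 = 0 by ker_tac (@N137E F) (K2 (E 2) (- E 1)).
rewrite mulf_eq0 (negbTE e0) => /eqP x1.
have /c0 x2 : x (o7 2) 0 *: b6 = 0 by ker_tac (@N137E F) (K2 (E 0) (E 0)).
have /c0/eqP : (eps * x (o7 3) 0) *: b6 = 0 by ker_tac (@N137E F) (K2 (E 0) (E 1)).
rewrite mulf_eq0 (negbTE e0) => /eqP x3.
have /c0 x4 : x (o7 4) 0 *: b6 = 0.
  by ker_tac (@N137E F) (K (- E 0)); rewrite x2 x3; vring.
have /c0/eqP : (eps * x (o7 5) 0) *: b6 = 0.
  by ker_tac (@N137E F) (K (- E 1)); rewrite x2 x3; vring.
rewrite mulf_eq0 (negbTE e0) => /eqP x5.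
have /c0 x6 : x (o7 6) 0 *: b6 = 0.
  by rewrite -[RHS]Hx frame_mx7 x0 x1 x2 x3 x4 x5 !zsimp.
by coords.
Qed.

Lemma N247_iso eps mu b0 b1 b2 b3 b4 b5 b6 :
  alternating mu -> central mu b5 -> central mu b6 ->
  (forall s t, s *: b5 + t *: b6 = 0 -> s = 0 /\ t = 0) ->
  bracket mu b0 b1 = b3 -> bracket mu b0 b2 = b4 -> bracket mu b1 b2 = 0 ->
  bracket mu b0 b3 = b5 -> bracket mu b0 b4 = 0 ->
  bracket mu b1 b3 = b5 -> bracket mu b1 b4 = b6 ->
  bracket mu b2 b3 = b6 -> bracket mu b2 b4 = eps *: b5 -> bracket mu b3 b4 = 0 ->
  isomorphic (N247 eps) mu.
Proof.
move=> A c5 c6 ind H01 H02 H12 H03 H04 H13 H14 H23 H24 H34.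
have An : alternating (N247 eps) by apply: alternating_of_table.
have H : frame_hom (N247 eps) mu [:: b0; b1; b2; b3; b4; b5; b6].
  by hom_tac N247E.
apply: (frame_iso An A H) => x Hx.
have K y := frame_kernel y An A H Hx.
have K2 y w := frame_kernel w An A H (K y).
have [x0 _] : x (o7 0) 0 = 0 /\ 0 = 0 :> F.
  by apply: ind; ker_tac (@N247E F) (K2 (E 1) (- E 0)).
have [x1 x2] : x (o7 1) 0 = 0 /\ x (o7 2) 0 = 0.
  by apply: ind; ker_tac (@N247E F) (K2 (E 0) (E 1)).
have [x3 x4] : x (o7 3) 0 = 0 /\ x (o7 4) 0 = 0.
  by apply: ind; ker_tac (@N247E F) (K (- E 1)); rewrite x0 x1 x2; vring.
have [x5 x6] : x (o7 5) 0 = 0 /\ x (o7 6) 0 = 0.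
  by apply: ind; rewrite -[RHS]Hx frame_mx7 x0 x1 x2 x3 x4 !zsimp.
by coords.
Qed.

End FrameLemmas.

(** * Normal forms of generic structures *)

Ltac tbl TE := rewrite !TE; coords; rewrite /minor2 ?vec7_coord //= ?vec7_coord //=.

Ltac low_by TE := rewrite TE => -[|[|[|[|[|//]]]]] _; rewrite ?vec7_coord //= /minor2 ?vec7_coord //=;
  ring.

Section NormalForms.
Variable R : realType.
Local Notation V := 'cV[R]_7.
Local Notation E i := (evec R (o7 i)).
Implicit Types (mu nu : bilin R 7) (eps : R).

Lemma solve2 (a b c d e f : R) : a * d - b * c != 0 ->
  exists s t, s * a + t * c = e /\ s * b + t * d = f.
Proof.
move=> D0; exists ((e * d - f * c) / (a * d - b * c)), ((a * f - b * e) / (a * d - b * c)).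
by split; field.
Qed.

Lemma indep2 (a b c d s t : R) : a * d - b * c != 0 ->
  s * a + t * c = 0 -> s * b + t * d = 0 -> s = 0 /\ t = 0.
Proof.
move=> D0 H1 H2; split; apply: (mulIf D0); rewrite mul0r.
  have -> : s * (a * d - b * c) = (s * a + t * c) * d - (s * b + t * d) * c by ring.
  by rewrite H1 H2 !mul0r subr0.
have -> : t * (a * d - b * c) = (s * b + t * d) * a - (s * a + t * c) * b by ring.
by rewrite H1 H2 !mul0r subr0.
Qed.

Lemma T322_central56 (p5 p6 m1 m2 m3 m4 q1 r1 q2 r2 q3 r3 s t : R) :
  central (T322 p5 p6 m1 m2 m3 m4 q1 r1 q2 r2 q3 r3) (vec7 [:: 0; 0; 0; 0; 0; s; t]).
Proof. by move=> y; tbl (@T322E R); ring. Qed.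

(** The pair of binary forms (q, r) is orthogonal to the form (k1, k2, k3) on the dual plane.
    Up to squares, the discriminant of the latter is eps, and the coefficients of the change
    of basis bring it to the norm form of the quadratic algebra j^2 = eps, so that (q, r)
    becomes the product of this algebra. *)
Lemma T322_normalize_form (p5 p6 m1 m2 m3 m4 q1 r1 q2 r2 q3 r3 dl eps : R) :
  let k1 := q2 * r3 - q3 * r2 in let k2 := q3 * r1 - q1 * r3 in
  let k3 := q1 * r2 - q2 * r1 in
  k1 != 0 -> dl != 0 -> k2 ^+ 2 - 4 * k1 * k3 = eps * dl ^+ 2 ->
  exists p5' p6' m1' m2' m3' m4', isomorphic (T322 p5 p6 m1 m2 m3 m4 q1 r1 q2 r2 q3 r3)
    (T322 p5' p6' m1' m2' m3' m4' 1 0 0 1 eps 0).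
Proof.
move=> k1 k2 k3 k10 d0 Hd.
set T := T322 _ _ _ _ _ _ _ _ _ _ _ _.
pose r := 2 * k1 / dl; pose s := k2 / dl.
have A : alternating T by apply: alternating_of_table.
pose b1 := vec7 [:: 0; 0; 1; 0; 0; 0; 0] : V.
pose b0 := vec7 [:: 1; 0; 0; 0; 0; 0; 0] : V.
pose b2 := vec7 [:: 0; r; s; 0; 0; 0; 0] : V.
pose b3 := vec7 [:: 0; 0; 0; 0; 1; 0; 0] : V.
pose b4 := vec7 [:: 0; 0; 0; r; s; 0; 0] : V.
pose b5 := vec7 [:: 0; 0; 0; 0; 0; q3; r3] : V.
pose b6 := vec7 [:: 0; 0; 0; 0; 0; r * q2 + s * q3; r * r2 + s * r3] : V.
have D0 : q3 * (r * r2 + s * r3) - r3 * (r * q2 + s * q3) != 0.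
  have -> : q3 * (r * r2 + s * r3) - r3 * (r * q2 + s * q3) = - (2 * k1 ^+ 2 / dl).
    by rewrite /r /s /k1; field.
  by rewrite oppr_eq0 !mulf_neq0 ?invr_eq0 ?expf_neq0 ?pnatr_eq0.
have ex (u : V) : low 5 u -> exists x y, u = x *: b5 + y *: b6.
  move=> u0; have [x [y [Hx Hy]]] := solve2 (u (o7 5) 0) (u (o7 6) 0) D0.
  by exists x, y; coords; rewrite ?u0 ?Hx ?Hy ?mulr0 ?addr0.
have low5 x y : low 5 (bracket T x y) -> exists c d, bracket T x y = c *: b5 + d *: b6.
  exact: ex.
have [p5' [p6' H12]] : exists c d, bracket T b1 b2 = c *: b5 + d *: b6.
  by apply: low5; low_by (@T322E R).
have [m1' [m2' H03]] : exists c d, bracket T b0 b3 = c *: b5 + d *: b6.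
  by apply: low5; low_by (@T322E R).
have [m3' [m4' H04]] : exists c d, bracket T b0 b4 = c *: b5 + d *: b6.
  by apply: low5; low_by (@T322E R).
exists p5', p6', m1', m2', m3', m4'; apply: isomorphic_sym.
have key (a1 a2 a3 : R) : k1 * a1 + k2 * a2 + k3 * a3 = 0 ->
   r * (r * a1 + s * a2) + s * (r * a2 + s * a3) = eps * a3.
  move=> Hk; have -> : r * (r * a1 + s * a2) + s * (r * a2 + s * a3)
     = (4 * k1 * (k1 * a1 + k2 * a2 + k3 * a3) + (k2 ^+ 2 - 4 * k1 * k3) * a3) / dl ^+ 2.
    by rewrite /r /s; field.
  by rewrite Hk Hd; field.
have kq : k1 * q1 + k2 * q2 + k3 * q3 = 0 by rewrite /k1 /k2 /k3; ring.
have kr : k1 * r1 + k2 * r2 + k3 * r3 = 0 by rewrite /k1 /k2 /k3; ring.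
apply: (@frame_iso _ _ _ [:: b0; b1; b2; b3; b4; b5; b6]) => //.
- by apply: alternating_of_table.
- apply: T322_frame.
  + exact: A.
  + exact: T322_central56.
  + exact: T322_central56.
  + by tbl (@T322E R); ring.
  + by tbl (@T322E R); ring.
  + exact: H12.
  + exact: H03.
  + exact: H04.
  + by tbl (@T322E R); ring.
  + by tbl (@T322E R); ring.
  + by tbl (@T322E R); ring.
  + tbl (@T322E R); try ring.
      by rewrite !zsimp -(key _ _ _ kq); ring.
    by rewrite !zsimp -(key _ _ _ kr); ring.
  + by tbl (@T322E R); ring.
move=> x /frame_mx7_eq0 Hx; have C k : (k < 7)%N -> _ := fun=> Hx (o7 k).
move: (C 0%N isT) (C 1%N isT) (C 2%N isT) (C 3%N isT) (C 4%N isT) (C 5%N isT) (C 6%N isT).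
rewrite !vec7_coord //= !zsimp.
have r0 : r != 0 by rewrite !mulf_neq0 ?invr_eq0 ?pnatr_eq0.
move=> x0 /eqP; rewrite mulf_eq0 (negbTE r0) orbF => /eqP x2; rewrite x2 !zsimp.
move=> x1 /eqP; rewrite mulf_eq0 (negbTE r0) orbF => /eqP x4; rewrite x4 !zsimp.
move=> x3 H5 H6; have [x5 x6] := indep2 D0 H5 H6.
by coords.
Qed.

(** Move e_2 along e_3 and e_4, whose brackets with e_1 are e_5 and e_6. *)
Lemma T322_kill_P (p5 p6 m1 m2 m3 m4 eps : R) :
  isomorphic (T322 p5 p6 m1 m2 m3 m4 1 0 0 1 eps 0)
             (T322 0 0 m1 m2 m3 m4 1 0 0 1 eps 0).
Proof.
set T := T322 p5 p6 _ _ _ _ _ _ _ _ _ _.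
have A : alternating T by apply: alternating_of_table.
pose b0 := vec7 [:: 1; 0; 0; 0; 0; 0; 0] : V.
pose b1 := vec7 [:: 0; 1; 0; 0; 0; 0; 0] : V.
pose b2 := vec7 [:: 0; 0; 1; - p5; - p6; 0; 0] : V.
pose b3 := vec7 [:: 0; 0; 0; 1; 0; 0; 0] : V.
pose b4 := vec7 [:: 0; 0; 0; 0; 1; - (p5 * m1 + p6 * m3); - (p5 * m2 + p6 * m4)] : V.
pose b5 := vec7 [:: 0; 0; 0; 0; 0; 1; 0] : V.
pose b6 := vec7 [:: 0; 0; 0; 0; 0; 0; 1] : V.
apply: isomorphic_sym.
apply: (@frame_iso _ _ _ [:: b0; b1; b2; b3; b4; b5; b6]).
- by apply: alternating_of_table.
- exact: A.
- apply: T322_frame; first exact: A.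
  + exact: T322_central56.
  + exact: T322_central56.
  1-10: by tbl (@T322E R); ring.
move=> x /frame_mx7_eq0 Hx; have C k : (k < 7)%N -> _ := fun=> Hx (o7 k).
move: (C 0%N isT) (C 1%N isT) (C 2%N isT) (C 3%N isT) (C 4%N isT) (C 5%N isT) (C 6%N isT).
rewrite !vec7_coord //= !zsimp => x0 x1 x2; rewrite x2 !zsimp => x3 x4.
by rewrite x4 !zsimp => x5 x6; coords.
Qed.

(** Identify the planes (e_1, e_2), (e_3, e_4), (e_5, e_6) with the quadratic algebra. The
    action of e_0 is a linear part, adjusted by a translation of e_0, plus z |-> m conj z.
    The change of scale z |-> u z with u^3 = m, together with the factor r on e_0, gives m
    the value 1/2 that it has in the model. *)
Lemma T322_to_N247 (m1 m2 m3 m4 u1 u2 eps : R) : (eps = 1 \/ eps = -1) ->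
  u1 ^+ 2 - eps * u2 ^+ 2 != 0 ->
  u1 ^+ 3 + 3 * eps * u1 * u2 ^+ 2 = (m1 - m4) / 2 ->
  3 * u1 ^+ 2 * u2 + eps * u2 ^+ 3 = (m2 - eps * m3) / 2 ->
  isomorphic (N247 eps) (T322 0 0 m1 m2 m3 m4 1 0 0 1 eps 0).
Proof.
move=> He N0 H1 H2.
have {H1} E1 : m1 = m4 + 2 * (u1 ^+ 3 + 3 * eps * u1 * u2 ^+ 2) by rewrite H1; field.
have {H2} E2 : m2 = eps * m3 + 2 * (3 * u1 ^+ 2 * u2 + eps * u2 ^+ 3) by rewrite H2; field.
have ee : eps * eps = 1 by case: He => ->; ring.
pose r := (2 * (u1 ^+ 2 - eps * u2 ^+ 2))^-1.
have rN : r * (2 * (u1 ^+ 2 - eps * u2 ^+ 2)) = 1.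
  by rewrite mulVf // mulf_neq0 // pnatr_eq0.
have r0 : r != 0 by rewrite invr_eq0 mulf_neq0 // pnatr_eq0.
pose c1 := u1 / 2 - r * ((m1 + m4) / 2).
pose c2 := u2 / 2 - r * ((m2 + eps * m3) / 2).
set T := T322 _ _ _ _ _ _ _ _ _ _ _ _.
pose b0 := vec7 [:: r; c1; c2; 0; 0; 0; 0] : V.
pose b1 := vec7 [:: 0; u1; u2; 0; 0; 0; 0] : V.
pose b2 := vec7 [:: 0; eps * u2; u1; 0; 0; 0; 0] : V.
pose b3 := vec7 [:: 0; 0; 0; r * u1; r * u2; 0; 0] : V.
pose b4 := vec7 [:: 0; 0; 0; r * (eps * u2); r * u1; 0; 0] : V.
pose b5 := vec7 [:: 0; 0; 0; 0; 0; r * (u1 ^+ 2 + eps * u2 ^+ 2); r * (2 * u1 * u2)] : V.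
pose b6 := vec7 [:: 0; 0; 0; 0; 0; r * (2 * eps * u1 * u2); r * (u1 ^+ 2 + eps * u2 ^+ 2)] : V.
have key (a b c : R) : a - b = (r * (2 * (u1 ^+ 2 - eps * u2 ^+ 2)) - 1) * c -> a = b.
  by rewrite rN subrr mul0r => /eqP; rewrite subr_eq0 => /eqP.
apply: (@N247_iso _ eps T b0 b1 b2 b3 b4 b5 b6).
- by apply: alternating_of_table.
- exact: T322_central56.
- exact: T322_central56.
- move=> s t Hst.
  have C k : (k < 7)%N -> _ := fun k7 => congr1 (fun u : V => u (o7 k) 0) Hst.
  move: (C 5%N isT) (C 6%N isT); rewrite !entE !vec7_coord //=; apply: indep2.
  have -> : r * (u1 ^+ 2 + eps * u2 ^+ 2) * (r * (u1 ^+ 2 + eps * u2 ^+ 2)) -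
    r * (2 * u1 * u2) * (r * (2 * eps * u1 * u2))
    = (r * (u1 ^+ 2 - eps * u2 ^+ 2)) ^+ 2 by ring.
  by rewrite expf_neq0 // mulf_neq0.
all: rewrite /b0 /b1 /b2 /b3 /b4 /b5 /b6 /T; tbl (@T322E R);
  rewrite /c1 /c2 ?E1 ?E2; try by ring.
all: rewrite /r; clear -He N0; case: He N0 => -> N0; field; move: N0; rewrite ?mul1r => N0.
all: by rewrite ?N0.
Qed.

Lemma T421_central6 (s1 s2 t1 t2 u1 u2 p q d s : R) :
  central (T421 s1 s2 t1 t2 u1 u2 p q d) (vec7 [:: 0; 0; 0; 0; 0; 0; s]).
Proof. by move=> y; tbl (@T421E R); ring. Qed.

(** The bracket of e_0 and e_1 is removed by moving e_1 along e_2, e_3, whose brackets with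
    e_0 span the middle step; e_2 and e_3 are then corrected by e_5. *)
Lemma T421_kill (s1 s2 t1 t2 u1 u2 p q d : R) : s1 * t2 - s2 * t1 != 0 ->
  isomorphic (T421 s1 s2 t1 t2 u1 u2 p q d) (T421 s1 s2 t1 t2 u1 u2 0 0 d).
Proof.
move=> D0; have D0' : s1 * t2 - t1 * s2 != 0 by rewrite [t1 * _]mulrC.
have [c2 [c3 [Hp Hq]]] := solve2 (- p) (- q) D0'.
have {Hp} -> : p = - (c2 * s1 + c3 * s2) by rewrite Hp opprK.
have {Hq} -> : q = - (c2 * t1 + c3 * t2) by rewrite Hq opprK.
set T := T421 _ _ _ _ _ _ _ _ _.
have A : alternating T by apply: alternating_of_table.
pose b0 := vec7 [:: 1; 0; 0; 0; 0; 0; 0] : V.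
pose b1 := vec7 [:: 0; 1; c2; c3; 0; 0; 0] : V.
pose b2 := vec7 [:: 0; 0; 1; 0; 0; c3 * d; 0] : V.
pose b3 := vec7 [:: 0; 0; 0; 1; 0; - (c2 * d); 0] : V.
pose b4 := vec7 [:: 0; 0; 0; 0; 1; 0; 0] : V.
pose b5 := vec7 [:: 0; 0; 0; 0; 0; 1; 0] : V.
pose b6 := vec7 [:: 0; 0; 0; 0; 0; 0; 1] : V.
apply: isomorphic_sym.
apply: (@frame_iso _ _ _ [:: b0; b1; b2; b3; b4; b5; b6]).
- by apply: alternating_of_table.
- exact: A.
- apply: T421_frame; first exact: A.
  + exact: T421_central6.
  1-15: by tbl (@T421E R); ring.
move=> x /frame_mx7_eq0 Hx; have C k : (k < 7)%N -> _ := fun=> Hx (o7 k).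
move: (C 0%N isT) (C 1%N isT) (C 2%N isT) (C 3%N isT) (C 4%N isT) (C 5%N isT) (C 6%N isT).
rewrite !vec7_coord //= !zsimp => x0 x1; rewrite x1 !zsimp => x2 x3.
by rewrite x2 x3 !zsimp => x4 x5 x6; coords.
Qed.

(** The covectors s, t, u on the plane of e_2, e_3 are the coefficients of a quadratic form
    on the plane of e_0, e_1, with values s at v_0 and eps s at v_1 by the hypotheses on u.
    Its polar value at v_0 and v_1 is b, and v_2, v_3 span the kernels of b and s. *)
Lemma T421_to_N137 (s1 s2 t1 t2 u1 u2 d rho sig eps : R) : (eps = 1 \/ eps = -1) ->
  rho != 0 -> d != 0 -> s1 * t2 - s2 * t1 != 0 ->
  u1 = (eps * s1 - 2 * rho * sig * t1 - sig ^+ 2 * s1) / rho ^+ 2 ->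
  u2 = (eps * s2 - 2 * rho * sig * t2 - sig ^+ 2 * s2) / rho ^+ 2 ->
  isomorphic (N137 eps) (T421 s1 s2 t1 t2 u1 u2 0 0 d).
Proof.
move=> He r0 d0 D0 -> ->.
set T := T421 _ _ _ _ _ _ _ _ _.
have e0 : eps != 0 by case: He => ->; rewrite ?oppr_eq0 oner_neq0.
pose b1 := rho * t1 + sig * s1.
pose b2 := rho * t2 + sig * s2.
pose v0 := vec7 [:: 1; 0; 0; 0; 0; 0; 0] : V.
pose v1 := vec7 [:: sig; rho; 0; 0; 0; 0; 0] : V.
pose v2 := vec7 [:: 0; 0; eps / d * b2; - (eps / d * b1); 0; 0; 0] : V.
pose v3 := vec7 [:: 0; 0; - (s2 / d); s1 / d; 0; 0; 0] : V.
pose w := rho * (s1 * t2 - s2 * t1) / d.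
pose v4 := vec7 [:: 0; 0; 0; 0; eps * w; eps / d * (sig * (t1 * s2 - t2 * s1)); 0] : V.
pose v5 := vec7 [:: 0; 0; 0; 0; 0; (s1 * t2 - s2 * t1) / d; 0] : V.
pose v6 := vec7 [:: 0; 0; 0; 0; 0; 0; eps * w] : V.
have w0 : eps * w != 0 by rewrite !mulf_neq0 ?invr_eq0.
apply: (@N137_iso _ eps T v0 v1 v2 v3 v4 v5 v6 e0).
- by apply: alternating_of_table.
- exact: T421_central6.
- apply: contra w0 => /eqP/(congr1 (fun u : V => u (o7 6) 0)).
  by rewrite vec7_coord // mxE /= => ->.
all: rewrite /v0 /v1 /v2 /v3 /v4 /v5 /v6 /T; tbl (@T421E R);
  rewrite /b1 /b2 /w; try by ring.
all: clear -He r0 d0; case: He => ->; field.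
all: by rewrite ?d0 ?r0.
Qed.

Lemma sqrt_sign (D : R) : D != 0 -> exists eps dl : R,
  [/\ eps = 1 \/ eps = -1, dl != 0 & D = eps * dl ^+ 2].
Proof.
move=> D0; case: (ltrgt0P D) => [pD|nD|z]; last by rewrite z eqxx in D0.
  exists 1, (Num.sqrt D); split; first by left.
    by rewrite sqrtr_eq0 -ltNge.
  by rewrite mul1r sqr_sqrtr // ltW.
exists (-1), (Num.sqrt (- D)); split; first by right.
  by rewrite sqrtr_eq0 -ltNge oppr_gt0.
by rewrite mulN1r sqr_sqrtr ?opprK // oppr_ge0 ltW.
Qed.

Lemma real_cbrt (a : R) : exists x : R, x ^+ 3 = a.
Proof.
have pos (b : R) : 0 <= b -> exists x : R, x ^+ 3 = b.
  by move=> b0; exists (b `^ 3^-1); rewrite -powR_mulrn ?powR_ge0 // -powRrM mulVf ?powRr1 // pnatr_eq0.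
case: (lerP 0 a) => [/pos //|a0].
have a1 : 0 <= - a by rewrite oppr_ge0 ltW.
have [x Hx] := pos (- a) a1.
by exists (- x); rewrite exprNn Hx -signr_odd /= expr1 mulN1r opprK.
Qed.

(** Cube roots in the quadratic algebra with j^2 = eps: two real cube roots when
    it splits, a complex one otherwise. *)
Lemma quadratic_cbrt (eps a b : R) : eps = 1 \/ eps = -1 -> exists x y : R,
  x ^+ 3 + 3 * eps * x * y ^+ 2 = a /\ 3 * x ^+ 2 * y + eps * y ^+ 3 = b.
Proof.
case=> ->.
  have [x Hx] := real_cbrt (a + b); have [y Hy] := real_cbrt (a - b).
  exists ((x + y) / 2), ((x - y) / 2).
  have -> : a = (x ^+ 3 + y ^+ 3) / 2 by rewrite Hx Hy; field.
  have -> : b = (x ^+ 3 - y ^+ 3) / 2 by rewrite Hx Hy; field.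
  by split; field.
pose z := 3.-root (a +i* b)%C.
have : z ^+ 3 = (a +i* b)%C by rewrite rootCK.
case: z => x y; rewrite !exprS expr0 mulr1 => -[Ha Hb].
exists x, y; split; [rewrite -Ha|rewrite -Hb]; ring.
Qed.

Lemma T421_generic (s1 s2 t1 t2 u1 u2 p q d : R) :
  d != 0 -> s1 * t2 - s2 * t1 != 0 ->
  (u1 * s2 - u2 * s1) ^+ 2 - 4 * (t1 * u2 - t2 * u1) * (s1 * t2 - s2 * t1) != 0 ->
  exists eps, (eps = 1 \/ eps = -1) /\ isomorphic (N137 eps) (T421 s1 s2 t1 t2 u1 u2 p q d).
Proof.
move=> d0 k0 /sqrt_sign[eps [dl [He dl0 Hd]]]; exists eps; split=> //.
apply: isomorphic_trans (isomorphic_sym (T421_kill u1 u2 p q d k0)).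
pose k3 := s1 * t2 - s2 * t1; pose k2 := u1 * s2 - u2 * s1.
apply: (@T421_to_N137 _ _ _ _ _ _ _ (2 * k3 / dl) (k2 / dl) _ He) => //.
- by rewrite !mulf_neq0 ?invr_eq0 ?pnatr_eq0.
- have -> : eps = (k2 ^+ 2 - 4 * (t1 * u2 - t2 * u1) * k3) / dl ^+ 2.
    by rewrite Hd; field.
  by rewrite /k2 /k3; field; rewrite dl0 k0.
- have -> : eps = (k2 ^+ 2 - 4 * (t1 * u2 - t2 * u1) * k3) / dl ^+ 2.
    by rewrite Hd; field.
  by rewrite /k2 /k3; field; rewrite dl0 k0.
Qed.

Lemma T322_generic_form (p5 p6 m1 m2 m3 m4 q1 r1 q2 r2 q3 r3 : R) :
  q2 * r3 - q3 * r2 != 0 ->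
  (q3 * r1 - q1 * r3) ^+ 2 - 4 * (q2 * r3 - q3 * r2) * (q1 * r2 - q2 * r1) != 0 ->
  exists eps m1' m2' m3' m4', (eps = 1 \/ eps = -1) /\
    isomorphic (T322 p5 p6 m1 m2 m3 m4 q1 r1 q2 r2 q3 r3)
      (T322 0 0 m1' m2' m3' m4' 1 0 0 1 eps 0).
Proof.
move=> k0 /sqrt_sign[eps [dl [He dl0 Hd]]].
have [p5' [p6' [m1' [m2' [m3' [m4' H]]]]]] := T322_normalize_form p5 p6 m1 m2 m3 m4 k0 dl0 Hd.
exists eps, m1', m2', m3', m4'; split=> //.
exact: isomorphic_trans H (T322_kill_P _ _ _ _ _ _ _).
Qed.

Lemma T322_generic (m1 m2 m3 m4 eps : R) : eps = 1 \/ eps = -1 ->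
  (m1 - m4) ^+ 2 - eps * (m2 - eps * m3) ^+ 2 != 0 ->
  isomorphic (N247 eps) (T322 0 0 m1 m2 m3 m4 1 0 0 1 eps 0).
Proof.
move=> He N0.
have [u1 [u2 [H1 H2]]] := quadratic_cbrt ((m1 - m4) / 2) ((m2 - eps * m3) / 2) He.
apply: (T322_to_N247 He _ H1 H2).
apply: contra N0 => /eqP N0; apply/eqP.
have -> : (m1 - m4) ^+ 2 - eps * (m2 - eps * m3) ^+ 2
   = 4 * (((m1 - m4) / 2) ^+ 2 - eps * ((m2 - eps * m3) / 2) ^+ 2) by field.
rewrite -H1 -H2.
have -> : 4 * ((u1 ^+ 3 + 3 * eps * u1 * u2 ^+ 2) ^+ 2 - eps * (3 * u1 ^+ 2 * u2 + eps * u2 ^+ 3) ^+ 2)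
  = 4 * (u1 ^+ 2 - eps * u2 ^+ 2) ^+ 3 by case: He => ->; ring.
by rewrite N0 expr0n mulr0.
Qed.

End NormalForms.

(** * Deformation to generic structures *)

Section Deformation.
Variable R : realType.

Definition polyfun (f : R -> R) := exists p : {poly R}, forall t, f t = p.[t].

Lemma polyfun_cst c : polyfun (fun=> c).
Proof. by exists c%:P => t; rewrite hornerC. Qed.
Lemma polyfun_id : polyfun (fun t => t).
Proof. by exists 'X => t; rewrite hornerX. Qed.
Lemma polyfunD f g : polyfun f -> polyfun g -> polyfun (fun t => f t + g t).
Proof. by move=> [p Hp] [q Hq]; exists (p + q) => t; rewrite hornerD Hp Hq. Qed.
Lemma polyfunN f : polyfun f -> polyfun (fun t => - f t).
Proof. by move=> [p Hp]; exists (- p) => t; rewrite hornerN Hp. Qed.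
Lemma polyfunM f g : polyfun f -> polyfun g -> polyfun (fun t => f t * g t).
Proof. by move=> [p Hp] [q Hq]; exists (p * q) => t; rewrite hornerM Hp Hq. Qed.
Lemma polyfunX f n : polyfun f -> polyfun (fun t => f t ^+ n).
Proof. by move=> [p Hp]; exists (p ^+ n) => t; rewrite horner_exp Hp. Qed.

Lemma polyfun_small f (d : R) : polyfun f -> 0 < d -> (exists t, f t != 0) ->
  exists2 t, `|t| < d & f t != 0.
Proof.
move=> [p Hp] d0 [t0]; rewrite Hp => pt0.
have p0 : p != 0 by apply: contraNneq pt0 => ->; rewrite horner0.
apply: contrapT => H0.
have H t : `|t| < d -> root p t.
  move=> td; apply/negPn/negP => nr; apply: H0.
  by exists t => //; rewrite Hp.
pose s := [seq d / (i.+2)%:R | i <- iota 0 (size p)].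
have : (size s < size p)%N.
  apply: max_poly_roots => //.
    apply/allP => _ /mapP[i _ ->]; apply: H.
    rewrite gtr0_norm ?divr_gt0 ?ltr0n // ltr_pdivrMr ?ltr0n //.
    by rewrite ltr_pMr // ltr1n.
  rewrite map_inj_uniq ?iota_uniq // => i j /(mulfI (lt0r_neq0 d0)) /invr_inj /eqP.
  by rewrite eqr_nat => /eqP[].
by rewrite size_map size_iota ltnn.
Qed.

(** The hypothesis under which a structure is rigid, in its algebraic form. *)
Definition robust (mu : bilin R 7) := nil_variety 3 mu /\ rigid_cocycles 3 mu.

Lemma robust_iso mu nu : isomorphic mu nu -> robust mu -> robust nu.
Proof. by move=> I [N B]; split; [apply: nil_variety_iso N|apply: rigid_cocycles_iso B]. Qed.

(** The orbit of a robust structure is open in the variety, so it contains the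
    points of small parameter on any line of the variety through that structure. *)
Lemma robust_line (M : R -> bilin R 7) f : robust (M 0) ->
  (forall t, M t = M 0 + t *: (M 1 - M 0)) -> (forall t, nil_variety 3 (M t)) ->
  polyfun f -> (exists t, f t != 0) -> exists t, f t != 0 /\ isomorphic (M 0) (M t).
Proof.
move=> [N0 B0] aff N pf ex.
have [_ [U oU orb]] := rigid_of_rigid_cocycles N0 B0.
have U0 : U (M 0).
  by have : gl_orbit (M 0) (M 0) by [apply/gl_orbitP/isomorphic_refl]; rewrite orb => -[].
have [d /= d0 Hd] : nbhs (0 : R) (fun t => U (M t)).
  have cM : {for 0, continuous M}.
    rewrite (_ : M = fun t => M 0 + t *: (M 1 - M 0)); last by apply/funext.
    move=> e; apply: cvgD; first exact: cvg_cst.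
    by apply: cvgZr_tmp; exact: cvg_id.
  by apply: cM; apply: open_nbhs_nbhs.
have [t td ft] := polyfun_small pf d0 ex.
exists t; split=> //; apply/gl_orbitP; rewrite orb; split; first exact: N.
by apply: Hd; rewrite /ball /= sub0r normrN.
Qed.

End Deformation.

Ltac polyfun_tac := repeat first [exact: polyfun_cst | exact: polyfun_id | apply: polyfunD
  | apply: polyfunN | apply: polyfunM | apply: polyfunX].

Ltac affine_tac TE := let t := fresh "t" in let x := fresh "x" in let y := fresh "y" in
  move=> t; apply: bracket_inj => x y;
  rewrite bracketDm bracketZm bracketBm !TE; coords; ring.

Section Families.
Variable R : realType.
Local Notation V := 'cV[R]_7.
Local Notation E i := (evec R (o7 i)).
Implicit Types (mu nu : bilin R 7) (eps : R).

(** The family is linear, so every member lies on a line through the model eps = 1, and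
    a point of this line near the member is generic. *)
Lemma robust_T421 (s1 s2 t1 t2 u1 u2 p q d : R) : robust (T421 s1 s2 t1 t2 u1 u2 p q d) ->
  exists eps, (eps = 1 \/ eps = -1) /\ isomorphic (T421 s1 s2 t1 t2 u1 u2 p q d) (N137 eps).
Proof.
move=> rob.
pose l (x y t : R) : R := x + t * (y - x).
pose M (t : R) := T421 (l s1 1 t) (l s2 0 t) (l t1 0 t) (l t2 1 t) (l u1 1 t) (l u2 0 t)
   (l p 0 t) (l q 0 t) (l d 1 t).
have l0 x y : l x y 0 = x by rewrite /l mul0r addr0.
have l1 x y : l x y 1 = y by rewrite /l mul1r addrC subrK.
have M0 : M 0 = T421 s1 s2 t1 t2 u1 u2 p q d by rewrite /M !l0.
pose f (t : R) : R := l d 1 t * (l s1 1 t * l t2 1 t - l s2 0 t * l t1 0 t) *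
  ((l u1 1 t * l s2 0 t - l u2 0 t * l s1 1 t) ^+ 2
   - 4 * (l t1 0 t * l u2 0 t - l t2 1 t * l u1 1 t) * (l s1 1 t * l t2 1 t - l s2 0 t * l t1 0 t)).
have [|||||t [ft It]] := @robust_line R M f.
- by rewrite M0.
- by rewrite /M /l; affine_tac (@T421E R).
- by move=> t; apply: T421_nil.
- by rewrite /f /l; polyfun_tac.
- by exists 1; rewrite /f !l1 !zsimp expr0n sub0r mulrN1 opprK pnatr_eq0.
move: ft; rewrite /f !mulf_eq0 !negb_or => /andP[/andP[a b] c].
have [eps [He I]] := T421_generic (l p 0 t) (l q 0 t) a b c.
exists eps; split=> //; rewrite -M0.
exact: isomorphic_trans It (isomorphic_sym I).
Qed.

(** A first line makes the pair of quadratic forms generic; in the normal form a second one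
    makes the semilinear part of the action of e_0 invertible. *)
Lemma robust_T322 (p5 p6 m1 m2 m3 m4 q1 r1 q2 r2 q3 r3 : R) :
  robust (T322 p5 p6 m1 m2 m3 m4 q1 r1 q2 r2 q3 r3) ->
  exists eps, (eps = 1 \/ eps = -1) /\
    isomorphic (T322 p5 p6 m1 m2 m3 m4 q1 r1 q2 r2 q3 r3) (N247 eps).
Proof.
move=> rob.
pose l (x y t : R) : R := x + t * (y - x).
have l0 x y : l x y 0 = x by rewrite /l mul0r addr0.
have l1 x y : l x y 1 = y by rewrite /l mul1r addrC subrK.
pose M (t : R) := T322 p5 p6 m1 m2 m3 m4 (l q1 1 t) (l r1 0 t) (l q2 0 t) (l r2 1 t) (l q3 1 t) (l r3 0 t).
have M0 : M 0 = T322 p5 p6 m1 m2 m3 m4 q1 r1 q2 r2 q3 r3 by rewrite /M !l0.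
pose k1 (t : R) : R := l q2 0 t * l r3 0 t - l q3 1 t * l r2 1 t.
pose f (t : R) : R := k1 t * ((l q3 1 t * l r1 0 t - l q1 1 t * l r3 0 t) ^+ 2 -
   4 * k1 t * (l q1 1 t * l r2 1 t - l q2 0 t * l r1 0 t)).
have [|||||t [ft It]] := @robust_line R M f.
- by rewrite M0.
- by rewrite /M /l; affine_tac (@T322E R).
- by move=> t; apply: T322_nil.
- by rewrite /f /k1 /l; polyfun_tac.
- by exists 1; rewrite (_ : f 1 = - 4%:R) ?oppr_eq0 ?pnatr_eq0 // /f /k1 !l1; ring.
move: ft; rewrite /f mulf_eq0 negb_or => /andP[a b].
have [eps [m1' [m2' [m3' [m4' [He I]]]]]] :=
  T322_generic_form p5 p6 m1 m2 m3 m4 a b.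
have {}I := isomorphic_trans It I; rewrite M0 in I.
have {}rob := robust_iso I rob.
pose M' (t : R) := T322 0 0 (l m1' (1 + m4') t) (l m2' (eps * m3') t) m3' m4' 1 0 0 1 eps 0.
have M'0 : M' 0 = T322 0 0 m1' m2' m3' m4' 1 0 0 1 eps 0 by rewrite /M' !l0.
pose f' (t : R) : R := (l m1' (1 + m4') t - m4') ^+ 2 - eps * (l m2' (eps * m3') t - eps * m3') ^+ 2.
have [|||||t' [ft' It']] := @robust_line R M' f'.
- by rewrite M'0.
- by rewrite /M' /l; affine_tac (@T322E R).
- by move=> u; apply: T322_nil.
- by rewrite /f' /l; polyfun_tac.
- by exists 1; rewrite /f' !l1 addrK subrr expr0n expr1n mulr0 subr0 oner_neq0.
exists eps; split=> //.
apply: isomorphic_trans I _; rewrite -M'0; apply: isomorphic_trans It' _.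
exact/isomorphic_sym/T322_generic.
Qed.

(** A line from a structure of type (4,1,2), at t = 0, into the type (3,2,2): for t nonzero
    e_3 becomes a bracket. The terms in t d_0 and t d_1 preserve the Jacobi identity. *)
Definition T412 (a0 a1 b0 b1 c0 c1 d0 d1 e0 e1 t : R) : bilin R 7 := of_table
  [:: (o7 0, o7 1, E 4); (o7 0, o7 2, t *: E 3 - (t * d1) *: E 4 + a0 *: E 5 + a1 *: E 6);
      (o7 1, o7 2, (t * d0) *: E 4 + c0 *: E 5 + c1 *: E 6);
      (o7 0, o7 3, b0 *: E 5 + b1 *: E 6); (o7 1, o7 3, d0 *: E 5 + d1 *: E 6);
      (o7 2, o7 3, e0 *: E 5 + e1 *: E 6); (o7 0, o7 4, E 5); (o7 1, o7 4, E 6)].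

Lemma T412E a0 a1 b0 b1 c0 c1 d0 d1 e0 e1 t x y :
  bracket (T412 a0 a1 b0 b1 c0 c1 d0 d1 e0 e1 t) x y = vec7
    [:: 0; 0; 0; t * minor2 x y 0 2;
      minor2 x y 0 1 - t * d1 * minor2 x y 0 2 + t * d0 * minor2 x y 1 2;
      a0 * minor2 x y 0 2 + c0 * minor2 x y 1 2 + b0 * minor2 x y 0 3 + d0 * minor2 x y 1 3
        + e0 * minor2 x y 2 3 + minor2 x y 0 4;
      a1 * minor2 x y 0 2 + c1 * minor2 x y 1 2 + b1 * minor2 x y 0 3 + d1 * minor2 x y 1 3
        + e1 * minor2 x y 2 3 + minor2 x y 1 4].
Proof.
rewrite bracket_of_table !big_cons big_nil /= -!/(minor2 x y _ _).
by coords; ring.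
Qed.

Lemma T412_level a0 a1 b0 b1 c0 c1 d0 d1 e0 e1 t u z : low 3 u ->
  bracket (T412 a0 a1 b0 b1 c0 c1 d0 d1 e0 e1 t) u z = vec7
    [:: 0; 0; 0; 0; 0;
      - (u (o7 3) 0 * (b0 * z (o7 0) 0 + d0 * z (o7 1) 0 + e0 * z (o7 2) 0)
         + u (o7 4) 0 * z (o7 0) 0);
      - (u (o7 3) 0 * (b1 * z (o7 0) 0 + d1 * z (o7 1) 0 + e1 * z (o7 2) 0)
         + u (o7 4) 0 * z (o7 1) 0)].
Proof.
move=> H; rewrite T412E; coords; rewrite /minor2 ?(H 0%N) ?(H 1%N) ?(H 2%N) //; ring.
Qed.

Lemma T412_low a0 a1 b0 b1 c0 c1 d0 d1 e0 e1 t x y :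
  low 3 (bracket (T412 a0 a1 b0 b1 c0 c1 d0 d1 e0 e1 t) x y).
Proof. by rewrite T412E; low_tac. Qed.

Lemma T412_nil a0 a1 b0 b1 c0 c1 d0 d1 e0 e1 t :
  nil_variety 3 (T412 a0 a1 b0 b1 c0 c1 d0 d1 e0 e1 t).
Proof.
split; first (split; first exact: alternating_of_table).
  move=> x y z; rewrite /jacobiator ![bracket _ (bracket _ _ _) _]T412_level; try exact: T412_low.
  by rewrite !T412E; coords; rewrite ?vec7_coord //= /minor2; ring.
apply: (nil3_low (p := 3) (q := 5)) => [x y|x y lx|x y lx]; first exact: T412_low.
  by rewrite T412_level //; low_tac.
rewrite T412_level; last exact: low_le lx.
by rewrite (lx 3%N) // (lx 4%N) //; coords; ring.
Qed.

Lemma T412_T322 (a0 a1 b0 b1 c0 c1 d0 d1 e0 e1 t : R) : t != 0 -> exists m3 m4 q2 q3 r3,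
  isomorphic (T412 a0 a1 b0 b1 c0 c1 d0 d1 e0 e1 t) (T322 c0 c1 1 0 m3 m4 0 1 q2 0 q3 r3).
Proof.
move=> t0.
exists (t * b0 - t * d1), (t * b1), (t * d0), (t * e0 + t * d0 * (t * b0 - t * d1)),
  (t * e1 + t * d0 * (t * b1)).
set T := T412 _ _ _ _ _ _ _ _ _ _ _.
have A : alternating T by apply: alternating_of_table.
pose v0 := vec7 [:: 1; 0; 0; 0; 0; 0; 0] : V.
pose v1 := vec7 [:: 0; 1; 0; 0; 0; 0; 0] : V.
pose v2 := vec7 [:: t * d0; 0; 1; 0; 0; 0; 0] : V.
pose v3 := vec7 [:: 0; 0; 0; 0; 1; 0; 0] : V.
pose v4 := vec7 [:: 0; 0; 0; t; - (t * d1); a0; a1] : V.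
pose v5 := vec7 [:: 0; 0; 0; 0; 0; 1; 0] : V.
pose v6 := vec7 [:: 0; 0; 0; 0; 0; 0; 1] : V.
apply: isomorphic_sym.
apply: (@frame_iso _ _ _ [:: v0; v1; v2; v3; v4; v5; v6]).
- by apply: alternating_of_table.
- exact: A.
- apply: T322_frame; first exact: A.
  + by move=> y; tbl (@T412E); ring.
  + by move=> y; tbl (@T412E); ring.
  1-10: by tbl (@T412E); ring.
move=> x /frame_mx7_eq0 Hx; have C k : (k < 7)%N -> _ := fun=> Hx (o7 k).
move: (C 0%N isT) (C 1%N isT) (C 2%N isT) (C 3%N isT) (C 4%N isT) (C 5%N isT) (C 6%N isT).
rewrite !vec7_coord //= !zsimp => + x1 x2; rewrite x2 !zsimp => x0.
move=> /eqP; rewrite mulf_eq0 (negbTE t0) orbF => /eqP x4; rewrite x4 !zsimp => x3 x5 x6.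
by coords.
Qed.

Lemma robust_T412 (a0 a1 b0 b1 c0 c1 d0 d1 e0 e1 : R) :
  robust (T412 a0 a1 b0 b1 c0 c1 d0 d1 e0 e1 0) ->
  exists eps, (eps = 1 \/ eps = -1) /\
    isomorphic (T412 a0 a1 b0 b1 c0 c1 d0 d1 e0 e1 0) (N247 eps).
Proof.
move=> rob; pose M (t : R) := T412 a0 a1 b0 b1 c0 c1 d0 d1 e0 e1 t.
have [|||||t [ft It]] := @robust_line R M (fun t => t).
- exact: rob.
- by rewrite /M; affine_tac (@T412E).
- by move=> t; apply: T412_nil.
- exact: polyfun_id.
- by exists 1; apply: oner_neq0.
have [m3 [m4 [q2 [q3 [r3 I]]]]] := T412_T322 a0 a1 b0 b1 c0 c1 d0 d1 e0 e1 ft.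
have {}I := isomorphic_trans It I.
have [eps [He J]] := robust_T322 (robust_iso I rob).
by exists eps; split=> //; apply: isomorphic_trans I J.
Qed.

(** Generators e_0, e_1, e_2, e_3, e_5, middle step e_4. The brackets of e_1, e_2, e_3, e_5
    are an alternating form with values in the centre. *)
Definition T511 (a1 a2 a3 w1 w2 w3 : R) : bilin R 7 := of_table
  [:: (o7 0, o7 1, E 4); (o7 0, o7 4, E 6);
      (o7 1, o7 2, a1 *: E 6); (o7 1, o7 3, a2 *: E 6); (o7 1, o7 5, a3 *: E 6);
      (o7 2, o7 3, w3 *: E 6); (o7 2, o7 5, w2 *: E 6); (o7 3, o7 5, w1 *: E 6)].

Lemma T511E a1 a2 a3 w1 w2 w3 x y :
  bracket (T511 a1 a2 a3 w1 w2 w3) x y = vec7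
    [:: 0; 0; 0; 0; minor2 x y 0 1; 0;
      minor2 x y 0 4 + a1 * minor2 x y 1 2 + a2 * minor2 x y 1 3 + a3 * minor2 x y 1 5
      + w3 * minor2 x y 2 3 + w2 * minor2 x y 2 5 + w1 * minor2 x y 3 5].
Proof.
rewrite bracket_of_table !big_cons big_nil /= -!/(minor2 x y _ _).
by coords; ring.
Qed.

Lemma T511_double a1 a2 a3 w1 w2 w3 x y z :
  bracket (T511 a1 a2 a3 w1 w2 w3) (bracket (T511 a1 a2 a3 w1 w2 w3) x y) z =
  vec7 [:: 0; 0; 0; 0; 0; 0; - (minor2 x y 0 1 * z (o7 0) 0)].
Proof.
rewrite [X in bracket _ X z]T511E; move: (_ + _) => m; rewrite T511E.
by coords; rewrite /minor2 !vec7_coord //=; ring.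
Qed.

Lemma T511_nil a1 a2 a3 w1 w2 w3 : nil_variety 3 (T511 a1 a2 a3 w1 w2 w3).
Proof.
split; first (split; first exact: alternating_of_table).
  by move=> x y z; rewrite /jacobiator !T511_double; coords; rewrite /minor2; ring.
move=> x; rewrite /= T511_double T511E.
by coords; rewrite /minor2 !vec7_coord //=; ring.
Qed.

(** The alternating form w on e_2, e_3, e_5 has a kernel; when e_1 pairs non-trivially with
    it, the kernel vector plays the part of e_5. *)
Lemma T511_T421 (a1 a2 a3 w1 w2 w3 : R) : w3 != 0 -> a1 * w1 - a2 * w2 + a3 * w3 != 0 ->
  isomorphic (T511 a1 a2 a3 w1 w2 w3) (T421 0 0 0 0 0 0 1 0 w3).
Proof.
set f := a1 * w1 - a2 * w2 + a3 * w3 => w30 f0.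
set T := T511 _ _ _ _ _ _.
have A : alternating T by apply: alternating_of_table.
pose v0 := vec7 [:: 1; 0; 0; 0; 0; 0; 0] : V.
pose v1 := vec7 [:: 0; 1; 0; 0; 0; 0; 0] : V.
pose v2 := vec7 [:: 0; 0; 1 - a1 * w1 / f; a1 * w2 / f; 0; - (a1 * w3 / f); 0] : V.
pose v3 := vec7 [:: 0; 0; - (a2 * w1 / f); 1 + a2 * w2 / f; 0; - (a2 * w3 / f); 0] : V.
pose v4 := vec7 [:: 0; 0; 0; 0; 1; 0; 0] : V.
pose v5 := vec7 [:: 0; 0; w1 / f; - (w2 / f); 0; w3 / f; 0] : V.
pose v6 := vec7 [:: 0; 0; 0; 0; 0; 0; 1] : V.
apply: isomorphic_sym.
apply: (@frame_iso _ _ _ [:: v0; v1; v2; v3; v4; v5; v6]).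
- by apply: alternating_of_table.
- exact: A.
- apply: T421_frame; first exact: A.
  + by move=> y; tbl (@T511E); ring.
  1-15: by tbl (@T511E); try ring; rewrite /f; field.
move=> x /frame_mx7_eq0 Hx; have C k : (k < 7)%N -> _ := fun=> Hx (o7 k).
move: (C 0%N isT) (C 1%N isT) (C 2%N isT) (C 3%N isT) (C 4%N isT) (C 5%N isT) (C 6%N isT).
rewrite !vec7_coord //= !zsimp => x0 x1 H2 H3 x4 H5 x6.
have g0 : x (o7 5) 0 - a1 * x (o7 2) 0 - a2 * x (o7 3) 0 = 0.
  apply: (mulIf w30); apply: (mulIf (invr_neq0 f0)); rewrite !mul0r -[RHS]H5; ring.
have {H2} x2 : x (o7 2) 0 = 0.
  rewrite -[RHS]H2 -[LHS]addr0 -[X in _ + X](mulr0 (w1 / f)) -g0; ring.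
have {H3} x3 : x (o7 3) 0 = 0.
  rewrite -[RHS]H3 -[LHS]addr0 -[X in _ + X](mulr0 (- (w2 / f))) -g0; ring.
by move: g0; rewrite x2 x3 !zsimp => x5; coords.
Qed.

Lemma robust_T511 (a1 a2 a3 w1 w2 w3 : R) : robust (T511 a1 a2 a3 w1 w2 w3) ->
  exists eps, (eps = 1 \/ eps = -1) /\ isomorphic (T511 a1 a2 a3 w1 w2 w3) (N137 eps).
Proof.
move=> rob.
pose l (x y t : R) : R := x + t * (y - x).
have l0 x y : l x y 0 = x by rewrite /l mul0r addr0.
have l1 x y : l x y 1 = y by rewrite /l mul1r addrC subrK.
pose M (t : R) := T511 (l a1 0 t) (l a2 0 t) (l a3 1 t) (l w1 0 t) (l w2 0 t) (l w3 1 t).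
have M0 : M 0 = T511 a1 a2 a3 w1 w2 w3 by rewrite /M !l0.
pose f (t : R) : R := l w3 1 t *
  (l a1 0 t * l w1 0 t - l a2 0 t * l w2 0 t + l a3 1 t * l w3 1 t).
have [|||||t [ft It]] := @robust_line R M f.
- by rewrite M0.
- by rewrite /M /l; affine_tac (@T511E).
- by move=> t; apply: T511_nil.
- by rewrite /f /l; polyfun_tac.
- by exists 1; rewrite /f !l1 !zsimp oner_neq0.
move: ft; rewrite /f mulf_eq0 negb_or => /andP[a b].
have I := isomorphic_trans It (T511_T421 a b); rewrite M0 in I.
have [eps [He J]] := robust_T421 (robust_iso I rob).
by exists eps; split=> //; apply: isomorphic_trans I J.
Qed.

End Families.

(** * The type (3,3,1) *)

Section Families2.
Variable R : realType.
Local Notation V := 'cV[R]_7.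
Local Notation E i := (evec R (o7 i)).
Implicit Types (mu nu : bilin R 7) (eps : R).

(** The middle step is the cross product of the three generators, and their action on it is
    the matrix with rows (a, b, c), (d, e, f), (g, h, - (a + e)): the Jacobi identity is the
    vanishing of its trace. *)
Definition T331 (a b c d e f g h : R) : bilin R 7 := of_table
  [:: (o7 1, o7 2, E 3); (o7 0, o7 2, - E 4); (o7 0, o7 1, E 5);
      (o7 0, o7 3, a *: E 6); (o7 0, o7 4, b *: E 6); (o7 0, o7 5, c *: E 6);
      (o7 1, o7 3, d *: E 6); (o7 1, o7 4, e *: E 6); (o7 1, o7 5, f *: E 6);
      (o7 2, o7 3, g *: E 6); (o7 2, o7 4, h *: E 6); (o7 2, o7 5, - (a + e) *: E 6)].

Lemma T331E a b c d e f g h x y :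
  bracket (T331 a b c d e f g h) x y = vec7
    [:: 0; 0; 0; minor2 x y 1 2; - minor2 x y 0 2; minor2 x y 0 1;
      a * minor2 x y 0 3 + b * minor2 x y 0 4 + c * minor2 x y 0 5
      + d * minor2 x y 1 3 + e * minor2 x y 1 4 + f * minor2 x y 1 5
      + g * minor2 x y 2 3 + h * minor2 x y 2 4 - (a + e) * minor2 x y 2 5].
Proof.
rewrite bracket_of_table !big_cons big_nil /= -!/(minor2 x y _ _).
by coords; ring.
Qed.

Lemma T331_level a b c d e f g h u z : low 3 u ->
  bracket (T331 a b c d e f g h) u z = vec7
    [:: 0; 0; 0; 0; 0; 0;
      - (u (o7 3) 0 * (a * z (o7 0) 0 + d * z (o7 1) 0 + g * z (o7 2) 0)
       + u (o7 4) 0 * (b * z (o7 0) 0 + e * z (o7 1) 0 + h * z (o7 2) 0)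
       + u (o7 5) 0 * (c * z (o7 0) 0 + f * z (o7 1) 0 - (a + e) * z (o7 2) 0))].
Proof.
move=> H; rewrite T331E; coords; rewrite /minor2 ?(H 0%N) ?(H 1%N) ?(H 2%N) //; ring.
Qed.

Lemma T331_low a b c d e f g h x y : low 3 (bracket (T331 a b c d e f g h) x y).
Proof. by rewrite T331E; low_tac. Qed.

Lemma T331_nil a b c d e f g h : nil_variety 3 (T331 a b c d e f g h).
Proof.
split; first (split; first exact: alternating_of_table).
  move=> x y z; rewrite /jacobiator ![bracket _ (bracket _ _ _) _]T331_level; try exact: T331_low.
  by rewrite !T331E; coords; rewrite ?vec7_coord //= /minor2; ring.
apply: (nil3_low (p := 3) (q := 6)) => [x y|x y lx|x y lx]; first exact: T331_low.
  by rewrite T331_level //; low_tac.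
rewrite T331_level; last exact: low_le lx.
by rewrite (lx 3%N) // (lx 4%N) // (lx 5%N) //; coords; ring.
Qed.

Definition s331 : bilin R 7 := of_table [:: (o7 1, o7 3, E 6)].

Lemma s331E x y : bracket s331 x y = vec7 [:: 0; 0; 0; 0; 0; 0; minor2 x y 1 3].
Proof.
rewrite bracket_of_table !big_cons big_nil /= -!/(minor2 x y _ _).
by coords; ring.
Qed.

Lemma s331_cocycle a b c d e f g h : cocycle 3 (T331 a b c d e f g h) s331.
Proof.
have ce u z : low 6 u -> bracket (T331 a b c d e f g h) u z = 0.
  move=> lu; rewrite T331_level; last exact: low_le lu.
  by rewrite (lu 3%N) // (lu 4%N) // (lu 5%N) //; coords; ring.
have cr u z : low 6 u -> bracket (T331 a b c d e f g h) z u = 0.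
  by move=> lu; rewrite (alternatingC _ _ (alternating_of_table _)) ce ?oppr0.
have ls x y : low 6 (bracket s331 x y) by rewrite s331E; low_tac.
have cs u z : low 4 u -> bracket s331 u z = 0.
  by move=> lu; rewrite s331E; coords; rewrite /minor2 (lu 1%N) // (lu 3%N) //; ring.
split; first exact: alternating_of_table.
- move=> x y z; rewrite /d2 ![bracket _ _ (bracket s331 _ _)]cr // !s331E.
  by rewrite !T331E; coords; rewrite /minor2 ?vec7_coord //= /minor2; ring.
move=> x /=; rewrite !bracket0l !addr0 bracketDl.
have l1 u v : low 3 u -> low 6 (bracket (T331 a b c d e f g h) u v).
  by move=> lu; rewrite T331_level //; low_tac.
rewrite cs; last by apply: low_le (l1 _ _ _) => //; apply: T331_low.
rewrite (ce _ _ (ls _ _)) !add0r ce //.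
by apply: l1; apply: low_le (ls _ _).
Qed.

(** With A the traceless 3 x 3 matrix of the parameters, a deformation A' of A is a
    coboundary only if A' = [A, X] + c A, and then A' is orthogonal for the trace form
    to tr(A^2) A^2 - tr(A^3) A. Here A' is an elementary matrix, so that one entry of
    this matrix must vanish. *)
Lemma T331_coboundary (a b c d e f g h : R) : B2 (T331 a b c d e f g h) s331 ->
  let i := - (a + e) in
  (a ^+ 2 + e ^+ 2 + i ^+ 2 + 2 * (b * d + c * g + f * h)) * (a * b + b * e + c * h)
  - 3 * (a * e * i + b * f * g + c * d * h - a * f * h - b * d * i - c * e * g) * b = 0.
Proof.
case=> X _ HX i.
pose x (r s : nat) : R := X (o7 r) (o7 s).
have XE r s : (r < 7)%N -> (s < 7)%N -> (X *m E s) (o7 r) 0 = x r s.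
  by move=> *; rewrite /evec -colE mxE.
have H u v k : (k < 7)%N ->
    (bracket s331 (E u) (E v)) (o7 k) 0 = (bracket (T331 a b c d e f g h) (E u) (X *m E v)) (o7 k) 0
      - (bracket (T331 a b c d e f g h) (E v) (X *m E u)) (o7 k) 0
      - (X *m bracket (T331 a b c d e f g h) (E u) (E v)) (o7 k) 0.
  by move=> k7; rewrite -HX d1E !entE.
have e0 u : bracket (T331 a b c d e f g h) (E 0) u = vec7 [:: 0; 0; 0; 0; - u (o7 2) 0;
    u (o7 1) 0; a * u (o7 3) 0 + b * u (o7 4) 0 + c * u (o7 5) 0].
  by rewrite T331E; coords; rewrite /minor2 !Ecoord //=; ring.
have e1 u : bracket (T331 a b c d e f g h) (E 1) u = vec7 [:: 0; 0; 0; u (o7 2) 0; 0;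
    - u (o7 0) 0; d * u (o7 3) 0 + e * u (o7 4) 0 + f * u (o7 5) 0].
  by rewrite T331E; coords; rewrite /minor2 !Ecoord //=; ring.
have e2 u : bracket (T331 a b c d e f g h) (E 2) u = vec7 [:: 0; 0; 0; - u (o7 1) 0;
    u (o7 0) 0; 0; g * u (o7 3) 0 + h * u (o7 4) 0 + i * u (o7 5) 0].
  by rewrite T331E; coords; rewrite /minor2 !Ecoord //= /i; ring.
have e3 u : bracket (T331 a b c d e f g h) (E 3) u = vec7 [:: 0; 0; 0; 0; 0; 0;
    - (a * u (o7 0) 0 + d * u (o7 1) 0 + g * u (o7 2) 0)].
  by rewrite T331_level; [coords; ring|apply: low_E].
have e4 u : bracket (T331 a b c d e f g h) (E 4) u = vec7 [:: 0; 0; 0; 0; 0; 0;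
    - (b * u (o7 0) 0 + e * u (o7 1) 0 + h * u (o7 2) 0)].
  by rewrite T331_level; [coords; ring|apply: low_E].
have e5 u : bracket (T331 a b c d e f g h) (E 5) u = vec7 [:: 0; 0; 0; 0; 0; 0;
    - (c * u (o7 0) 0 + f * u (o7 1) 0 + i * u (o7 2) 0)].
  by rewrite T331_level; [coords; rewrite /i; ring|apply: low_E].
have E01 : bracket (T331 a b c d e f g h) (E 0) (E 1) = E 5 by rewrite e0; coords; ring.
have E12 : bracket (T331 a b c d e f g h) (E 1) (E 2) = E 3 by rewrite e1; coords; ring.
have E20 : bracket (T331 a b c d e f g h) (E 2) (E 0) = E 4 by rewrite e2; coords; ring.
have H01 k : (2 < k < 6)%N -> x k 5 = (bracket (T331 a b c d e f g h) (E 0) (X *m E 1)) (o7 k) 0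
      - (bracket (T331 a b c d e f g h) (E 1) (X *m E 0)) (o7 k) 0.
  move=> /andP[k2 k6]; have k7 := ltnW k6; have := H 0 1 k k7; rewrite E01 XE // s331E.
  case: k k2 k6 {k7} => [|[|[|[|[|[|//]]]]]] // _ _; rewrite vec7_coord //= => /esym/eqP;
  by rewrite subr_eq0 => /eqP.
have H12 k : (2 < k < 6)%N -> x k 3 = (bracket (T331 a b c d e f g h) (E 1) (X *m E 2)) (o7 k) 0
      - (bracket (T331 a b c d e f g h) (E 2) (X *m E 1)) (o7 k) 0.
  move=> /andP[k2 k6]; have k7 := ltnW k6; have := H 1 2 k k7; rewrite E12 XE // s331E.
  case: k k2 k6 {k7} => [|[|[|[|[|[|//]]]]]] // _ _; rewrite vec7_coord //= => /esym/eqP;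
  by rewrite subr_eq0 => /eqP.
have H20 k : (2 < k < 6)%N -> x k 4 = (bracket (T331 a b c d e f g h) (E 2) (X *m E 0)) (o7 k) 0
      - (bracket (T331 a b c d e f g h) (E 0) (X *m E 2)) (o7 k) 0.
  move=> /andP[k2 k6]; have k7 := ltnW k6; have := H 2 0 k k7; rewrite E20 XE // s331E.
  case: k k2 k6 {k7} => [|[|[|[|[|[|//]]]]]] // _ _; rewrite vec7_coord //= => /esym/eqP;
  by rewrite subr_eq0 => /eqP.
have B00 : bracket (T331 a b c d e f g h) (E 0) (E 3) = (a) *: E 6.
  by rewrite e0; coords; ring.
have B01 : bracket (T331 a b c d e f g h) (E 0) (E 4) = (b) *: E 6.
  by rewrite e0; coords; ring.
have B02 : bracket (T331 a b c d e f g h) (E 0) (E 5) = (c) *: E 6.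
  by rewrite e0; coords; ring.
have B10 : bracket (T331 a b c d e f g h) (E 1) (E 3) = (d) *: E 6.
  by rewrite e1; coords; ring.
have B11 : bracket (T331 a b c d e f g h) (E 1) (E 4) = (e) *: E 6.
  by rewrite e1; coords; ring.
have B12 : bracket (T331 a b c d e f g h) (E 1) (E 5) = (f) *: E 6.
  by rewrite e1; coords; ring.
have B20 : bracket (T331 a b c d e f g h) (E 2) (E 3) = (g) *: E 6.
  by rewrite e2; coords; ring.
have B21 : bracket (T331 a b c d e f g h) (E 2) (E 4) = (h) *: E 6.
  by rewrite e2; coords; ring.
have B22 : bracket (T331 a b c d e f g h) (E 2) (E 5) = i *: E 6.
  by rewrite e2; coords; ring.
pose D (r s : nat) : R := ((r == 1%N) && (s == 0%N))%:R.
have K r s q : (r < 3)%N -> (s < 3)%N ->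
    bracket (T331 a b c d e f g h) (E r) (E (3 + s)) = q *: E 6 ->
    D r s = (bracket (T331 a b c d e f g h) (E r) (X *m E (3 + s))) (o7 6) 0
      - (bracket (T331 a b c d e f g h) (E (3 + s)) (X *m E r)) (o7 6) 0 - q * x 6 6.
  move=> r3 s3 Eq; have := H r (3 + s)%N 6 isT; rewrite Eq -scalemxAr entZ XE //= => <-.
  rewrite /D s331E vec7_coord //=; case: r s r3 s3 {Eq} => [|[|[|//]]] [|[|[|//]]] _ _;
  by rewrite minor2E //= ?subr0.
have K00 := K 0 0 _ isT isT B00.
have K01 := K 0 1 _ isT isT B01.
have K02 := K 0 2 _ isT isT B02.
have K10 := K 1 0 _ isT isT B10.
have K11 := K 1 1 _ isT isT B11.
have K12 := K 1 2 _ isT isT B12.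
have K20 := K 2 0 _ isT isT B20.
have K21 := K 2 1 _ isT isT B21.
have K22 := K 2 2 _ isT isT B22.
have W35 := H01 3 isT.
have W45 := H01 4 isT.
have W55 := H01 5 isT.
have W33 := H12 3 isT.
have W43 := H12 4 isT.
have W53 := H12 5 isT.
have W34 := H20 3 isT.
have W44 := H20 4 isT.
have W54 := H20 5 isT.
rewrite !e0 in K00 K01 K02 W34 W35 W44 W45 W54 W55.
rewrite !e1 in K10 K11 K12 W33 W35 W43 W45 W53 W55.
rewrite !e2 in K20 K21 K22 W33 W34 W43 W44 W53 W54.
rewrite !e3 in K00 K10 K20; rewrite !e4 in K01 K11 K21; rewrite !e5 in K02 K12 K22.
rewrite !vec7_coord //= !XE //= in K00 K01 K02.
rewrite !vec7_coord //= !XE //= in K10 K11 K12.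
rewrite !vec7_coord //= !XE //= in K20 K21 K22.
rewrite !vec7_coord //= !XE //= in W33 W34 W35.
rewrite !vec7_coord //= !XE //= in W43 W44 W45.
rewrite !vec7_coord //= !XE //= in W53 W54 W55.
pose t2 := a ^+ 2 + e ^+ 2 + i ^+ 2 + 2 * (b * d + c * g + f * h).
pose t3 := 3 * (a * e * i + b * f * g + c * d * h - a * f * h - b * d * i - c * e * g).
transitivity ((t2 * (a * a + b * d + c * g) - t3 * a) * D 0 0
   + (t2 * (d * a + e * d + f * g) - t3 * d) * D 0 1
   + (t2 * (g * a + h * d + i * g) - t3 * g) * D 0 2
   + (t2 * (a * b + b * e + c * h) - t3 * b) * D 1 0
   + (t2 * (d * b + e * e + f * h) - t3 * e) * D 1 1
   + (t2 * (g * b + h * e + i * h) - t3 * h) * D 1 2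
   + (t2 * (a * c + b * f + c * i) - t3 * c) * D 2 0
   + (t2 * (d * c + e * f + f * i) - t3 * f) * D 2 1
   + (t2 * (g * c + h * f + i * i) - t3 * i) * D 2 2).
  by rewrite /D /= /t2 /t3 /i; ring.
rewrite K00 K01 K02 K10 K11 K12 K20 K21 K22 W33 W34 W35 W43 W44 W45 W53 W54 W55 /t2 /t3 /i; ring.
Qed.

Lemma T331_not_robust (a b c d e f g h : R) : ~ robust (T331 a b c d e f g h).
Proof.
move=> rob.
pose l (x y t : R) : R := x + t * (y - x).
have l0 x y : l x y 0 = x by rewrite /l mul0r addr0.
have l1 x y : l x y 1 = y by rewrite /l mul1r addrC subrK.
(* the endpoint of the line is the cyclic permutation matrix *)
pose M (t : R) := T331 (l a 0 t) (l b 1 t) (l c 0 t) (l d 0 t) (l e 0 t) (l f 1 t)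
  (l g 1 t) (l h 0 t).
have M0 : M 0 = T331 a b c d e f g h by rewrite /M !l0.
pose P (a b c d e f g h : R) : R := let i := - (a + e) in
  (a ^+ 2 + e ^+ 2 + i ^+ 2 + 2 * (b * d + c * g + f * h)) * (a * b + b * e + c * h)
  - 3 * (a * e * i + b * f * g + c * d * h - a * f * h - b * d * i - c * e * g) * b.
pose F (t : R) : R := P (l a 0 t) (l b 1 t) (l c 0 t) (l d 0 t) (l e 0 t) (l f 1 t)
  (l g 1 t) (l h 0 t).
have [|||||t [ft It]] := @robust_line R M F.
- by rewrite M0.
- by rewrite /M /l; affine_tac (@T331E).
- by move=> t; apply: T331_nil.
- by rewrite /F /P /l; polyfun_tac.
- exists 1; rewrite (_ : F 1 = - 3%:R) ?oppr_eq0 ?pnatr_eq0 //.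
  by rewrite /F !l1 /P; ring.
move/eqP: ft; apply; rewrite M0 in It.
have [_ rob'] := robust_iso It rob.
exact: T331_coboundary (rob' _ (s331_cocycle _ _ _ _ _ _ _ _)).
Qed.

End Families2.

(** * Bases adapted to the lower central series *)

Section LinearAlgebra.
Variable F : fieldType.

Lemma ker_vec m k (M : 'M[F]_(k, m)) : (m < k)%N -> exists2 u : 'rV_k, u != 0 & u *m M = 0.
Proof.
move=> mk; have : kermx M != 0.
  by rewrite -mxrank_eq0 mxrank_ker subn_eq0 -ltnNge (leq_ltn_trans (rank_leq_col M)).
case/rowV0Pn => u /sub_kermxP Hu u0; by exists u.
Qed.

Lemma colfree_rank m k (G : 'M[F]_(k, m)) :
  (forall c : 'cV_m, G *m c = 0 -> c = 0) -> \rank G = m.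
Proof.
move=> H; rewrite -mxrank_tr; apply/eqP; rewrite -[_ == _]/(row_free G^T) -kermx_eq0.
apply/rowV0P => u /sub_kermxP Hu; apply: trmx_inj; rewrite trmx0; apply: H.
by rewrite -[G]trmxK -trmx_mul Hu trmx0.
Qed.

Lemma colfree_unit n (G : 'M[F]_n) :
  (forall c : 'cV_n, G *m c = 0 -> c = 0) -> G \in unitmx.
Proof. by move=> H; rewrite -row_full_unit /row_full colfree_rank. Qed.

(** Gaussian elimination, with the basis in the rows of [B]: the first [m] vectors are dual to
    the columns of [G], the others annihilate them. *)
Lemma dual_basis m k (G : 'M[F]_(m + k, m)) : \rank G = m ->
  exists B : 'M[F]_(m + k), B \in unitmx /\ B *m G = col_mx 1%:M 0.
Proof.
move=> rG; have fG : row_full G by rewrite /row_full rG.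
exists (block_mx (invmx (row_ebase G)) 0 0 1%:M *m invmx (col_ebase G)); split.
  rewrite unitmx_mul unitmx_inv col_ebase_unit andbT unitmxE det_ublock det1 mulr1.
  by rewrite -unitmxE unitmx_inv row_ebase_unit.
have EG : G = col_ebase G *m pid_mx m *m row_ebase G by rewrite -{1}[G]mulmx_ebase rG.
rewrite [X in _ *m X = _]EG -!mulmxA mulKmx ?col_ebase_unit //.
have -> : (pid_mx m : 'M[F]_(m + k, m)) = col_mx 1%:M 0.
  by rewrite pid_mx_col.
rewrite (mul_col_mx 1%:M 0 (row_ebase G)) mul1mx mul0mx mul_block_col !mulmx0 !mul0mx !addr0 mulVmx //.
exact: row_ebase_unit.
Qed.

(** Take a row space of maximal rank on which [P] holds. *)
Lemma subspace_mx n (P : 'rV[F]_n -> Prop) : P 0 ->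
  (forall a u v, P u -> P v -> P (a *: u + v)) ->
  exists K : 'M[F]_n, forall u, (u <= K)%MS <-> P u.
Proof.
move=> P0 PD.
pose Q r := `[< exists2 K : 'M[F]_n, \rank K = r & forall u, (u <= K)%MS -> P u >].
have Q0 : exists r, Q r.
  by exists 0%N; apply/asboolP; exists 0; rewrite ?mxrank0 // => u; rewrite submx0 => /eqP ->.
have Qn r : Q r -> (r <= n)%N by move/asboolP => [K <- _]; apply: rank_leq_col.
case: (ex_maxnP Q0 Qn) => r /asboolP[K rK PK] max; exists K => u; split; first exact: PK.
move=> Pu; apply/negPn/negP => nu.
have : (\rank (K + <<u>>)%MS <= r)%N.
  apply: max; apply/asboolP; exists (K + <<u>>)%MS => // v /sub_addsmxP[[a b] ->].
  rewrite addrC; have : (b *m <<u>>%MS <= u)%MS by rewrite -(genmxE u) submxMl.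
  by move=> /sub_rVP[c ->]; apply: PD => //; apply: PK; apply: submxMl.
apply/negP; rewrite -ltnNge -rK; apply: rank_ltmx.
by rewrite ltmxE addsmxSl /= addsmx_sub submx_refl /= genmxE.
Qed.

Lemma mulmx_castr a m n (e : a = n) (u : 'rV[F]_n) (B : 'M[F]_(a, m)) :
  u *m castmx (e, erefl m) B = castmx (erefl 1%N, esym e) u *m B.
Proof. by case: n / e u => u; rewrite !castmx_id. Qed.

(** The basis consists of bases of a complement of [K1], of a complement of [K2] in [K1],
    and of [K2]. *)
Lemma flag_basis n (K1 K2 : 'M[F]_n) : (K2 <= K1)%MS ->
  exists p q (b : 'M[F]_n), [/\ b \in unitmx, (p + q <= n)%N,
    forall u : 'rV_n, (u *m b <= K1)%MS <-> forall i : 'I_n, (i < p)%N -> u 0 i = 0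
  & forall u : 'rV_n, (u *m b <= K2)%MS <-> forall i : 'I_n, (i < p + q)%N -> u 0 i = 0].
Proof.
move=> s21; pose p : nat := \rank (K1^C)%MS; pose q : nat := \rank (K1 :\: K2)%MS; pose r : nat := \rank K2.
have rK1 : (r + q = \rank K1)%N by rewrite /q -(mxrank_cap_compl K1 K2) (capmx_idPr s21).
have e : (p + (q + r) = n)%N.
  by rewrite [(q + r)%N]addnC rK1 /p mxrank_compl subnK // rank_leq_col.
pose C : 'M[F]_(p, n) := row_base (K1^C)%MS; pose D : 'M[F]_(q, n) := row_base (K1 :\: K2)%MS.
pose Z : 'M[F]_(r, n) := row_base K2.
pose b := col_mx C (col_mx D Z).
pose cu (u : 'rV[F]_n) : 'rV[F]_(p + (q + r)) := castmx (erefl 1%N, esym e) u.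
have cE u (i : 'I_(p + (q + r))) (j : 'I_n) : i = j :> nat -> cu u 0 i = u 0 j.
  move=> ij; rewrite castmxE /= cast_ord_id esymK; congr (u _ _).
  by apply: val_inj.
have uE u : u *m castmx (e, erefl n) b = lsubmx (cu u) *m C
    + (lsubmx (rsubmx (cu u)) *m D + rsubmx (rsubmx (cu u)) *m Z).
  by rewrite -!mul_row_col !hsubmxK mulmx_castr.
have sD : (D <= K1)%MS by rewrite eq_row_base diffmxSl.
have sZ : (Z <= K1)%MS by rewrite eq_row_base.
have C0 u : (u *m C <= K1)%MS -> u = 0.
  move=> H; apply: (row_free_inj (row_base_free (K1^C)%MS)); rewrite mul0mx.
  apply/eqP; rewrite -submx0 -(capmx_compl K1) sub_capmx H.
  by rewrite -(eq_row_base (K1^C)%MS) submxMl.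
have D0 u : (u *m D <= K2)%MS -> u = 0.
  move=> H; apply: (row_free_inj (row_base_free (K1 :\: K2)%MS)); rewrite mul0mx.
  apply/eqP; rewrite -submx0 -(capmx_diff K1 K2) sub_capmx H andbT.
  by rewrite -(eq_row_base (K1 :\: K2)%MS) submxMl.
have P1 u : (u *m castmx (e, erefl n) b <= K1)%MS <-> lsubmx (cu u) = 0.
  rewrite uE; set w := (X in _ + X); have sw : (w <= K1)%MS.
    by rewrite addmx_sub // mulmx_sub.
  split=> [H|->]; last by rewrite mul0mx add0r.
  apply: C0; rewrite -[_ *m C](addrK w) addmx_sub ?eqmx_opp //.
have P2 u : (u *m castmx (e, erefl n) b <= K2)%MS <->
    lsubmx (cu u) = 0 /\ lsubmx (rsubmx (cu u)) = 0.
  split=> [H|]; last first.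
    by rewrite uE => -[-> ->]; rewrite !mul0mx !add0r mulmx_sub ?eq_row_base.
  have z1 : lsubmx (cu u) = 0 by apply/P1; apply: submx_trans H s21.
  split=> //; apply: D0; move: H; rewrite uE z1 mul0mx add0r => H.
  rewrite -[_ *m D](addrK (rsubmx (rsubmx (cu u)) *m Z)) addmx_sub ?eqmx_opp //.
  by rewrite mulmx_sub ?eq_row_base.
have L1 u : lsubmx (cu u) = 0 <-> forall i : 'I_n, (i < p)%N -> u 0 i = 0.
  split=> [/rowP H i ip|H].
    by have := H (Ordinal ip); rewrite !mxE => <-; apply/esym/cE.
  apply/rowP => j; rewrite !mxE; have jn : (j < n)%N by rewrite -e ltn_addr.
  by rewrite (cE _ _ (Ordinal jn)) // H //= ltn_ord.
have L2 u : lsubmx (rsubmx (cu u)) = 0 <->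
    forall i : 'I_n, (p <= i < p + q)%N -> u 0 i = 0.
  split=> [/rowP H i /andP[ip iq]|H].
    have iq' : (i - p < q)%N by rewrite ltn_subLR.
    by have := H (Ordinal iq'); rewrite !mxE => <-; apply/esym/cE; rewrite /= subnKC.
  apply/rowP => j; rewrite !mxE.
  have jn : (p + j < n)%N by rewrite -e ltn_add2l ltn_addr.
  by rewrite (cE _ _ (Ordinal jn)) // H //= leq_addr ltn_add2l ltn_ord.
exists p, q, (castmx (e, erefl n) b); split.
- rewrite -row_free_unit -kermx_eq0; apply/rowV0P => u /sub_kermxP Hu.
  have [z1 z2] : lsubmx (cu u) = 0 /\ lsubmx (rsubmx (cu u)) = 0.
    by apply/P2; rewrite Hu sub0mx.
  have z3 : rsubmx (rsubmx (cu u)) = 0.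
    apply: (row_free_inj (row_base_free K2)); rewrite mul0mx -[RHS]Hu uE z1 z2.
    by rewrite !mul0mx !add0r.
  have cu0 : cu u = 0 by rewrite -[cu u]hsubmxK z1 -[rsubmx _]hsubmxK z2 z3 !row_mx0.
  apply/rowP => i; have ip : (i < p + (q + r))%N by rewrite e.
  by rewrite -(cE u (Ordinal ip)) // cu0 !mxE.
- by rewrite -e leq_add2l leq_addr.
- by move=> u; rewrite P1 L1.
move=> u; rewrite P2 L1 L2; split=> [[H1 H2] i ipq|H].
  by case: (ltnP i p) => ip; [apply: H1|apply: H2; rewrite ip].
by split=> i; [move=> ip; apply/H/ltn_addr|case/andP => _; apply: H].
Qed.
End LinearAlgebra.

Section Filtered.
Variable F : fieldType.
Local Notation V := 'cV[F]_7.
Local Notation E i := (evec F (o7 i)).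
Implicit Types (mu nu : bilin F 7) (x y z u v w : V).

(** The coordinates from [p] on contain the brackets and those from [p + q] on the triple
    brackets; the last condition holds because the brackets of brackets are quadruple. *)
Record filtered mu p q : Prop := Filtered {
  filtered_nil : nil_variety 3 mu;
  filtered1 : forall x y, low p (bracket mu x y);
  filtered2 : forall x y, low p x -> low (p + q) (bracket mu x y);
  filtered3 : forall x, low (p + q) x -> central mu x;
  filtered_abelian : forall x y, low p x -> low p y -> bracket mu x y = 0 }.

(** Every functional that vanishes on the brackets vanishes on the step of the
    filtration where they lie; that is, the brackets span this step. *)
Definition onto mu p q :=
  (forall phi : 'rV[F]_7, (forall x y, phi *m bracket mu x y = 0) ->
     forall u, low p u -> phi *m u = 0) /\
  (forall phi : 'rV[F]_7, (forall x y, low p x -> phi *m bracket mu x y = 0) ->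
     forall u, low (p + q) u -> phi *m u = 0).

Definition adr mu y : 'M[F]_7 := \matrix_(k, i) (bracket mu (E i) y) k 0.

Lemma adrE mu y x : bracket mu x y = adr mu y *m x.
Proof.
rewrite {1}[x]vec7E bracket_suml {2}[x]vec7E mulmx_sumr; apply: eq_bigr => i _.
rewrite bracketZl -scalemxAr; congr (_ *: _); rewrite /evec -colE.
by apply/colP => k; rewrite [RHS]mxE [RHS]mxE /evec !inord_val.
Qed.

(** A linear map on V = F^n vanishes on a double annihilator as soon as it vanishes
    on the original vectors. *)
Lemma annihilator_mx (S : V -> Prop) u :
  (forall phi : 'rV[F]_7, (forall v, S v -> phi *m v = 0) -> phi *m u = 0) ->
  forall A : 'M[F]_7, (forall v, S v -> A *m v = 0) -> A *m u = 0.
Proof.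
move=> H A HA; apply/row_matrixP => i; rewrite row_mul row0 H // => v Sv.
by rewrite -row_mul HA // row0.
Qed.

(** The first two steps of the lower central series as double annihilators, which spares
    the choice of spanning families. *)
Definition C1 mu v := forall phi : 'rV[F]_7,
  (forall x y, phi *m bracket mu x y = 0) -> phi *m v = 0.
Definition C2 mu v := forall phi : 'rV[F]_7,
  (forall x y, C1 mu x -> phi *m bracket mu x y = 0) -> phi *m v = 0.

Lemma C1_mx mu u (A : 'M[F]_7) : C1 mu u -> (forall x y, A *m bracket mu x y = 0) -> A *m u = 0.
Proof.
move=> H HA; apply: (annihilator_mx (S := fun v => exists x y, v = bracket mu x y)).
  by move=> phi Hp; apply: H => x y; apply: Hp; exists x, y.
by move=> _ [x [y ->]].
Qed.

Lemma C2_mx mu u (A : 'M[F]_7) : C2 mu u ->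
  (forall x y, C1 mu x -> A *m bracket mu x y = 0) -> A *m u = 0.
Proof.
move=> H HA; apply: (annihilator_mx (S := fun v => exists x y, C1 mu x /\ v = bracket mu x y)).
  by move=> phi Hp; apply: H => x y Cx; apply: Hp; exists x, y.
by move=> _ [x [y [Cx ->]]]; apply: HA.
Qed.

Section Nil3.
Variable mu : bilin F 7.
Hypothesis N : nil_variety 3 mu.
Let A : alternating mu. Proof. by case: N => [[]]. Qed.

Lemma bracket4 x y z w : bracket mu (bracket mu (bracket mu x y) z) w = 0.
Proof.
have [_ H] := N.
exact: (H (fun i => nth 0 [:: x; y; z; w] i)).
Qed.

Lemma C2_central v : C2 mu v -> central mu v.
Proof.
move=> Cv y; rewrite adrE; apply: (C2_mx Cv) => a b Ca.
rewrite -adrE adrE adrE mulmxA; apply: (C1_mx Ca) => x' y'.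
by rewrite -mulmxA -!adrE bracket4.
Qed.

Lemma C1_abelian u v : C1 mu u -> C1 mu v -> bracket mu u v = 0.
Proof.
move=> Cu Cv; rewrite adrE; apply: (C1_mx Cu) => x y; rewrite -adrE.
rewrite (alternatingC _ _ A) adrE -mulNmx; apply: (C1_mx Cv) => a b.
have [L _] := N.
by rewrite mulNmx -adrE (jacobiL _ _ _ L) bracket4 addr0 (alternatingC _ _ A) bracket4 !oppr0.
Qed.
End Nil3.

Lemma C1_lin mu a u v : C1 mu u -> C1 mu v -> C1 mu (a *: u + v).
Proof. by move=> Hu Hv phi H; rewrite mulmxDr -scalemxAr Hu // Hv // scaler0 addr0. Qed.
Lemma C2_lin mu a u v : C2 mu u -> C2 mu v -> C2 mu (a *: u + v).
Proof. by move=> Hu Hv phi H; rewrite mulmxDr -scalemxAr Hu // Hv // scaler0 addr0. Qed.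

Lemma filtered_transport mu p q (g : 'M[F]_7) : nil_variety 3 mu -> g \in unitmx ->
  (forall u, C1 mu (g *m u) <-> low p u) -> (forall u, C2 mu (g *m u) <-> low (p + q) u) ->
  exists nu, [/\ isomorphic mu nu, filtered nu p q & onto nu p q].
Proof.
move=> N gu H1 H2; pose nu := gl_act (invmx g) mu.
have iso : isomorphic mu nu by apply/gl_orbitP; exists (invmx g); rewrite //= unitmx_inv.
have gE x y : g *m bracket nu x y = bracket mu (g *m x) (g *m y).
  by rewrite gl_actE invmxK mulKVmx.
have nu0 x y : bracket mu (g *m x) (g *m y) = 0 -> bracket nu x y = 0.
  by move=> H; apply: (can_inj (mulKmx gu)); rewrite gE H mulmx0.
have back phi x y : phi *m invmx g *m bracket mu x y =
    phi *m bracket nu (invmx g *m x) (invmx g *m y) :> 'rV_1.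
  by rewrite -mulmxA; congr (_ *m _); apply: (can_inj (mulKmx gu)); rewrite gE !mulKVmx.
exists nu; split=> //.
  split; first exact: nil_variety_iso iso N.
  - by move=> x y; apply/H1; rewrite gE => phi; apply.
  - by move=> x y /H1 lx; apply/H2; rewrite gE => phi; apply.
  - by move=> x /H2 lx y; apply: nu0; apply: C2_central lx _.
  - by move=> x y /H1 lx /H1 ly; apply: nu0; apply: C1_abelian.
split=> [phi H u /H1 lu|phi H u /H2 lu].
  have := lu (phi *m invmx g); rewrite -mulmxA mulKmx //; apply=> x y.
  by rewrite back H.
have := lu (phi *m invmx g); rewrite -mulmxA mulKmx //; apply=> x y Cx.
by rewrite back H //; apply/H1; rewrite mulKVmx.
Qed.

Lemma filtered_exists mu : nil_variety 3 mu ->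
  exists p q nu, [/\ isomorphic mu nu, (p + q <= 7)%N, filtered nu p q & onto nu p q].
Proof.
move=> N.
have c10 : C1 mu 0 by move=> phi _; rewrite mulmx0.
have c20 : C2 mu 0 by move=> phi _; rewrite mulmx0.
have [|a u v Hu Hv|K1 HK1] := @subspace_mx F 7 (fun u : 'rV[F]_7 => C1 mu u^T).
- by rewrite trmx0.
- by rewrite linearP; apply: C1_lin.
have [|a u v Hu Hv|K2 HK2] := @subspace_mx F 7 (fun u : 'rV[F]_7 => C2 mu u^T).
- by rewrite trmx0.
- by rewrite linearP; apply: C2_lin.
have s21 : (K2 <= K1)%MS.
  apply/rV_subP => u /HK2 Cu; apply/HK1 => phi Hphi; apply: Cu => x y _; exact: Hphi.
have [p [q [b [bu pq P1 P2]]]] := flag_basis s21.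
have lowE k u : low k u <-> forall i : 'I_7, (i < k)%N -> u^T 0 i = 0.
  split=> [H i ik|H i ik]; first by rewrite mxE -(inord_val i) H.
  case: (ltnP i 7) => i7; last first.
    have -> : o7 i = o7 0 by apply: val_inj; rewrite /inord !val_insubd ltnNge i7.
    by rewrite -(H (o7 0)) ?mxE ?inordK //; apply: leq_ltn_trans ik.
  by have := H (o7 i); rewrite mxE inordK // => ->.
have [|u|u|nu [I Fn On]] := @filtered_transport mu p q b^T N.
- by rewrite unitmx_tr.
- by rewrite lowE -P1 HK1 trmx_mul trmxK.
- by rewrite lowE -P2 HK2 trmx_mul trmxK.
by exists p, q, nu.
Qed.

Section FilteredTheory.
Variables (mu : bilin F 7) (p q : nat).
Hypothesis Fm : filtered mu p q.

Lemma filtered_lie : is_lie mu. Proof. by case: (filtered_nil Fm). Qed.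
Lemma filtered_alt : alternating mu. Proof. by case: filtered_lie. Qed.

Lemma filtered2r x y : low p y -> low (p + q) (bracket mu x y).
Proof.
by move=> ly; rewrite (alternatingC _ _ filtered_alt); apply/lowN/filtered2.
Qed.

(** The first step modulo the second is spanned by the brackets of the
    complementary basis vectors. *)
Lemma onto_basis1 (phi : 'rV[F]_7) : onto mu p q ->
  (forall i j, (i < j < p)%N -> phi *m bracket mu (E i) (E j) = 0) ->
  (forall u, low (p + q) u -> phi *m u = 0) -> forall u, low p u -> phi *m u = 0.
Proof.
move=> [sp _] H1 H2; apply: sp => x y; rewrite (vec7E x) (vec7E y) bracket_suml mulmx_sumr.
rewrite big1 // => i _; rewrite bracket_sumr mulmx_sumr big1 // => j _.
rewrite bracketZl bracketZr -!scalemxAr; suff -> : phi *m bracket mu (E i) (E j) = 0.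
  by rewrite !scaler0.
case: (ltnP i p) => ip; last first.
  by apply/H2/(filtered2 Fm)/low_E; rewrite ip ltn_ord.
case: (ltnP j p) => jp; last first.
  by apply/H2/filtered2r/low_E; rewrite jp ltn_ord.
case: (ltngtP i j) => [ij|ji|->]; first by apply: H1; rewrite ij.
  by rewrite (alternatingC _ _ filtered_alt) mulmxN H1 ?oppr0 // ji.
by rewrite filtered_alt mulmx0.
Qed.

Lemma onto_basis2 (phi : 'rV[F]_7) : onto mu p q ->
  (forall i j, (i < p)%N -> (p <= j < p + q)%N -> phi *m bracket mu (E i) (E j) = 0) ->
  forall u, low (p + q) u -> phi *m u = 0.
Proof.
move=> [_ sp] H; apply: sp => x y lx; rewrite (vec7E x) (vec7E y) bracket_suml mulmx_sumr.
rewrite big1 // => i _; rewrite bracketZl -scalemxAr.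
case: (ltnP i p) => ip; first by rewrite (lx _ ip) scale0r.
have li : low p (E i) by apply: low_E; rewrite ip ltn_ord.
rewrite bracket_sumr mulmx_sumr big1 ?scaler0 // => j _.
rewrite bracketZr -scalemxAr; suff -> : bracket mu (E i) (E j) = - bracket mu (E j) (E i).
  case: (ltnP j p) => jp; last first.
    rewrite (filtered_abelian Fm) ?oppr0 ?mulmx0 ?scaler0 //.
    by apply: low_E; rewrite jp ltn_ord.
  case: (ltnP i (p + q)) => iq; first by rewrite mulmxN H ?oppr0 ?scaler0 ?ip.
  rewrite -(alternatingC _ _ filtered_alt) (filtered3 Fm) ?mulmx0 ?scaler0 //.
  by apply: low_E; rewrite iq ltn_ord.
exact: alternatingC filtered_alt.
Qed.

End FilteredTheory.

Section ChangeBasis.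
Variables (p : nat) (B : 'M[F]_p).
Hypotheses (p7 : (p <= 7)%N) (Bu : B \in unitmx).
Let wd : 'I_p -> 'I_7 := widen_ord p7.

(** The rows of [B] become the first [p] basis vectors, the others are kept; brackets in the
    first step keep their coordinates. *)
Definition rowvec k : V := \sum_j B k j *: E (val j).

Definition chg_mx : 'M[F]_7 := frame_mx
  (mkseq (fun k => if insub k is Some k' then rowvec k' else E k) 7).

Lemma chg_E (k : 'I_p) : chg_mx *m E k = rowvec k.
Proof.
have k7 := leq_trans (ltn_ord k) p7.
rewrite frame_mxE // nth_mkseq // insubT ?ltn_ord // => H.
by congr (rowvec _); apply: val_inj.
Qed.

Lemma chg_high k : (p <= k < 7)%N -> chg_mx *m E k = E k.
Proof. by case/andP=> pk k7; rewrite frame_mxE // nth_mkseq // insubF // ltnNge pk. Qed.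

Lemma chg_low u : low p u -> chg_mx *m u = u.
Proof.
move=> lu; rewrite [u]vec7E mulmx_sumr; apply: eq_bigr => i _; rewrite -scalemxAr.
case: (ltnP i p) => ip; first by rewrite (lu _ ip) !scale0r.
by rewrite chg_high // ip ltn_ord.
Qed.

Lemma chg_coord u (j : 'I_p) : (chg_mx *m u) (o7 j) 0 = \sum_k u (o7 (val k)) 0 * B k j.
Proof.
have j7 := leq_trans (ltn_ord j) p7.
rewrite {1}[u]vec7E mulmx_sumr summxE.
rewrite (bigID (fun i : 'I_7 => (i < p)%N)) /= [X in _ + X]big1 ?addr0; last first.
  move=> i ip; rewrite -scalemxAr mxE chg_high ?ltn_ord ?andbT 1?leqNgt // Ecoord //.
  by rewrite gtn_eqF ?mulr0 // (leq_trans (ltn_ord j)) // leqNgt.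
rewrite (reindex_onto wd (fun i : 'I_7 => insubd j (val i))) /=; last first.
  by move=> i ip; apply: val_inj; rewrite /= insubdK.
apply: eq_big => [k|k _].
  by rewrite ltn_ord -val_eqE /= valKd eqxx.
rewrite -scalemxAr mxE chg_E; congr (_ * _); rewrite summxE (bigD1 j) //= big1 ?addr0.
  by rewrite mxE Ecoord // eqxx mulr1.
move=> i ij; rewrite mxE Ecoord ?(leq_trans (ltn_ord i)) //.
by rewrite -[(_ == _)]/(i == j) (negbTE ij) mulr0.
Qed.

Lemma chg_lowE m u : (p <= m)%N -> low m (chg_mx *m u) <-> low m u.
Proof.
move=> pm; have key : low p (chg_mx *m u) -> low p u.
  move=> H; pose w : 'rV[F]_p := \row_k u (o7 (val k)) 0.
  have w0 : w = 0.
    apply: (can_inj (mulmxK Bu)); rewrite mul0mx; apply/rowP => j; rewrite !mxE.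
    have := H j (ltn_ord j); rewrite chg_coord => E0; rewrite -[RHS]E0.
    by apply: eq_bigr => k _; rewrite mxE.
  by move=> k kp; have := congr1 (fun w : 'rV_p => w 0 (Ordinal kp)) w0; rewrite !mxE.
split=> H; last by rewrite chg_low //; apply: low_le H.
by have lu := key (low_le pm H); rewrite chg_low in H.
Qed.

Lemma chg_unit : chg_mx \in unitmx.
Proof.
apply: unitmx_inj => x Hx; have lx : low p x by apply/chg_lowE; rewrite // Hx; apply: low0.
by rewrite -(chg_low lx).
Qed.

Lemma change_basis mu q : filtered mu p q ->
  exists nu, [/\ isomorphic mu nu, filtered nu p q, onto mu p q -> onto nu p q,
    forall (k : 'I_p) l, (p <= l < 7)%N ->
      bracket nu (E k) (E l) = \sum_j B k j *: bracket mu (E (val j)) (E l)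
  & forall k l : 'I_p, bracket nu (E k) (E l) =
      \sum_i \sum_j (B k i * B l j) *: bracket mu (E (val i)) (E (val j))].
Proof.
move=> Fm; set g := chg_mx; have gu : g \in unitmx := chg_unit.
pose nu := gl_act (invmx g) mu.
have iso : isomorphic mu nu by apply/gl_orbitP; exists (invmx g); rewrite //= unitmx_inv.
have gE x y : g *m bracket nu x y = bracket mu (g *m x) (g *m y).
  by rewrite gl_actE invmxK mulKVmx.
have l1 x y : low p (bracket nu x y).
  by apply/chg_lowE => //; rewrite -/g gE; apply: filtered1 Fm _ _.
have nuE x y : bracket nu x y = bracket mu (g *m x) (g *m y).
  by rewrite -gE chg_low.
have pq : (p <= p + q)%N by apply: leq_addr.
have gV u : g *m (invmx g *m u) = u by rewrite mulKVmx.
exists nu; split=> //.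
- split=> //; first exact: nil_variety_iso iso (filtered_nil Fm).
  + by move=> x y lx; rewrite nuE; apply: (filtered2 Fm); apply/chg_lowE.
  + by move=> x lx y; rewrite nuE; apply: (filtered3 Fm); apply/chg_lowE.
  + by move=> x y lx ly; rewrite nuE; apply: (filtered_abelian Fm); apply/chg_lowE.
- case=> O1 O2; split=> phi H u lu.
    by apply: O1 => // x y; rewrite -(gV x) -(gV y) -nuE.
  apply: O2 => // x y lx; rewrite -(gV x) -(gV y) -nuE; apply: H.
  by apply/(chg_lowE _ (leqnn p)); rewrite -/g gV.
- move=> k l /[dup] lp /low_E ll; rewrite nuE chg_E (chg_high lp) /rowvec bracket_suml.
  by apply: eq_bigr => j _; rewrite bracketZl.
move=> k l; rewrite nuE !chg_E /rowvec bracket_suml; apply: eq_bigr => i _.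
by rewrite bracket_sumr; apply: eq_bigr => j _; rewrite bracketZl bracketZr scalerA.
Qed.

End ChangeBasis.

End Filtered.

(** * Structures of a given type *)

Section Reduction.
Variable R : realType.
Local Notation V := 'cV[R]_7.
Local Notation E i := (evec R (o7 i)).
Implicit Types (mu nu : bilin R 7) (eps : R) (u v w : V).

Lemma functional7 l u : ((vec7 l)^T *m u = 0 :> 'M[R]_1) <->
  nth 0 l 0 * u (o7 0) 0 + nth 0 l 1 * u (o7 1) 0 + nth 0 l 2 * u (o7 2) 0
  + nth 0 l 3 * u (o7 3) 0 + nth 0 l 4 * u (o7 4) 0 + nth 0 l 5 * u (o7 5) 0
  + nth 0 l 6 * u (o7 6) 0 = 0.
Proof.
have -> : (vec7 l)^T *m u = (nth 0 l 0 * u (o7 0) 0 + nth 0 l 1 * u (o7 1) 0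
  + nth 0 l 2 * u (o7 2) 0 + nth 0 l 3 * u (o7 3) 0 + nth 0 l 4 * u (o7 4) 0
  + nth 0 l 5 * u (o7 5) 0 + nth 0 l 6 * u (o7 6) 0)%:M.
  rewrite [LHS]mx11_scalar; congr (_%:M); rewrite mxE -(sum7 (fun k => nth 0 l k * u (o7 k) 0)).
  by apply: eq_bigr => i _; rewrite !mxE inord_val.
split=> [/(congr1 (fun A : 'M[R]_1 => A 0 0))|->]; first by rewrite !mxE eqxx mulr1n.
exact: raddf0.
Qed.

Lemma functional_low l p : (forall u, low p u -> (vec7 l)^T *m u = 0 :> 'M[R]_1) ->
  forall k, (p <= k < 7)%N -> nth 0 l k = 0.
Proof.
move=> H k pk; have := congr1 (fun M : 'M[R]_1 => M 0 0) (H _ (low_E _ pk)).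
by case/andP: pk => _ k7; rewrite /evec -colE !mxE inordK.
Qed.

Lemma low3E u : low 3 u -> u = u (o7 3) 0 *: E 3 + u (o7 4) 0 *: E 4 + u (o7 5) 0 *: E 5 + u (o7 6) 0 *: E 6.
Proof. by move=> l; coords; rewrite ?(l 0%N) ?(l 1%N) ?(l 2%N) //; ring. Qed.
Lemma low4E u : low 4 u -> u = u (o7 4) 0 *: E 4 + u (o7 5) 0 *: E 5 + u (o7 6) 0 *: E 6.
Proof. by move=> l; coords; rewrite ?(l 0%N) ?(l 1%N) ?(l 2%N) ?(l 3%N) //; ring. Qed.
Lemma low5E u : low 5 u -> u = u (o7 5) 0 *: E 5 + u (o7 6) 0 *: E 6.
Proof. by move=> l; coords; rewrite ?(l 0%N) ?(l 1%N) ?(l 2%N) ?(l 3%N) ?(l 4%N) //; ring. Qed.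
Lemma low6E u : low 6 u -> u = u (o7 6) 0 *: E 6.
Proof. by move=> l; coords; rewrite ?(l 0%N) ?(l 1%N) ?(l 2%N) ?(l 3%N) ?(l 4%N) ?(l 5%N) //; ring. Qed.

Lemma basis_entry m k G (B : 'M[R]_(m + k)) : B *m G = col_mx 1%:M 0 ->
  forall i (j : 'I_m), \sum_l B i l * G l j = (val i == val j)%:R.
Proof.
move=> H i j; have := congr1 (fun M : 'M[R]_(m + k, m) => M i j) H; rewrite !mxE => ->.
by case: splitP => i' Hi; rewrite mxE /= Hi // gtn_eqF // (leq_trans (ltn_ord j)) ?leq_addr.
Qed.

Lemma sum_scale_coef (I : finType) (b c : I -> R) u :
  \sum_j b j *: (c j *: u) = (\sum_j b j * c j) *: u.
Proof. by rewrite scaler_suml; apply: eq_bigr => j _; rewrite scalerA. Qed.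

(** Type (3,2,2): the three brackets of the generators span a plane modulo the second
    step, so some decomposable bivector has its bracket in the second step. *)
Section Type322.
Variable nu : bilin R 7.
Hypothesis Fn : filtered nu 3 2.
Let A : alternating nu := filtered_alt Fn.
Let L : is_lie nu := filtered_lie Fn.

(** The basis is completed by the brackets of [v0] with [v1] and [v2]. *)
Lemma type322_frame v0 v1 v2 :
  (forall x y z : R, low 3 (x *: v0 + y *: v1 + z *: v2) -> [/\ x = 0, y = 0 & z = 0]) ->
  low 5 (bracket nu v1 v2) -> minor2 (bracket nu v0 v1) (bracket nu v0 v2) 3 4 != 0 ->
  exists p5 p6 m1 m2 m3 m4 q1 r1 q2 r2 q3 r3,
    isomorphic nu (T322 p5 p6 m1 m2 m3 m4 q1 r1 q2 r2 q3 r3).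
Proof.
move=> fr l12 D0.
set b3 := bracket nu v0 v1 in D0 *; set b4 := bracket nu v0 v2 in D0 *.
have l3 : low 3 b3 := filtered1 Fn _ _; have l4 : low 3 b4 := filtered1 Fn _ _.
have l5 v b : low 3 b -> low 5 (bracket nu v b) by move=> /(filtered2r Fn v).
have c5 : central nu (E 5) by apply: (filtered3 Fn); apply: low_E.
have c6 : central nu (E 6) by apply: (filtered3 Fn); apply: low_E.
have sym : bracket nu v2 b3 = bracket nu v1 b4.
  have := jacobiL v1 v0 v2 L; rewrite -/b4.
  rewrite [bracket nu v0 (bracket nu v1 v2)](alternatingC _ _ A) (filtered3 Fn l12).
  rewrite [bracket nu v1 v0](alternatingC _ _ A) bracketNl -/b3 oppr0 add0r => ->.
  exact: alternatingC A.
do 12![eexists]; apply: isomorphic_sym.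
apply: (@frame_iso _ _ _ [:: v0; v1; v2; b3; b4; E 5; E 6]).
- by apply: alternating_of_table.
- exact: A.
- apply: (T322_frame A c5 c6 erefl erefl (low5E l12)).
  + exact: low5E (l5 v0 _ l3).
  + exact: low5E (l5 v0 _ l4).
  + exact: low5E (l5 v1 _ l3).
  + exact: low5E (l5 v1 _ l4).
  + by rewrite sym; exact: low5E (l5 v1 _ l4).
  + exact: low5E (l5 v2 _ l4).
  + exact: (filtered_abelian Fn).
move=> x; rewrite frame_mx7 => Hx.
have [x0 x1 x2] : [/\ x (o7 0) 0 = 0, x (o7 1) 0 = 0 & x (o7 2) 0 = 0].
  apply: fr => k k3; have := congr1 (fun u : V => u (o7 k) 0) Hx.
  rewrite !entE (l3 k) // (l4 k) // !mulr0 !addr0.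
  by case: k k3 => [|[|[|//]]] _; rewrite !Ecoord // !mulr0 !addr0.
rewrite x0 x1 x2 !zsimp in Hx.
have C k : (k < 7)%N -> _ := fun k7 => congr1 (fun u : V => u (o7 k) 0) Hx.
move: (C 3%N isT) (C 4%N isT) (C 5%N isT) (C 6%N isT).
rewrite !entE !Ecoord // !zsimp => h3 h4.
have [x3 x4] := indep2 D0 h3 h4.
by rewrite x3 x4 !zsimp => x5 x6; coords.
Qed.

Lemma plane_functional (a3 a4 b3 b4 c3 c4 : R) :
  a3 * b4 - a4 * b3 = 0 -> b3 * c4 - b4 * c3 = 0 -> c3 * a4 - c4 * a3 = 0 ->
  exists f g, [/\ f * a3 + g * a4 = 0, f * b3 + g * b4 = 0, f * c3 + g * c4 = 0
    & ~~ ((f == 0) && (g == 0))].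
Proof.
move=> Hab Hbc Hca.
case: (boolP ((a3 == 0) && (a4 == 0))) => [/andP[/eqP -> /eqP ->]|na]; last first.
  exists a4, (- a3); split; last by rewrite oppr_eq0 andbC.
  - ring.
  - by rewrite -[RHS]oppr0 -[in RHS]Hab; ring.
  - by rewrite -[RHS]Hca; ring.
case: (boolP ((b3 == 0) && (b4 == 0))) => [/andP[/eqP -> /eqP ->]|nb]; last first.
  exists b4, (- b3); split; last by rewrite oppr_eq0 andbC.
  - ring.
  - ring.
  - by rewrite -[RHS]oppr0 -[in RHS]Hbc; ring.
case: (boolP ((c3 == 0) && (c4 == 0))) => [/andP[/eqP -> /eqP ->]|nc]; last first.
  exists c4, (- c3); split; last by rewrite oppr_eq0 andbC.
  - ring.
  - ring.
  - ring.
by exists 1, 0; split; rewrite ?oner_eq0 //; ring.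
Qed.

Lemma type322 : onto nu 3 2 -> exists p5 p6 m1 m2 m3 m4 q1 r1 q2 r2 q3 r3,
    isomorphic nu (T322 p5 p6 m1 m2 m3 m4 q1 r1 q2 r2 q3 r3).
Proof.
move=> On.
have go i j k : (forall x y z : R, low 3 (x *: E i + y *: E j + z *: E k) -> [/\ x = 0, y = 0 & z = 0]) ->
    minor2 (bracket nu (E i) (E j)) (bracket nu (E k) (E i)) 3 4 != 0 ->
    exists p5 p6 m1 m2 m3 m4 q1 r1 q2 r2 q3 r3,
    isomorphic nu (T322 p5 p6 m1 m2 m3 m4 q1 r1 q2 r2 q3 r3).
  move=> fr; set bij := bracket nu (E i) (E j); set bki := bracket nu (E k) (E i).
  set bjk := bracket nu (E j) (E k) => D0.
  have [t [s [Hs Ht]]] := solve2 (- bjk (o7 3) 0) (- bjk (o7 4) 0) D0.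
  have bik : bracket nu (E i) (E k) = - bki by apply: alternatingC A.
  have bji : bracket nu (E j) (E i) = - bij by apply: alternatingC A.
  apply: (@type322_frame (E i) (E j - s *: E i) (E k - t *: E i)).
  - move=> x y z Hl; have [|x0 y0 z0] := fr (x - y * s - z * t) y z.
      rewrite (_ : _ + _ = x *: E i + y *: (E j - s *: E i) + z *: (E k - t *: E i)) //.
      by vring.
    by split=> //; move: x0; rewrite y0 z0 !mul0r !subr0.
  - rewrite !(bracketBl, bracketBr, bracketZl, bracketZr) A -/bjk bik bji.
    rewrite (_ : _ - _ = bjk + t *: bij + s *: bki); last by vring.
    have l3 : low 3 (bjk + t *: bij + s *: bki).
      by do 2?[apply: lowD]; rewrite ?scaler0; try apply: lowZ; apply: filtered1 Fn _ _.
    by move=> [|[|[|[|[|//]]]]] _; [exact: l3 | exact: l3 | exact: l3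
      | rewrite 2!entD !entZ -addrA Hs subrr | rewrite 2!entD !entZ -addrA Ht subrr].
  rewrite !(bracketBr, bracketZr) A !scaler0 !subr0 bik -/bij /minor2 !entE.
  apply: contra D0 => /eqP H; rewrite -oppr_eq0; apply/eqP; rewrite -[RHS]H /minor2; ring.
have fr3 x y z : low 3 (x *: E 0 + y *: E 1 + z *: E 2) -> [/\ x = 0, y = 0 & z = 0].
  move=> H; move: (H 0%N isT) (H 1%N isT) (H 2%N isT).
  by rewrite !entE !Ecoord // !zsimp => -> -> ->.
have fr3' x y z : low 3 (x *: E 1 + y *: E 2 + z *: E 0) -> [/\ x = 0, y = 0 & z = 0].
  move=> H; move: (H 0%N isT) (H 1%N isT) (H 2%N isT).
  by rewrite !entE !Ecoord // !zsimp => -> -> ->.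
have fr3'' x y z : low 3 (x *: E 2 + y *: E 0 + z *: E 1) -> [/\ x = 0, y = 0 & z = 0].
  move=> H; move: (H 0%N isT) (H 1%N isT) (H 2%N isT).
  by rewrite !entE !Ecoord // !zsimp => -> -> ->.
have [z1|] := eqVneq (minor2 (bracket nu (E 0) (E 1)) (bracket nu (E 2) (E 0)) 3 4) 0; last exact: go.
have [z2|] := eqVneq (minor2 (bracket nu (E 1) (E 2)) (bracket nu (E 0) (E 1)) 3 4) 0; last exact: go.
have [z3|] := eqVneq (minor2 (bracket nu (E 2) (E 0)) (bracket nu (E 1) (E 2)) 3 4) 0; last exact: go.
have [f [g [H01 H20 H12 /negP[]]]] := plane_functional z1 z3 z2.
pose phi : 'rV[R]_7 := (vec7 [:: 0; 0; 0; f; g; 0; 0])^T.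
have K : forall u, low 3 u -> phi *m u = 0.
  apply: (onto_basis1 Fn On) => [i j /andP[]|u lu]; last first.
    by apply/functional7; rewrite /= (lu 3%N) // (lu 4%N) // !zsimp.
  do 3?[case: i => [|i]] => //; do 3?[case: j => [|j]] => // _ _; apply/functional7;
    rewrite /= !zsimp //.
  by rewrite (alternatingC _ _ A) !entE !mulrN -opprD H20 oppr0.
have H := functional_low K.
by have /= -> := H 3%N isT; have /= -> := H 4%N isT; rewrite eqxx.
Qed.

End Type322.

End Reduction.

Section Reduction.
Variable R : realType.
Local Notation V := 'cV[R]_7.
Local Notation E i := (evec R (o7 i)).
Implicit Types (mu nu : bilin R 7) (eps : R) (u v w : V).

Lemma mul_matrix_col m n (f : nat -> nat -> R) (c : 'cV[R]_n.+1) (i : 'I_m) :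
  ((\matrix_(i < m, k < n.+1) f i k) *m c) i 0 = \sum_(k < n.+1) f i k * c (inord k) 0.
Proof. by rewrite mxE; apply: eq_bigr => k _; rewrite mxE inord_val. Qed.

Lemma mul_row_matrix m n (f : nat -> nat -> R) (w : nat -> R) (k : 'I_n) :
  ((\row_(i < m) w i) *m (\matrix_(i < m, k < n) f i k)) 0 k = \sum_(i < m) w i * f i k.
Proof. by rewrite mxE; apply: eq_bigr => i _; rewrite !mxE. Qed.

Lemma colP_inord n (c : 'cV[R]_n.+1) : (forall k, (k < n.+1)%N -> c (inord k) 0 = 0) -> c = 0.
Proof. by move=> H; apply/colP => k; rewrite mxE -(inord_val k) H. Qed.

Lemma rowE_nat n (w : nat -> R) : \row_(i < n) w i = 0 -> forall i, (i < n)%N -> w i = 0.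
Proof. by move=> H i ni; have := congr1 (fun u : 'rV[R]_n => u 0 (Ordinal ni)) H; rewrite !mxE. Qed.

Lemma basis_entry_fun m k (f : nat -> nat -> R) (B : 'M[R]_(m + k)) :
  B *m (\matrix_(i < m + k, j < m) f i j) = col_mx 1%:M 0 ->
  forall i j, (j < m)%N -> \sum_l B i l * f l j = (val i == j)%:R.
Proof.
move=> H i j jm; rewrite -(basis_entry H i (Ordinal jm)).
by apply: eq_bigr => l _; rewrite mxE.
Qed.

Lemma filtered_E nu p q : filtered nu p q -> forall k, (p + q <= k < 7)%N -> central nu (E k).
Proof. by move=> Fn k Hk; apply/(filtered3 Fn)/low_E. Qed.

(** Type (3,1,3): the Jacobi identity on the three generators kills the bracket. *)
Lemma no_type313 nu : filtered nu 3 1 -> ~ onto nu 3 1.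
Proof.
move=> Fn On; have A := filtered_alt Fn; have [_ J] := filtered_lie Fn.
pose f (i k : nat) : R := (bracket nu (E i) (E 3)) (o7 (4 + k)) 0.
pose M : 'M[R]_3 := \matrix_(i < 3, k < 3) f i k.
have Mu : M \in unitmx.
  apply: colfree_unit => c Mc0; pose c' (k : nat) : R := c (inord k) 0.
  have K : forall u, low 4 u -> (vec7 [:: 0; 0; 0; 0; c' 0%N; c' 1%N; c' 2%N])^T *m u = 0 :> 'M[R]_1.
    apply: (onto_basis2 Fn On) => i j i3 /andP[j3 j4].
    have -> : j = 3%N by apply/eqP; rewrite eqn_leq j3 -ltnS j4.
    apply/functional7; have := congr1 (fun u : 'cV[R]_3 => u (Ordinal i3) 0) Mc0.
    rewrite mul_matrix_col [RHS]mxE !big_ord_recr big_ord0 /= !zsimp => H0.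
    by rewrite -[RHS]H0 /f /c' /=; ring.
  have H := functional_low K.
  by apply: colP_inord => -[|[|[|//]]] _; [have := H 4%N isT | have := H 5%N isT | have := H 6%N isT].
pose b (i j : nat) : R := (bracket nu (E i) (E j)) (o7 3) 0.
pose w (k : nat) : R := nth 0 [:: b 1%N 2%N; b 2%N 0%N; b 0%N 1%N] k.
have bb i j k : bracket nu (bracket nu (E i) (E j)) (E k) = - b i j *: bracket nu (E k) (E 3).
  rewrite {1}[bracket nu (E i) (E j)](low3E (filtered1 Fn _ _)) !bracketDl !bracketZl.
  rewrite (filtered_E Fn (k := 4%N) isT) (filtered_E Fn (k := 5%N) isT) (filtered_E Fn (k := 6%N) isT).
  by rewrite !scaler0 !addr0 [bracket nu (E 3) _](alternatingC _ _ A) scalerN scaleNr.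
have w0 : \row_(i < 3) w i = 0.
  apply: (can_inj (mulmxK Mu)); rewrite mul0mx; apply/rowP => k.
  rewrite mul_row_matrix [RHS]mxE !big_ord_recr big_ord0 /= add0r.
  have := congr1 (fun u : V => u (o7 (4 + k)) 0) (J (E 0) (E 1) (E 2)).
  rewrite /jacobiator !bb !entE -/(f _ _) => /eqP; rewrite -oppr_eq0 => /eqP <-.
  rewrite /f /w /=; ring.
have wE := rowE_nat w0.
have K : forall u, low 3 u -> (vec7 [:: 0; 0; 0; 1; 0; 0; 0])^T *m u = 0 :> 'M[R]_1.
  apply: (onto_basis1 Fn On) => [i j /andP[]|u lu]; last first.
    by apply/functional7; rewrite /= (lu 3%N) // !zsimp.
  do 3?[case: i => [|i]] => //; do 3?[case: j => [|j]] => // _ _; apply/functional7;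
    rewrite /= !zsimp //.
  + exact: (wE 2%N).
  + by rewrite (alternatingC _ _ A) entN; apply/eqP; rewrite oppr_eq0; apply/eqP/(wE 1%N).
  + exact: (wE 0%N).
by have /eqP := functional_low K (k := 3%N) isT; rewrite oner_eq0.
Qed.

Lemma sum3_solve (x y : R) (X Y Z W : V) : Y = x *: W -> Z = y *: W ->
  - X - Y - Z = 0 -> X = - (x + y) *: W.
Proof.
move=> -> -> /eqP; rewrite -addrA addrC subr_eq0 => /eqP <-.
by rewrite scaleNr scalerDl opprD.
Qed.

Lemma T331_frame mu (b0 b1 b2 b3 b4 b5 b6 : V) (a b c d e f g h : R) :
  alternating mu -> central mu b6 ->
  bracket mu b1 b2 = b3 -> bracket mu b0 b2 = - b4 -> bracket mu b0 b1 = b5 ->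
  bracket mu b0 b3 = a *: b6 -> bracket mu b0 b4 = b *: b6 -> bracket mu b0 b5 = c *: b6 ->
  bracket mu b1 b3 = d *: b6 -> bracket mu b1 b4 = e *: b6 -> bracket mu b1 b5 = f *: b6 ->
  bracket mu b2 b3 = g *: b6 -> bracket mu b2 b4 = h *: b6 ->
  bracket mu b2 b5 = - (a + e) *: b6 ->
  bracket mu b3 b4 = 0 -> bracket mu b3 b5 = 0 -> bracket mu b4 b5 = 0 ->
  frame_hom (T331 a b c d e f g h) mu [:: b0; b1; b2; b3; b4; b5; b6].
Proof.
by move=> A c6 H12 H02 H01 H03 H04 H05 H13 H14 H15 H23 H24 H25 H34 H35 H45; hom_tac T331E.
Qed.

(** Type (3,3,1): the brackets of the generators form a basis of the middle step, and
    the Jacobi identity on the generators is the vanishing of the trace. *)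
Lemma type331 nu : filtered nu 3 3 -> onto nu 3 3 ->
  exists a b c d e f g h, isomorphic nu (T331 a b c d e f g h).
Proof.
move=> Fn On; have A := filtered_alt Fn; have [_ J] := filtered_lie Fn.
set b3 := bracket nu (E 1) (E 2); set b4 := bracket nu (E 2) (E 0).
set b5 := bracket nu (E 0) (E 1).
have l3 : low 3 b3 := filtered1 Fn _ _. have l4 : low 3 b4 := filtered1 Fn _ _.
have l5 : low 3 b5 := filtered1 Fn _ _.
pose f (i k : nat) : R := (nth 0 [:: b3; b4; b5] i) (o7 (3 + k)) 0.
pose M : 'M[R]_3 := \matrix_(i < 3, k < 3) f i k.
have Mu : M \in unitmx.
  apply: colfree_unit => c Mc0; pose c' (k : nat) : R := c (inord k) 0.
  have row i : (i < 3)%N -> f i 0%N * c' 0%N + f i 1%N * c' 1%N + f i 2%N * c' 2%N = 0.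
    move=> i3; have := congr1 (fun u : 'cV[R]_3 => u (Ordinal i3) 0) Mc0.
    by rewrite mul_matrix_col [RHS]mxE !big_ord_recr big_ord0 /= add0r.
  have K : forall u, low 3 u -> (vec7 [:: 0; 0; 0; c' 0%N; c' 1%N; c' 2%N; 0])^T *m u = 0 :> 'M[R]_1.
    apply: (onto_basis1 Fn On) => [i j /andP[]|u lu]; last first.
      by apply/functional7; rewrite /= (lu 3%N) // (lu 4%N) // (lu 5%N) // !zsimp.
    do 3?[case: i => [|i]] => //; do 3?[case: j => [|j]] => // _ _; apply/functional7;
      rewrite /= !zsimp.
    + by rewrite -[RHS](row 2%N) // /f /=; ring.
    + by rewrite (alternatingC _ _ A) !entN -[RHS]oppr0 -[in RHS](row 1%N) // /f /=; ring.
    + by rewrite -[RHS](row 0%N) // /f /=; ring.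
  have H := functional_low K.
  by apply: colP_inord => -[|[|[|//]]] _; [have := H 3%N isT | have := H 4%N isT | have := H 5%N isT].
have e6 v b : low 3 b -> bracket nu v b = (bracket nu v b) (o7 6) 0 *: E 6.
  by move=> lb; apply: low6E; apply: (filtered2r Fn).
have tr : bracket nu (E 2) b5 = - ((bracket nu (E 0) b3) (o7 6) 0 + (bracket nu (E 1) b4) (o7 6) 0) *: E 6.
  apply: (sum3_solve (e6 (E 0) b3 l3) (e6 (E 1) b4 l4)); rewrite -[RHS](J (E 0) (E 1) (E 2)).
  rewrite /jacobiator (alternatingC (bracket nu (E 0) (E 1)) (E 2) A).
  rewrite (alternatingC (bracket nu (E 1) (E 2)) (E 0) A).
  by rewrite (alternatingC (bracket nu (E 2) (E 0)) (E 1) A).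
do 8![eexists]; apply: isomorphic_sym.
apply: (@frame_iso _ _ _ [:: E 0; E 1; E 2; b3; b4; b5; E 6]).
- by apply: alternating_of_table.
- exact: A.
- apply: (T331_frame A (filtered_E Fn (k := 6%N) isT) erefl (alternatingC _ _ A) erefl
    (e6 _ _ l3) (e6 _ _ l4) (e6 _ _ l5) (e6 _ _ l3) (e6 _ _ l4) (e6 _ _ l5)
    (e6 _ _ l3) (e6 _ _ l4) tr); exact: (filtered_abelian Fn).
move=> x /frame_mx7_eq0 Hx; have C k : (k < 7)%N -> _ := fun=> Hx (o7 k).
have [x0 x1 x2] : [/\ x (o7 0) 0 = 0, x (o7 1) 0 = 0 & x (o7 2) 0 = 0].
  move: (C 0%N isT) (C 1%N isT) (C 2%N isT).
  rewrite (l3 0%N) // (l3 1%N) // (l3 2%N) // (l4 0%N) // (l4 1%N) // (l4 2%N) //.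
  rewrite (l5 0%N) // (l5 1%N) // (l5 2%N) // !Ecoord // !zsimp.
  by move=> -> -> ->.
pose w (k : nat) : R := x (o7 (3 + k)) 0.
have w0 : \row_(i < 3) w i = 0.
  apply: (can_inj (mulmxK Mu)); rewrite mul0mx; apply/rowP => k.
  rewrite mul_row_matrix [RHS]mxE !big_ord_recr big_ord0 /= add0r.
  have k7 : (3 + k < 7)%N by rewrite (@leq_trans (3 + 3)) ?ltn_add2l.
  have k6 : (6 == 3 + k :> nat)%N = false by rewrite gtn_eqF // (@leq_trans (3 + 3)) ?ltn_add2l.
  by have := C _ k7; rewrite x0 x1 x2 [E 6 _ _]Ecoord // k6 !zsimp.
have wE := rowE_nat w0.
have x3 : x (o7 3) 0 = 0 by exact: (wE 0%N).
have x4 : x (o7 4) 0 = 0 by exact: (wE 1%N).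
have x5 : x (o7 5) 0 = 0 by exact: (wE 2%N).
move: (C 6%N isT); rewrite x0 x1 x2 x3 x4 x5 [E 6 _ _]Ecoord // !zsimp => x6.
by coords.
Qed.

Lemma T412_frame mu (b0 b1 b2 b3 b4 b5 b6 : V) (a0 a1 c0 c1 d0 d1 e0 e1 f0 f1 : R) :
  alternating mu -> central mu b5 -> central mu b6 ->
  bracket mu b0 b1 = b4 -> bracket mu b0 b2 = a0 *: b5 + a1 *: b6 ->
  bracket mu b0 b3 = c0 *: b5 + c1 *: b6 -> bracket mu b1 b2 = d0 *: b5 + d1 *: b6 ->
  bracket mu b1 b3 = e0 *: b5 + e1 *: b6 -> bracket mu b2 b3 = f0 *: b5 + f1 *: b6 ->
  bracket mu b0 b4 = b5 -> bracket mu b1 b4 = b6 -> bracket mu b2 b4 = 0 ->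
  bracket mu b3 b4 = 0 ->
  frame_hom (T412 a0 a1 c0 c1 d0 d1 e0 e1 f0 f1 0) mu [:: b0; b1; b2; b3; b4; b5; b6].
Proof.
by move=> A c5 c6 H01 H02 H03 H12 H13 H23 H04 H14 H24 H34; hom_tac T412E.
Qed.

(** Type (4,1,2): in a basis dual to the action on the one-dimensional middle step, the
    Jacobi identity leaves one bracket modulo the second step. *)
Lemma type412 nu : filtered nu 4 1 -> onto nu 4 1 ->
  exists a0 a1 c0 c1 d0 d1 e0 e1 f0 f1,
    isomorphic nu (T412 a0 a1 c0 c1 d0 d1 e0 e1 f0 f1 0).
Proof.
move=> Fn0 On0.
pose f (i k : nat) : R := (bracket nu (E i) (E 4)) (o7 (5 + k)) 0.
pose G : 'M[R]_(2 + 2, 2) := \matrix_(i < 4, k < 2) f i k.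
have rG : \rank G = 2%N.
  apply: colfree_rank => c Gc0; pose c' (k : nat) : R := c (inord k) 0.
  have K : forall u, low 5 u -> (vec7 [:: 0; 0; 0; 0; 0; c' 0%N; c' 1%N])^T *m u = 0 :> 'M[R]_1.
    apply: (onto_basis2 Fn0 On0) => i j i4 /andP[j4 j5].
    have -> : j = 4%N by apply/eqP; rewrite eqn_leq j4 -ltnS j5.
    apply/functional7; have := congr1 (fun u : 'cV[R]_4 => u (Ordinal i4) 0) Gc0.
    rewrite mul_matrix_col [RHS]mxE !big_ord_recr big_ord0 /= !zsimp => H0.
    by rewrite -[RHS]H0 /f /c' /=; ring.
  have H := functional_low K.
  by apply: colP_inord => -[|[|//]] _; [have := H 5%N isT | have := H 6%N isT].
have [B [Bu BG]] := dual_basis rG.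
have [mu [I Fm Om H4 _]] := @change_basis R 4 B isT Bu nu 1%N Fn0.
have {}Om := Om On0.
have act (k : 'I_4) : bracket mu (E k) (E 4) = (val k == 0%N)%:R *: E 5 + (val k == 1%N)%:R *: E 6.
  rewrite H4 // (eq_bigr (fun j : 'I_4 => B k j *: (f j 0%N *: E 5) + B k j *: (f j 1%N *: E 6))); last first.
    by move=> j _; rewrite -scalerDr; congr (_ *: _); apply: low5E; apply/(filtered2r Fn0)/low_E.
  rewrite big_split /= !sum_scale_coef.
  by rewrite (basis_entry_fun BG k (j := 0%N)) // (basis_entry_fun BG k (j := 1%N)).
have a0 : bracket mu (E 0) (E 4) = E 5 by rewrite (act (Ordinal (isT : 0 < 4)%N)) /= !zsimp.
have a1 : bracket mu (E 1) (E 4) = E 6 by rewrite (act (Ordinal (isT : 1 < 4)%N)) /= !zsimp.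
have a2 : bracket mu (E 2) (E 4) = 0 by rewrite (act (Ordinal (isT : 2 < 4)%N)) /= !zsimp.
have a3 : bracket mu (E 3) (E 4) = 0 by rewrite (act (Ordinal (isT : 3 < 4)%N)) /= !zsimp.
have A := filtered_alt Fm; have [_ J] := filtered_lie Fm.
pose b (i j : nat) : R := (bracket mu (E i) (E j)) (o7 4) 0.
have c5 : central mu (E 5) := filtered_E Fm (k := 5%N) isT.
have c6 : central mu (E 6) := filtered_E Fm (k := 6%N) isT.
have bb i j k : bracket mu (bracket mu (E i) (E j)) (E k) = - b i j *: bracket mu (E k) (E 4).
  rewrite {1}[bracket mu (E i) (E j)](low4E (filtered1 Fm _ _)) !bracketDl !bracketZl c5 c6.
  by rewrite !scaler0 !addr0 (alternatingC (E 4) (E k) A) scalerN scaleNr.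
have bC i j : b i j = - b j i by rewrite /b (alternatingC _ _ A) entN.
have jac i j k l : - b i j * (bracket mu (E k) (E 4)) (o7 l) 0 - b j k * (bracket mu (E i) (E 4)) (o7 l) 0
    - b k i * (bracket mu (E j) (E 4)) (o7 l) 0 = 0.
  have := congr1 (fun u : V => u (o7 l) 0) (J (E i) (E j) (E k)).
  by rewrite /jacobiator !bb !entE !mulNr.
have b12 : b 1%N 2%N = 0.
  by have := jac 0%N 1%N 2%N 5%N; rewrite a0 a1 a2 !entE !Ecoord //= !zsimp => /eqP; rewrite oppr_eq0 => /eqP.
have b02 : b 0%N 2%N = 0.
  by have := jac 0%N 1%N 2%N 6%N; rewrite a0 a1 a2 !entE !Ecoord //= !zsimp bC opprK.
have b13 : b 1%N 3%N = 0.
  by have := jac 0%N 1%N 3%N 5%N; rewrite a0 a1 a3 !entE !Ecoord //= !zsimp => /eqP; rewrite oppr_eq0 => /eqP.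
have b03 : b 0%N 3%N = 0.
  by have := jac 0%N 1%N 3%N 6%N; rewrite a0 a1 a3 !entE !Ecoord //= !zsimp bC opprK.
have b23 : b 2%N 3%N = 0.
  by have := jac 0%N 2%N 3%N 5%N; rewrite a0 a2 a3 !entE !Ecoord //= !zsimp => /eqP; rewrite oppr_eq0 => /eqP.
have b01 : b 0%N 1%N != 0.
  apply/eqP => b01.
  have K : forall u, low 4 u -> (vec7 [:: 0; 0; 0; 0; 1; 0; 0])^T *m u = 0 :> 'M[R]_1.
    apply: (onto_basis1 Fm Om) => [i j /andP[]|u lu]; last first.
      by apply/functional7; rewrite /= (lu 4%N) // !zsimp.
    do 4?[case: i => [|i]] => //; do 4?[case: j => [|j]] => // _ _; apply/functional7;
      by rewrite /= !zsimp.
  by have /eqP := functional_low K (k := 4%N) isT; rewrite oner_eq0.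
set c := b 0%N 1%N in b01.
have e5 i j : b i j = 0 -> bracket mu (E i) (E j) =
   ((bracket mu (E i) (E j)) (o7 5) 0 / c) *: (c *: E 5) + ((bracket mu (E i) (E j)) (o7 6) 0 / c) *: (c *: E 6).
  move=> bij; rewrite !scalerA !divfK //; apply: low5E => k.
  by rewrite ltnS leq_eqVlt => /orP[/eqP ->|k4]; [exact: bij | exact: (filtered1 Fm)].
have b4E v : bracket mu v (bracket mu (E 0) (E 1)) = c *: bracket mu v (E 4).
  rewrite {1}[bracket mu (E 0) (E 1)](low4E (filtered1 Fm _ _)) !bracketDr !bracketZr.
  by rewrite [bracket mu v (E 5)](central_r _ A c5) [bracket mu v (E 6)](central_r _ A c6) !scaler0 !addr0.
do 10![eexists]; apply: isomorphic_trans I _; apply: isomorphic_sym.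
apply: (@frame_iso _ _ _ [:: E 0; E 1; E 2; E 3; bracket mu (E 0) (E 1); c *: E 5; c *: E 6]).
- by apply: alternating_of_table.
- exact: A.
- apply: (T412_frame A _ _ erefl (e5 _ _ b02) (e5 _ _ b03) (e5 _ _ b12) (e5 _ _ b13) (e5 _ _ b23)).
  + by move=> y; rewrite bracketZl c5 scaler0.
  + by move=> y; rewrite bracketZl c6 scaler0.
  + by rewrite b4E a0.
  + by rewrite b4E a1.
  + by rewrite b4E a2 scaler0.
  + by rewrite b4E a3 scaler0.
move=> x /frame_mx7_eq0 Hx; have C k : (k < 7)%N -> _ := fun=> Hx (o7 k).
have l := filtered1 Fm (E 0) (E 1).
move: (C 0%N isT) (C 1%N isT) (C 2%N isT) (C 3%N isT).
rewrite (l 0%N) // (l 1%N) // (l 2%N) // (l 3%N) // !entZ !Ecoord //= !zsimp => x0 x1 x2 x3.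
move: (C 4%N isT); rewrite -/c !entZ !Ecoord //= x0 x1 x2 x3 !zsimp => /eqP.
rewrite mulf_eq0 (negbTE b01) orbF => /eqP x4.
move: (C 5%N isT) (C 6%N isT); rewrite !entZ !Ecoord //= x0 x1 x2 x3 x4 !zsimp.
move=> /eqP; rewrite mulf_eq0 (negbTE b01) orbF => /eqP x5.
move=> /eqP; rewrite mulf_eq0 (negbTE b01) orbF => /eqP x6.
by coords.
Qed.

End Reduction.

Section Reduction.
Variable R : realType.
Local Notation V := 'cV[R]_7.
Local Notation E i := (evec R (o7 i)).
Implicit Types (mu nu : bilin R 7) (eps : R) (u v w : V).

Lemma T511_frame mu (b0 b1 b2 b3 b4 b5 b6 : V) (a1 a2 a3 w1 w2 w3 : R) :
  alternating mu -> central mu b6 ->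
  bracket mu b0 b1 = b4 -> bracket mu b0 b2 = 0 -> bracket mu b0 b3 = 0 ->
  bracket mu b0 b5 = 0 -> bracket mu b0 b4 = b6 ->
  bracket mu b1 b2 = a1 *: b6 -> bracket mu b1 b3 = a2 *: b6 -> bracket mu b1 b5 = a3 *: b6 ->
  bracket mu b2 b3 = w3 *: b6 -> bracket mu b2 b5 = w2 *: b6 -> bracket mu b3 b5 = w1 *: b6 ->
  bracket mu b1 b4 = 0 -> bracket mu b2 b4 = 0 -> bracket mu b3 b4 = 0 -> bracket mu b4 b5 = 0 ->
  frame_hom (T511 a1 a2 a3 w1 w2 w3) mu [:: b0; b1; b2; b3; b4; b5; b6].
Proof.
by move=> A c6 H01 H02 H03 H05 H04 H12 H13 H15 H23 H25 H35 H14 H24 H34 H45; hom_tac T511E.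
Qed.

Lemma sum_skew (n : nat) (b c u v : 'I_n -> R) :
  \sum_i \sum_j (b i * c j) * (u i * v j - u j * v i) =
  (\sum_i b i * u i) * (\sum_j c j * v j) - (\sum_i b i * v i) * (\sum_j c j * u j).
Proof.
rewrite !big_distrlr -sumrB; apply: eq_bigr => i _; rewrite -sumrB.
by apply: eq_bigr => j _ /=; ring.
Qed.

Lemma frame511_inj (z1 z2 z3 z4 : R) (x : V) : frame_mx [:: E 0; E 1; E 2 - z2 *: E 5;
  E 3 - z3 *: E 5; E 5 + z1 *: E 6; E 4 - z4 *: E 5; E 6] *m x = 0 -> x = 0.
Proof.
move=> /frame_mx7_eq0 Hx; have C k : (k < 7)%N -> _ := fun=> Hx (o7 k).
move: (C 0%N isT) (C 1%N isT) (C 2%N isT) (C 3%N isT) (C 4%N isT).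
rewrite !entE !Ecoord //= !zsimp => x0 x1 x2 x3 x5.
move: (C 5%N isT); rewrite !entE !Ecoord //= x0 x1 x2 x3 x5 !zsimp => x4.
move: (C 6%N isT); rewrite !entE !Ecoord //= x0 x1 x2 x3 x5 x4 !zsimp => x6.
by coords.
Qed.

(** Type (5,1,1): the bracket modulo the centre is a product of two covectors, one of
    them being the action on the middle step. *)
Lemma type511 nu : filtered nu 5 1 -> onto nu 5 1 ->
  exists a1 a2 a3 w1 w2 w3 : R, isomorphic nu (T511 a1 a2 a3 w1 w2 w3).
Proof.
move=> F0 O0.
pose f (i k : nat) : R := (bracket nu (E i) (E 5)) (o7 (6 + k)) 0.
pose G : 'M[R]_(1 + 4, 1) := \matrix_(i < 5, k < 1) f i k.
have rG : \rank G = 1%N.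
  apply: colfree_rank => c Gc0; pose c' (k : nat) : R := c (inord k) 0.
  have K : forall u, low 6 u -> (vec7 [:: 0; 0; 0; 0; 0; 0; c' 0%N])^T *m u = 0 :> 'M[R]_1.
    apply: (onto_basis2 F0 O0) => i j i5 /andP[j5 j6].
    have -> : j = 5%N by apply/eqP; rewrite eqn_leq j5 -ltnS j6.
    apply/functional7; have := congr1 (fun u : 'cV[R]_5 => u (Ordinal i5) 0) Gc0.
    rewrite mul_matrix_col [RHS]mxE !big_ord_recr big_ord0 /= !zsimp => H0.
    by rewrite -[RHS]H0 /f /c' /=; ring.
  have H := functional_low K.
  by apply: colP_inord => -[|//] _; have := H 6%N isT.
have [B [Bu BG]] := dual_basis rG.
have [mu [I Fm Om H5 _]] := @change_basis R 5 B isT Bu nu 1%N F0.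
have {}Om := Om O0.
have act (k : 'I_5) : bracket mu (E k) (E 5) = (val k == 0%N)%:R *: E 6.
  rewrite H5 // (eq_bigr (fun j : 'I_5 => B k j *: (f j 0%N *: E 6))); last first.
    by move=> j _; congr (_ *: _); apply: low6E; apply/(filtered2r F0)/low_E.
  by rewrite sum_scale_coef (basis_entry_fun BG k (j := 0%N)).
have A := filtered_alt Fm; have [_ J] := filtered_lie Fm.
pose b (i j : nat) : R := (bracket mu (E i) (E j)) (o7 5) 0.
have c6 : central mu (E 6) := filtered_E Fm (k := 6%N) isT.
have bb i j (k : 'I_5) : bracket mu (bracket mu (E i) (E j)) (E k) = - (b i j * (val k == 0%N)%:R) *: E 6.
  rewrite {1}[bracket mu (E i) (E j)](low5E (filtered1 Fm _ _)) !bracketDl !bracketZl c6.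
  by rewrite scaler0 addr0 (alternatingC (E 5) (E k) A) act scalerN scalerA scaleNr.
have bC i j : b i j = - b j i by rewrite /b (alternatingC _ _ A) entN.
have bij (i j : 'I_5) : (0 < i)%N -> (0 < j)%N -> b i j = 0.
  move=> i0 j0; have := congr1 (fun u : V => u (o7 6) 0) (J (E (@ord0 4)) (E i) (E j)).
  rewrite /jacobiator !bb /= (gtn_eqF i0) (gtn_eqF j0) !entE Ecoord //= !zsimp.
  by move/eqP; rewrite oppr_eq0 => /eqP.
have b00 : b 0%N 0%N = 0 by rewrite /b A mxE.
pose f2 (i k : nat) : R := nth 0 [:: (i == 0%N)%:R; b 0%N i] k.
pose G2 : 'M[R]_(2 + 3, 2) := \matrix_(i < 5, k < 2) f2 i k.
have rG2 : \rank G2 = 2%N.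
  apply: colfree_rank => c Gc0; pose c' (k : nat) : R := c (inord k) 0.
  have row i : (i < 5)%N -> (i == 0%N)%:R * c' 0%N + b 0%N i * c' 1%N = 0.
    move=> i5; have := congr1 (fun u : 'cV[R]_5 => u (Ordinal i5) 0) Gc0.
    by rewrite mul_matrix_col [RHS]mxE !big_ord_recr big_ord0 /= !zsimp.
  have c0 : c' 0%N = 0 by have := row 0%N isT; rewrite b00 !zsimp.
  suff c1 : c' 1%N = 0 by apply: colP_inord => -[|[|//]] _.
  apply/eqP/negPn/negP => c1.
  have b0 i : (i < 5)%N -> b 0%N i = 0.
    by move=> /row/eqP; rewrite c0 mulr0 add0r mulf_eq0 (negbTE c1) orbF => /eqP.
  have K : forall u, low 5 u -> (vec7 [:: 0; 0; 0; 0; 0; 1; 0])^T *m u = 0 :> 'M[R]_1.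
    apply: (onto_basis1 Fm Om) => [i j /andP[ij j5]|u lu]; last first.
      by apply/functional7; rewrite /= (lu 5%N) // !zsimp.
    apply/functional7; rewrite /= !zsimp -/(b i j); have i5 := ltn_trans ij j5.
    case: (posnP i) => [->|i0]; first exact: b0.
    exact: (bij (Ordinal i5) (Ordinal j5) i0 (ltn_trans i0 ij)).
  by have /eqP := functional_low K (k := 5%N) isT; rewrite oner_eq0.
have bE (i j : 'I_5) : b i j = f2 i 0%N * f2 j 1%N - f2 j 0%N * f2 i 1%N.
  rewrite /f2 /=; case: (posnP i) => [i0|i0]; case: (posnP j) => [j0|j0].
  - by rewrite i0 j0 b00 /=; ring.
  - by rewrite i0 b00 /=; ring.
  - by rewrite j0 b00 bC /=; ring.
  - by rewrite bij //=; ring.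
have [B2 [Bu2 BG2]] := dual_basis rG2.
have [la [I2 Fl _ H52 Hl]] := @change_basis R 5 B2 isT Bu2 mu 1%N Fm.
have act2 (k : 'I_5) : bracket la (E k) (E 5) = (val k == 0%N)%:R *: E 6.
  rewrite H52 // (eq_bigr (fun j : 'I_5 => B2 k j *: (f2 j 0%N *: E 6))); last first.
    by move=> j _; congr (_ *: _); rewrite act.
  by rewrite sum_scale_coef (basis_entry_fun BG2 k (j := 0%N)).
have b2 (k l : 'I_5) : (bracket la (E k) (E l)) (o7 5) 0 =
    (val k == 0%N)%:R * (val l == 1%N)%:R - (val k == 1%N)%:R * (val l == 0%N)%:R.
  rewrite Hl summxE (eq_bigr (fun i => \sum_j (B2 k i * B2 l j) * (f2 i 0%N * f2 j 1%N - f2 j 0%N * f2 i 1%N))); last first.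
    by move=> i _; rewrite summxE; apply: eq_bigr => j _; rewrite entZ -/(b _ _) bE.
  by rewrite sum_skew !(basis_entry_fun BG2).
have Al := filtered_alt Fl.
have o5 k (k5 : (k < 5)%N) : bracket la (E k) (E 5) = (k == 0%N)%:R *: E 6.
  exact: (act2 (Ordinal k5)).
have z6 : central la (E 6) := filtered_E Fl (k := 6%N) isT.
have low6 i j : (0 < i < 5)%N -> (i < j < 5)%N -> bracket la (E i) (E j) = (bracket la (E i) (E j)) (o7 6) 0 *: E 6.
  move=> /andP[i0 i5] /andP[ij j5]; apply: low6E => k.
  rewrite ltnS leq_eqVlt => /orP[/eqP ->|k5]; last exact: (filtered1 Fl).
  rewrite (b2 (Ordinal i5) (Ordinal j5)) /= (gtn_eqF i0) (gtn_eqF (ltn_trans i0 ij)).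
  by rewrite mul0r mulr0 subr0.
have low60 j : (1 < j < 5)%N -> bracket la (E 0) (E j) = (bracket la (E 0) (E j)) (o7 6) 0 *: E 6.
  move=> /andP[j1 j5]; apply: low6E => k.
  rewrite ltnS leq_eqVlt => /orP[/eqP ->|k5]; last exact: (filtered1 Fl).
  rewrite (b2 (@ord0 4) (Ordinal j5)) /= (gtn_eqF j1) (gtn_eqF (ltn_trans _ j1)) //.
  by rewrite !mulr0 subr0.
pose z j : R := (bracket la (E 0) (E j)) (o7 6) 0.
have b4E : bracket la (E 0) (E 1) = E 5 + z 1%N *: E 6.
  rewrite [LHS](low5E (filtered1 Fl _ _)).
  by rewrite (b2 (Ordinal (isT : 0 < 5)%N) (Ordinal (isT : 1 < 5)%N)) /= !zsimp.
have z6r v : bracket la v (E 6) = 0 by apply: central_r.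
have o55 : bracket la (E 5) (E 5) = 0 by apply: Al.
have o5l k : (k < 5)%N -> bracket la (E 5) (E k) = - ((k == 0%N)%:R *: E 6).
  by move=> k5; rewrite (alternatingC _ _ Al) o5.
have o50 k : (0 < k < 5)%N -> bracket la (E k) (E 5) = 0.
  by move=> /andP[k0 k5]; rewrite o5 // (gtn_eqF k0) scale0r.
have o5l0 k : (0 < k < 5)%N -> bracket la (E 5) (E k) = 0.
  by move=> Hk; rewrite (alternatingC _ _ Al) o50 ?oppr0.
have red i j s t : (0 < i < 5)%N -> (0 < j < 5)%N ->
    bracket la (E i - s *: E 5) (E j - t *: E 5) = bracket la (E i) (E j).
  by move=> Hi Hj; rewrite bracketBl !bracketBr !bracketZl !bracketZr o50 // o5l0 // o55 !scaler0 !subr0.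
have red1 i j t : (0 < i < 5)%N -> bracket la (E i) (E j - t *: E 5) = bracket la (E i) (E j).
  by move=> Hi; rewrite bracketBr bracketZr o50 // scaler0 subr0.
do 6![eexists]; apply: isomorphic_trans (isomorphic_trans I I2) _; apply: isomorphic_sym.
apply: (@frame_iso _ _ _ [:: E 0; E 1; E 2 - z 2%N *: E 5; E 3 - z 3%N *: E 5;
  bracket la (E 0) (E 1); E 4 - z 4%N *: E 5; E 6]).
- by apply: alternating_of_table.
- exact: Al.
- apply: (T511_frame Al z6 erefl).
  + by rewrite bracketBr bracketZr o5 //= scale1r low60 // subrr.
  + by rewrite bracketBr bracketZr o5 //= scale1r low60 // subrr.
  + by rewrite bracketBr bracketZr o5 //= scale1r low60 // subrr.
  + by rewrite b4E bracketDr bracketZr z6r o5 //= scale1r scaler0 addr0.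
  1-3: rewrite red1 //; exact: low6.
  1-3: rewrite red //; exact: low6.
  + by rewrite b4E bracketDr bracketZr z6r o50 // scaler0 addr0.
  1-2: by rewrite b4E bracketBl bracketZl !bracketDr !bracketZr !z6r o50 // o55 !scaler0 !addr0 scaler0 subr0.
  + by rewrite b4E bracketDl bracketZl z6 bracketBr bracketZr o5l0 // o55 !scaler0 !subr0 addr0.
by move=> x; rewrite b4E; apply: frame511_inj.
Qed.

End Reduction.

Section Reduction.
Variable R : realType.
Local Notation V := 'cV[R]_7.
Local Notation E i := (evec R (o7 i)).
Implicit Types (mu nu : bilin R 7) (eps : R) (u v w : V).

Lemma frame421_inj (z01 z02 z12 z03 z13 : R) (x : V) : frame_mx [:: E 0; E 1 - z01 *: E 4;
  E 2 - z02 *: E 4 - z12 *: E 5; E 3 - z03 *: E 4 - z13 *: E 5; E 4; E 5; E 6] *m x = 0 -> x = 0.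
Proof.
move=> /frame_mx7_eq0 Hx; have C k : (k < 7)%N -> _ := fun=> Hx (o7 k).
move: (C 0%N isT) (C 1%N isT) (C 2%N isT) (C 3%N isT).
rewrite !entE !Ecoord //= !zsimp => x0 x1 x2 x3.
move: (C 4%N isT) (C 5%N isT) (C 6%N isT).
rewrite !entE !Ecoord //= x0 x1 x2 x3 !zsimp => x4 x5 x6.
by coords.
Qed.

(** When the two covectors of the action on the middle step are independent, take a dual
    basis; the Jacobi identity then makes the bracket of the first two basis vectors with
    the last two symmetric. *)
Lemma type421_rank2 nu : filtered nu 4 2 ->
  let f (i k : nat) : R := (bracket nu (E i) (E (4 + k))) (o7 6) 0 in
  \rank (\matrix_(i < 4, k < 2) f i k) = 2%N ->
  exists s1 s2 t1 t2 u1 u2 p q d : R, isomorphic nu (T421 s1 s2 t1 t2 u1 u2 p q d).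
Proof.
move=> F0 f rG.
have [B [Bu BG]] := @dual_basis R 2 2 _ rG.
have [mu [I Fm _ H4 _]] := @change_basis R 4 B isT Bu nu 2%N F0.
have act (k : 'I_4) j : (j < 2)%N -> bracket mu (E k) (E (4 + j)) = (val k == j)%:R *: E 6.
  move=> j2; have j6 : (4 <= 4 + j < 7)%N by case: j j2 => [|[|]].
  rewrite H4 // (eq_bigr (fun l : 'I_4 => B k l *: (f l j *: E 6))); last first.
    by move=> l _; congr (_ *: _); apply: low6E; apply/(filtered2r F0)/low_E.
  by rewrite sum_scale_coef (basis_entry_fun BG k j2).
have A := filtered_alt Fm; have [_ J] := filtered_lie Fm.
have a4 k (k4 : (k < 4)%N) : bracket mu (E k) (E 4) = (k == 0%N)%:R *: E 6.
  exact: (act (Ordinal k4) 0%N).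
have a5 k (k4 : (k < 4)%N) : bracket mu (E k) (E 5) = (k == 1%N)%:R *: E 6.
  exact: (act (Ordinal k4) 1%N).
have c6 : central mu (E 6) := filtered_E Fm (k := 6%N) isT.
pose b4 (i j : nat) : R := (bracket mu (E i) (E j)) (o7 4) 0.
pose b5 (i j : nat) : R := (bracket mu (E i) (E j)) (o7 5) 0.
pose b6 (i j : nat) : R := (bracket mu (E i) (E j)) (o7 6) 0.
have bE i j : bracket mu (E i) (E j) = b4 i j *: E 4 + b5 i j *: E 5 + b6 i j *: E 6.
  exact: low4E (filtered1 Fm _ _).
have bb i j k : (k < 4)%N -> (bracket mu (bracket mu (E i) (E j)) (E k)) (o7 6) 0
     = - (b4 i j * (k == 0%N)%:R + b5 i j * (k == 1%N)%:R).
  move=> k4; rewrite {1}[bracket mu (E i) (E j)]bE !bracketDl !bracketZl c6.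
  rewrite scaler0 addr0 (alternatingC (E 4) (E k) A) (alternatingC (E 5) (E k) A) a4 // a5 //.
  by rewrite !entE Ecoord //=; ring.
have jac i j k : (i < 4)%N -> (j < 4)%N -> (k < 4)%N ->
    (b4 i j * (k == 0%N)%:R + b5 i j * (k == 1%N)%:R)
    + (b4 j k * (i == 0%N)%:R + b5 j k * (i == 1%N)%:R)
    + (b4 k i * (j == 0%N)%:R + b5 k i * (j == 1%N)%:R) = 0.
  move=> i4 j4 k4; have := congr1 (fun u : V => u (o7 6) 0) (J (E i) (E j) (E k)).
  rewrite /jacobiator !entE !bb // => /eqP; rewrite -!opprD oppr_eq0 => /eqP <-; ring.
have bC5 i j : b5 i j = - b5 j i by rewrite /b5 (alternatingC _ _ A) entN.
have b423 : b4 2%N 3%N = 0 by have := jac 0%N 2%N 3%N isT isT isT; rewrite /= !zsimp.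
have b523 : b5 2%N 3%N = 0 by have := jac 1%N 2%N 3%N isT isT isT; rewrite /= !zsimp.
have s2 : b4 1%N 2%N = b5 0%N 2%N.
  have := jac 0%N 1%N 2%N isT isT isT; rewrite /= !zsimp [b5 2%N _]bC5.
  by move/eqP; rewrite subr_eq0 => /eqP.
have s3 : b4 1%N 3%N = b5 0%N 3%N.
  have := jac 0%N 1%N 3%N isT isT isT; rewrite /= !zsimp [b5 3%N _]bC5.
  by move/eqP; rewrite subr_eq0 => /eqP.
have z45 : bracket mu (E 4) (E 5) = 0 by apply: (filtered_abelian Fm); apply: low_E.
have z54 : bracket mu (E 5) (E 4) = 0 by apply: (filtered_abelian Fm); apply: low_E.
have z44 : bracket mu (E 4) (E 4) = 0 := A _.
have z55 : bracket mu (E 5) (E 5) = 0 := A _.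
have l4 k (k4 : (k < 4)%N) : bracket mu (E 4) (E k) = - ((k == 0%N)%:R *: E 6).
  by rewrite (alternatingC _ _ A) a4.
have l5 k (k4 : (k < 4)%N) : bracket mu (E 5) (E k) = - ((k == 1%N)%:R *: E 6).
  by rewrite (alternatingC _ _ A) a5.
exists (b4 0%N 2%N), (b4 0%N 3%N), (b5 0%N 2%N), (b5 0%N 3%N), (b5 1%N 2%N), (b5 1%N 3%N),
  (b4 0%N 1%N), (b5 0%N 1%N), (b6 2%N 3%N).
apply: isomorphic_trans I _; apply: isomorphic_sym.
have H := (bracketBl, bracketBr, bracketZl, bracketZr, z45, z54, z44, z55).
apply: (@frame_iso _ _ _ [:: E 0; E 1 - b6 0%N 1%N *: E 4;
  E 2 - b6 0%N 2%N *: E 4 - b6 1%N 2%N *: E 5; E 3 - b6 0%N 3%N *: E 4 - b6 1%N 3%N *: E 5;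
  E 4; E 5; E 6]).
- by apply: alternating_of_table.
- exact: A.
- apply: T421_frame; first exact: A.
  + exact: c6.
  + by rewrite !H a4 // bE /= !zsimp addrK.
  + by rewrite !H a4 // a5 // bE /= !zsimp scaler0 subr0 addrK.
  + by rewrite !H a4 // a5 // bE /= !zsimp scaler0 subr0 addrK.
  + rewrite !H a4 // a5 // l4 // bE s2 /= !zsimp oppr0 !scaler0 !subr0 addrK //.
  + rewrite !H a4 // a5 // l4 // bE s3 /= !zsimp oppr0 !scaler0 !subr0 addrK //.
  + rewrite !H a4 // a5 // l4 // l5 // bE b423 b523 /= !zsimp !oppr0 !scaler0 !subr0 //.
  + by rewrite a4 //= scale1r.
  + by rewrite a5 //= scale0r.
  + by rewrite !H a4 //= ?zsimp ?scaler0 ?subr0 ?oppr0 ?addr0.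
  + by rewrite !H a5 //= ?zsimp ?scaler0 ?subr0 ?oppr0 ?addr0.
  + by rewrite !H a4 //= ?zsimp ?scaler0 ?subr0 ?oppr0 ?addr0.
  + by rewrite !H a5 //= ?zsimp ?scaler0 ?subr0 ?oppr0 ?addr0.
  + by rewrite !H a4 //= ?zsimp ?scaler0 ?subr0 ?oppr0 ?addr0.
  + by rewrite !H a5 //= ?zsimp ?scaler0 ?subr0 ?oppr0 ?addr0.
  + exact: z45.
exact: frame421_inj.
Qed.

(** The action on the middle step is the covector of e_0 on e_4 and t times the covector p
    on e_5, of rank one at t = 0. The terms in t along e_4 preserve the Jacobi identity
    when p is orthogonal to (c23, - c13, c12). *)
Definition R421 (a1 a2 a3 r1 r2 r3 x1 x2 x3 c12 c13 c23 z12 z13 z23 p1 p2 p3 t : R) : bilin R 7 :=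
  of_table
  [:: (o7 0, o7 1, a1 *: E 4 + r1 *: E 5 + x1 *: E 6);
      (o7 0, o7 2, a2 *: E 4 + r2 *: E 5 + x2 *: E 6);
      (o7 0, o7 3, a3 *: E 4 + r3 *: E 5 + x3 *: E 6);
      (o7 1, o7 2, (t * (p1 * r2 - p2 * r1)) *: E 4 + c12 *: E 5 + z12 *: E 6);
      (o7 1, o7 3, (t * (p1 * r3 - p3 * r1)) *: E 4 + c13 *: E 5 + z13 *: E 6);
      (o7 2, o7 3, (t * (p2 * r3 - p3 * r2)) *: E 4 + c23 *: E 5 + z23 *: E 6);
      (o7 0, o7 4, E 6); (o7 1, o7 5, (t * p1) *: E 6); (o7 2, o7 5, (t * p2) *: E 6);
      (o7 3, o7 5, (t * p3) *: E 6)].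

Section R421.
Variables (a1 a2 a3 r1 r2 r3 x1 x2 x3 c12 c13 c23 z12 z13 z23 p1 p2 p3 t : R).
Local Notation T := (R421 a1 a2 a3 r1 r2 r3 x1 x2 x3 c12 c13 c23 z12 z13 z23 p1 p2 p3 t).

Lemma R421E x y : bracket T x y = vec7
  [:: 0; 0; 0; 0;
    a1 * minor2 x y 0 1 + a2 * minor2 x y 0 2 + a3 * minor2 x y 0 3
    + t * ((p1 * r2 - p2 * r1) * minor2 x y 1 2 + (p1 * r3 - p3 * r1) * minor2 x y 1 3
    + (p2 * r3 - p3 * r2) * minor2 x y 2 3);
    r1 * minor2 x y 0 1 + r2 * minor2 x y 0 2 + r3 * minor2 x y 0 3
    + c12 * minor2 x y 1 2 + c13 * minor2 x y 1 3 + c23 * minor2 x y 2 3;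
    x1 * minor2 x y 0 1 + x2 * minor2 x y 0 2 + x3 * minor2 x y 0 3
    + z12 * minor2 x y 1 2 + z13 * minor2 x y 1 3 + z23 * minor2 x y 2 3
    + minor2 x y 0 4 + t * (p1 * minor2 x y 1 5 + p2 * minor2 x y 2 5 + p3 * minor2 x y 3 5)].
Proof.
rewrite bracket_of_table !big_cons big_nil /= -!/(minor2 x y _ _).
by coords; ring.
Qed.

Lemma R421_level u z : low 4 u -> bracket T u z = vec7
  [:: 0; 0; 0; 0; 0; 0; - (u (o7 4) 0 * z (o7 0) 0
    + u (o7 5) 0 * (t * (p1 * z (o7 1) 0 + p2 * z (o7 2) 0 + p3 * z (o7 3) 0)))].
Proof.
move=> H; rewrite R421E; coords;
  rewrite /minor2 ?(H 0%N) ?(H 1%N) ?(H 2%N) ?(H 3%N) //; ring.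
Qed.

Lemma R421_low x y : low 4 (bracket T x y).
Proof. by rewrite R421E; low_tac. Qed.

Lemma R421_filtered : c12 * p3 - c13 * p2 + c23 * p1 = 0 -> filtered T 4 2.
Proof.
move=> H0.
have lv u z : low 4 u -> low 6 (bracket T u z) by move=> lu; rewrite R421_level //; low_tac.
have ce u : low 6 u -> central T u.
  move=> lu z; rewrite R421_level; last exact: low_le lu.
  by rewrite (lu 4%N) // (lu 5%N) //; coords; ring.
split=> //; last first.
- move=> x y lx ly; rewrite R421_level //.
  by rewrite (ly 0%N) // (ly 1%N) // (ly 2%N) // (ly 3%N) //; coords; ring.
- exact: R421_low.
split; first (split; first exact: alternating_of_table).
  move=> x y z; rewrite /jacobiator ![bracket _ (bracket _ _ _) _]R421_level; try exact: R421_low.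
  rewrite !R421E; coords; rewrite ?vec7_coord //= /minor2; try ring.
  have -> : 0 = (c12 * p3 - c13 * p2 + c23 * p1) * (- t *
     (x (o7 1) 0 * (y (o7 2) 0 * z (o7 3) 0 - y (o7 3) 0 * z (o7 2) 0)
    - x (o7 2) 0 * (y (o7 1) 0 * z (o7 3) 0 - y (o7 3) 0 * z (o7 1) 0)
    + x (o7 3) 0 * (y (o7 1) 0 * z (o7 2) 0 - y (o7 2) 0 * z (o7 1) 0))) :> R by rewrite H0 mul0r.
  by ring.
apply: (nil3_low (p := 4) (q := 6)) => [x y|x y lx|x y lx]; first exact: R421_low.
  exact: lv.
exact: ce.
Qed.

Lemma R421_rank2 : t != 0 -> (p1, p2, p3) != (0, 0, 0) ->
  \rank (\matrix_(i < 4, k < 2) (bracket T (E i) (E (4 + k))) (o7 6) 0) = 2%N.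
Proof.
move=> t0 p0; pose g (i k : nat) : R := nth 0 [:: (i == 0%N)%:R; t * nth 0 [:: 0; p1; p2; p3] i] k.
have -> : \matrix_(i < 4, k < 2) (bracket T (E i) (E (4 + k))) (o7 6) 0 =
    \matrix_(i < 4, k < 2) g i k :> 'M[R]_(4, 2).
  apply/matrixP => i k; rewrite [LHS]mxE [RHS]mxE R421E vec7_coord //=.
  by case: i => [[|[|[|[|//]]]] ?]; case: k => [[|[|//]] ?]; rewrite !minor2E //= /g /=; ring.
apply: colfree_rank => c gc; pose c' (k : nat) : R := c (inord k) 0.
have row i : (i < 4)%N -> g i 0%N * c' 0%N + g i 1%N * c' 1%N = 0.
  move=> i4; have := congr1 (fun u : 'cV[R]_4 => u (Ordinal i4) 0) gc.
  by rewrite mul_matrix_col [RHS]mxE !big_ord_recr big_ord0 /= !zsimp.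
have c0 : c' 0%N = 0 by have := row 0%N isT; rewrite /g /= !zsimp.
suff c1 : c' 1%N = 0 by apply: colP_inord => -[|[|//]] _.
apply/eqP/negPn/negP => c1; case/negP: p0.
have p0 k : (k < 3)%N -> nth 0 [:: p1; p2; p3] k = 0.
  move=> k3; have := row k.+1 k3; rewrite /g /= mul0r add0r => /eqP.
  by rewrite !mulf_eq0 (negbTE t0) (negbTE c1) orbF => /eqP.
by apply/eqP; have /= -> := p0 0%N isT; have /= -> := p0 1%N isT; have /= -> := p0 2%N isT.
Qed.
End R421.

Lemma R421_frame mu (b0 b1 b2 b3 b4 b5 b6 : V)
   (a1 a2 a3 r1 r2 r3 x1 x2 x3 c12 c13 c23 z12 z13 z23 p1 p2 p3 : R) :
  alternating mu -> central mu b6 ->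
  bracket mu b0 b1 = a1 *: b4 + r1 *: b5 + x1 *: b6 ->
  bracket mu b0 b2 = a2 *: b4 + r2 *: b5 + x2 *: b6 ->
  bracket mu b0 b3 = a3 *: b4 + r3 *: b5 + x3 *: b6 ->
  bracket mu b1 b2 = c12 *: b5 + z12 *: b6 ->
  bracket mu b1 b3 = c13 *: b5 + z13 *: b6 ->
  bracket mu b2 b3 = c23 *: b5 + z23 *: b6 ->
  bracket mu b0 b4 = b6 -> bracket mu b1 b4 = 0 -> bracket mu b2 b4 = 0 -> bracket mu b3 b4 = 0 ->
  bracket mu b0 b5 = 0 -> bracket mu b1 b5 = 0 -> bracket mu b2 b5 = 0 -> bracket mu b3 b5 = 0 ->
  bracket mu b4 b5 = 0 ->
  frame_hom (R421 a1 a2 a3 r1 r2 r3 x1 x2 x3 c12 c13 c23 z12 z13 z23 p1 p2 p3 0) mu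
    [:: b0; b1; b2; b3; b4; b5; b6].
Proof.
by move=> A c6 H01 H02 H03 H12 H13 H23 H04 H14 H24 H34 H05 H15 H25 H35 H45; hom_tac R421E.
Qed.

(** A dependent pair of covectors is deformed into an independent one. The new covector
    is chosen in the kernel of the remaining bracket, which keeps the Jacobi identity. *)
Lemma robust_R421 (a1 a2 a3 r1 r2 r3 x1 x2 x3 c12 c13 c23 z12 z13 z23 : R) :
  let M p1 p2 p3 := R421 a1 a2 a3 r1 r2 r3 x1 x2 x3 c12 c13 c23 z12 z13 z23 p1 p2 p3 in
  (forall p1 p2 p3, robust (M p1 p2 p3 0)) ->
  exists eps, (eps = 1 \/ eps = -1) /\ isomorphic (M 0 0 0 0) (N137 eps).
Proof.
move=> M rob.
pose w (i : nat) : R := nth 0 [:: c23; - c13; c12] i.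
have [u u0 Hu] := @ker_vec R 1 3 (\matrix_(i < 3, k < 1) w i) isT.
pose p (k : nat) : R := u 0 (inord k).
have p0 : (p 0%N, p 1%N, p 2%N) != (0, 0, 0).
  apply: contra u0 => /eqP[q0 q1 q2]; apply/eqP/rowP => k; rewrite mxE -(inord_val k).
  by case: k => [[|[|[|//]]] ?].
have Hw : c12 * p 2%N - c13 * p 1%N + c23 * p 0%N = 0.
  have := congr1 (fun A : 'M[R]_1 => A 0 0) Hu; rewrite !mxE => <-.
  rewrite (eq_bigr (fun j : 'I_3 => p j * w j)); last by move=> j _; rewrite mxE /p inord_val.
  by rewrite !big_ord_recr big_ord0 /= /w /=; ring.
pose L := M (p 0%N) (p 1%N) (p 2%N).
have [|||||t [ft It]] := @robust_line R L (fun t => t).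
- exact: rob.
- by rewrite /L /M; affine_tac (@R421E).
- by move=> t; apply: filtered_nil (R421_filtered _ _ _ _ _ _ _ _ _ _ _ _ _ Hw).
- exact: polyfun_id.
- by exists 1; apply: oner_neq0.
have [s1 [s2 [t1 [t2 [u1 [u2 [q1 [q2 [d I]]]]]]]]] :=
  type421_rank2 (R421_filtered a1 a2 a3 r1 r2 r3 x1 x2 x3 z12 z13 z23 t Hw) (R421_rank2 _ _ _ _ _ _ _ _ _ _ _ _ _ _ _ ft p0).
have {}I := isomorphic_trans It I.
have [eps [He J]] := robust_T421 (robust_iso I (rob _ _ _)).
exists eps; split=> //; have -> : M 0 0 0 0 = L 0.
  by apply: bracket_inj => x y; rewrite /L /M !R421E !mul0r.
exact: isomorphic_trans I J.
Qed.

Lemma frame421b_inj (c0 c1 : R) (x : V) : c0 * c0 + c1 * c1 != 0 ->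
  frame_mx [:: E 0; E 1; E 2; E 3; - c1 *: E 4 + c0 *: E 5; c0 *: E 4 + c1 *: E 5; E 6] *m x = 0 ->
  x = 0.
Proof.
move=> D0; move=> /frame_mx7_eq0 Hx; have C k : (k < 7)%N -> _ := fun=> Hx (o7 k).
move: (C 0%N isT) (C 1%N isT) (C 2%N isT) (C 3%N isT).
rewrite !entE !Ecoord //= !zsimp => x0 x1 x2 x3.
move: (C 4%N isT) (C 5%N isT) (C 6%N isT).
rewrite !entE !Ecoord //= x0 x1 x2 x3 !zsimp => h4 h5 x6.
have D1 : - c1 * c1 - c0 * c0 != 0 by rewrite -oppr_eq0 opprB mulNr opprK.
have [x4 x5] := indep2 D1 h4 h5.
by coords.
Qed.

(** When the covectors are dependent, one combination [w5] of e_4 and e_5 is central and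
    the orthogonal one [w4] is not; this is the structure [R421] at t = 0. *)
Lemma robust_type421 nu : filtered nu 4 2 -> onto nu 4 2 -> robust nu ->
  exists eps, (eps = 1 \/ eps = -1) /\ isomorphic nu (N137 eps).
Proof.
move=> F0 O0 rob.
pose f (i k : nat) : R := (bracket nu (E i) (E (4 + k))) (o7 6) 0.
case: (pselect (forall c : 'cV[R]_2, (\matrix_(i < 4, k < 2) f i k) *m c = 0 -> c = 0)) => [/colfree_rank rG|].
  have [s1 [s2 [t1 [t2 [u1 [u2 [p [q [d I]]]]]]]]] := type421_rank2 F0 rG.
  have [eps [He J]] := robust_T421 (robust_iso I rob).
  by exists eps; split=> //; apply: isomorphic_trans I J.
move=> /existsNP[c /not_implyP[Gc /eqP cn0]].
pose c' (k : nat) : R := c (inord k) 0; set c0 := c' 0%N; set c1 := c' 1%N.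
have D0 : c0 * c0 + c1 * c1 != 0.
  apply: contra cn0; rewrite -!expr2 paddr_eq0 ?sqr_ge0 // !sqrf_eq0 => /andP[/eqP q0 /eqP q1].
  by apply/eqP/colP_inord => -[|[|//]] _.
have row i : (i < 4)%N -> f i 0%N * c0 + f i 1%N * c1 = 0.
  move=> i4; have := congr1 (fun u : 'cV[R]_4 => u (Ordinal i4) 0) Gc.
  by rewrite mul_matrix_col [RHS]mxE !big_ord_recr big_ord0 /= !zsimp.
(* f4 is the covector of the orthogonal combination *)
pose f4 (i k : nat) : R := - c1 * f i 0%N + c0 * f i 1%N.
have rG : \rank (\matrix_(i < 4, k < 1) f4 i k : 'M[R]_(1 + 3, 1)) = 1%N.
  apply: colfree_rank => d Gd; pose d' : R := d (inord 0) 0.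
  suff d0 : d' = 0 by apply: colP_inord => -[|//] _.
  apply/eqP/negPn/negP => d0.
  have row4 i : (i < 4)%N -> f4 i 0%N = 0.
    move=> i4; have := congr1 (fun u : 'cV[R]_4 => u (Ordinal i4) 0) Gd.
    rewrite mul_matrix_col [RHS]mxE !big_ord_recr big_ord0 /= !zsimp => /eqP.
    by rewrite mulf_eq0 (negbTE d0) orbF => /eqP.
  have ff i : (i < 4)%N -> f i 0%N = 0 /\ f i 1%N = 0.
    move=> i4; have h1 := row i i4; have h2 := row4 i i4.
    have D1 : c0 * c0 - - c1 * c1 != 0 by rewrite mulNr opprK.
    by apply: (indep2 D1); [rewrite -[RHS]h1; ring|rewrite -[RHS]h2 /f4; ring].
  have K : forall u, low 6 u -> (vec7 [:: 0; 0; 0; 0; 0; 0; 1])^T *m u = 0 :> 'M[R]_1.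
    apply: (onto_basis2 F0 O0) => i j i4 /andP[j4 j6]; apply/functional7; rewrite /= !zsimp.
    have [f0 f1] := ff i i4; have -> : j = (4 + (j - 4))%N by rewrite subnKC.
    by case: (j - 4)%N (ltn_sub2r (n := 6%N) (p := 4%N) isT j6) => [|[|//]] _.
  by have /eqP := functional_low K (k := 6%N) isT; rewrite oner_eq0.
have [B [Bu BG]] := dual_basis rG.
have [mu [I Fm _ H4 _]] := @change_basis R 4 B isT Bu nu 2%N F0.
have A := filtered_alt Fm; have [_ J] := filtered_lie Fm.
have c6 : central mu (E 6) := filtered_E Fm (k := 6%N) isT.
pose w4 : V := - c1 *: E 4 + c0 *: E 5; pose w5 : V := c0 *: E 4 + c1 *: E 5.
have fE j k : (4 + k < 6)%N -> bracket nu (E j) (E (4 + k)) = f j k *: E 6.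
  by move=> k6; apply/low6E/(filtered2r F0)/low_E; rewrite leq_addr ltnW.
have comb (k : 'I_4) (s t : R) : bracket mu (E k) (s *: E 4 + t *: E 5) =
    (\sum_j B k j * (s * f j 0%N + t * f j 1%N)) *: E 6.
  rewrite bracketDr !bracketZr !H4 // !scaler_sumr -big_split /= scaler_suml.
  apply: eq_bigr => j _; rewrite (fE j 0%N) // (fE j 1%N) // !scalerA -scalerDl.
  by congr (_ *: _); ring.
have aw4 k (k4 : (k < 4)%N) : bracket mu (E k) w4 = (k == 0%N)%:R *: E 6.
  by rewrite (comb (Ordinal k4)) (basis_entry_fun BG (Ordinal k4) (j := 0%N)).
have aw5 k (k4 : (k < 4)%N) : bracket mu (E k) w5 = 0.
  rewrite (comb (Ordinal k4)) big1 ?scale0r // => j _.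
  by rewrite [c0 * _]mulrC [c1 * _]mulrC row ?mulr0.
have D1 : - c1 * c1 - c0 * c0 != 0 by rewrite -oppr_eq0 opprB mulNr opprK.
have ex i j : exists a b z, bracket mu (E i) (E j) = a *: w4 + b *: w5 + z *: E 6.
  have [a [b [Ha Hb]]] := solve2 ((bracket mu (E i) (E j)) (o7 4) 0) ((bracket mu (E i) (E j)) (o7 5) 0) D1.
  exists a, b, ((bracket mu (E i) (E j)) (o7 6) 0).
  by rewrite [LHS](low4E (filtered1 Fm _ _)) -Ha -Hb /w4 /w5; vring.
have exj i j : (0 < i < 4)%N -> (0 < j < 4)%N -> exists b z, bracket mu (E i) (E j) = b *: w5 + z *: E 6.
  move=> /andP[i0 i4] /andP[j0 j4]; have [a [b [z Hij]]] := ex i j.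
  have lw k (k4 : (k < 4)%N) u v : (exists a b z, bracket mu u v = a *: w4 + b *: w5 + z *: E 6 /\
      a * (k == 0%N)%:R = 0) -> bracket mu (bracket mu u v) (E k) = 0.
    move=> [a' [b' [z' [-> a0]]]]; rewrite !bracketDl !bracketZl c6 scaler0 addr0.
    rewrite (alternatingC w4 (E k) A) (alternatingC w5 (E k) A) aw4 // aw5 // oppr0 scaler0 addr0.
    by rewrite scalerN scalerA a0 scale0r oppr0.
  have := J (E i) (E j) (E 0); rewrite /jacobiator.
  rewrite [bracket mu (bracket mu (E j) (E 0)) (E i)]lw //; last first.
    by have [a' [b' [z' ->]]] := ex j 0%N; exists a', b', z'; rewrite (gtn_eqF i0) mulr0.
  rewrite [bracket mu (bracket mu (E 0) (E i)) (E j)]lw //; last first.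
    by have [a' [b' [z' ->]]] := ex 0%N i; exists a', b', z'; rewrite (gtn_eqF j0) mulr0.
  rewrite !addr0 Hij !bracketDl !bracketZl c6 scaler0 addr0.
  rewrite (alternatingC w4 (E 0) A) (alternatingC w5 (E 0) A) aw4 // aw5 // oppr0 scaler0 addr0 /=.
  move=> /(congr1 (fun u : V => u (o7 6) 0)); rewrite !entE Ecoord //= !zsimp mulrN1 => /eqP.
  by rewrite oppr_eq0 => /eqP a0; exists b, z; rewrite a0 scale0r add0r.
have [a1 [r1 [x1 e01]]] := ex 0%N 1%N; have [a2 [r2 [x2 e02]]] := ex 0%N 2%N.
have [a3 [r3 [x3 e03]]] := ex 0%N 3%N.
have [c12 [z12 e12]] := exj 1%N 2%N isT isT; have [c13 [z13 e13]] := exj 1%N 3%N isT isT.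
have [c23 [z23 e23]] := exj 2%N 3%N isT isT.
have iso p1 p2 p3 : isomorphic nu (R421 a1 a2 a3 r1 r2 r3 x1 x2 x3 c12 c13 c23 z12 z13 z23 p1 p2 p3 0).
  apply: isomorphic_trans I _; apply: isomorphic_sym.
  apply: (@frame_iso _ _ _ [:: E 0; E 1; E 2; E 3; w4; w5; E 6]).
  - by apply: alternating_of_table.
  - exact: A.
  - apply: (R421_frame p1 p2 p3 A c6 e01 e02 e03 e12 e13 e23).
    + by rewrite aw4 //= scale1r.
    + by rewrite aw4 //= scale0r.
    + by rewrite aw4 //= scale0r.
    + by rewrite aw4 //= scale0r.
    + exact: aw5.
    + exact: aw5.
    + exact: aw5.
    + exact: aw5.
    + by apply: (filtered_abelian Fm); apply: lowD; apply: lowZ; apply: low_E.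
  by move=> x; apply: frame421b_inj.
have [|eps [He K]] := @robust_R421 a1 a2 a3 r1 r2 r3 x1 x2 x3 c12 c13 c23 z12 z13 z23.
  by move=> p1 p2 p3; apply: robust_iso (iso p1 p2 p3) rob.
by exists eps; split=> //; apply: isomorphic_trans (iso 0 0 0) K.
Qed.
End Reduction.

(** * Classification *)

Section Reduction.
Variable R : realType.
Local Notation V := 'cV[R]_7.
Local Notation E i := (evec R (o7 i)).
Implicit Types (mu nu : bilin R 7) (eps : R) (u v w : V).

Section SmallTypes.
Variables (nu : bilin R 7) (p q : nat).
Hypotheses (Fn : filtered nu p q) (On : onto nu p q) (S3 : nil_step 3 nu).
Let A : alternating nu := filtered_alt Fn.

Lemma type_lt7 : (p + q < 7)%N.
Proof.
rewrite ltnNge; apply/negP => pq; case: S3 => _; apply.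
split; first exact: filtered_lie Fn.
move=> x /=; apply/low7/(low_le pq)/(filtered2 Fn)/(filtered1 Fn).
Qed.

Lemma type_q_gt0 : (0 < q)%N.
Proof.
rewrite lt0n; apply/eqP => q0; have pq := type_lt7.
have K : forall u, low (p + q) u -> (vec7 (rcons (nseq 6 0) 1))^T *m u = 0 :> 'M[R]_1.
  by apply: (onto_basis2 Fn On) => i j _; rewrite q0 addn0 ltnNge andbN.
by have /eqP := functional_low K (k := 6%N) (introT andP (conj pq isT)); rewrite oner_eq0.
Qed.

(** The test [onto] for functionals supported on the middle step. *)
Lemma type_mid (f : nat -> R) : (forall k, (k < p)%N || (p + q <= k)%N -> f k = 0) ->
  (forall i j, (i < j < p)%N -> \sum_(k < 7) f k * (bracket nu (E i) (E j)) (o7 k) 0 = 0) ->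
  forall k, (p <= k < 7)%N -> f k = 0.
Proof.
move=> f0 H k /[dup] pk /andP[_ k7].
have fE u : (vec7 (mkseq f 7))^T *m u = 0 :> 'M[R]_1 <-> \sum_(k < 7) f k * u (o7 k) 0 = 0.
  by rewrite functional7 (sum7 (fun k => f k * u (o7 k) 0)).
have K : forall u, low p u -> (vec7 (mkseq f 7))^T *m u = 0 :> 'M[R]_1.
  apply: (onto_basis1 Fn On) => [i j ij|u lu]; apply/fE; first exact: H.
  rewrite big1 // => l _; case: (ltnP l (p + q)) => lpq; first by rewrite lu ?mulr0.
  by rewrite f0 ?mul0r // lpq orbT.
by have := functional_low K pk; rewrite nth_mkseq.
Qed.

(** Two generators have a single bracket, so the middle step is a line; the last step is then
    spanned by two brackets, which is too small for the dimension. *)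
Lemma type_p_gt2 : (2 < p)%N.
Proof.
have q0 := type_q_gt0; have pq := type_lt7.
rewrite ltnNge; apply/negP => p2.
have [p1|p1] := leqP p 1.
  have := @type_mid (fun k => (k == p)%:R) _ _ p.
  rewrite eqxx leqnn /= => H; have /eqP : (1 : R) = 0; last by rewrite oner_eq0.
  apply: H => [k /orP[kp|kp]|i j /andP[ij jp]|].
  - by rewrite (ltn_eqF kp).
  - by rewrite gtn_eqF // (leq_trans _ kp) // -[X in (X < _)%N]addn0 ltn_add2l.
  - by have := leq_ltn_trans (leq0n i) ij; rewrite ltnNge -ltnS (leq_trans jp p1).
  by rewrite (leq_ltn_trans _ pq) // leq_addr.
have {p1 p2} p2 : p = 2%N by apply/eqP; rewrite eqn_leq p2 p1.
have [q1|q1] := leqP q 1.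
  have {q1} q1 : q = 1%N by apply/eqP; rewrite eqn_leq q1 q0.
  pose f (i k : nat) : R := (bracket nu (E k) (E 2)) (o7 (3 + i)) 0.
  have [u u0 Hu] := @ker_vec R 2 4 (\matrix_(i < 4, k < 2) f i k) isT.
  pose w (k : nat) : R := u 0 (inord k).
  have row i : (i < 2)%N -> w 0%N * f 0%N i + w 1%N * f 1%N i + w 2%N * f 2%N i + w 3%N * f 3%N i = 0.
    move=> i2; have := congr1 (fun v : 'rV[R]_2 => v 0 (Ordinal i2)) Hu.
    rewrite !mxE (eq_bigr (fun j : 'I_4 => w j * f j i)); last by move=> l _; rewrite mxE /w inord_val.
    by rewrite !big_ord_recr big_ord0 /= add0r.
  have K : forall v, low (p + q) v -> (vec7 [:: 0; 0; 0; w 0%N; w 1%N; w 2%N; w 3%N])^T *m v = 0 :> 'M[R]_1.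
    apply: (onto_basis2 Fn On) => i j; rewrite p2 q1 => i2 /andP[j2 j3].
    have -> : j = 2%N by apply/eqP; rewrite eqn_leq j2 -ltnS j3.
    by apply/functional7; rewrite -[RHS](row i) // /f /= !zsimp; ring.
  rewrite p2 q1 in K; have Kw := functional_low K.
  case/negP: u0; apply/eqP/rowP => k; rewrite mxE -(inord_val k) -/(w _).
  case: k => [[|[|[|[|//]]]] ?] /=.
  - exact: (Kw 3%N).
  - exact: (Kw 4%N).
  - exact: (Kw 5%N).
  - exact: (Kw 6%N).
pose b k : R := (bracket nu (E 0) (E 1)) (o7 k) 0.
have [u u0 Hu] := @ker_vec R 1 2 (\matrix_(i < 2, k < 1) (fun i k => b (2 + i)%N) i k) isT.
pose w (k : nat) : R := u 0 (inord k).
have Hw : w 0%N * b 2%N + w 1%N * b 3%N = 0.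
  have := congr1 (fun v : 'rV[R]_1 => v 0 0) Hu.
  rewrite !mxE (eq_bigr (fun j : 'I_2 => w j * b (2 + j)%N)); last by move=> l _; rewrite mxE /w inord_val.
  by rewrite !big_ord_recr big_ord0 /= add0r.
pose f k : R := nth 0 [:: 0; 0; w 0%N; w 1%N] k.
have f0 k : (2 <= k < 7)%N -> f k = 0.
  move: k; have tm := @type_mid f; rewrite p2 in tm; apply: tm => [l|i j].
    rewrite /f; case/orP; first by case: l => [|[|]].
    move=> Hl; rewrite nth_default //=; apply: leq_trans Hl; by rewrite (leq_add2l 2 2).
  case/andP; case: i => [|i]; case: j => [|[|j]] // _ _.
  by rewrite (sum7 (fun k => f k * b k)) /f /= !zsimp.
case/negP: u0; apply/eqP/rowP => k; rewrite mxE -(inord_val k) -/(w _).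
by case: k => [[|[|//]] ?] /=; [exact: (f0 2%N) | exact: (f0 3%N)].
Qed.

End SmallTypes.

(** An adapted basis has one of six types. The type (3,1,3) is empty and (3,3,1) is never
    rigid; a rigid structure of one of the types (5,1,1), (4,2,1) is isomorphic to a generic
    one of type (4,2,1), and one of the types (4,1,2), (3,2,2) to a generic one of type
    (3,2,2). *)
Theorem classification mu : nil_step 3 mu -> rigid_cocycles 3 mu ->
  exists eps, (eps = 1 \/ eps = -1) /\ (isomorphic mu (N137 eps) \/ isomorphic mu (N247 eps)).
Proof.
move=> S Z; have [N _] := S.
have [p [q [nu [I _ Fn On]]]] := filtered_exists N.
have {S} S := nil_step_iso I S.
have rob : robust nu by apply: robust_iso I _.
suff [eps [He J]] : exists eps, (eps = 1 \/ eps = -1) /\ (isomorphic nu (N137 eps) \/ isomorphic nu (N247 eps)).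
  exists eps; split=> //; case: J => J; [left|right]; exact: isomorphic_trans I J.
have pq := type_lt7 Fn S; have q0 := type_q_gt0 Fn On S; have p2 := type_p_gt2 Fn On S.
have H : (p = 3 /\ q = 1 \/ p = 3 /\ q = 2 \/ p = 3 /\ q = 3 \/
   p = 4 /\ q = 1 \/ p = 4 /\ q = 2 \/ p = 5 /\ q = 1)%N by lia.
case: H Fn On => [[-> ->]|[[-> ->]|[[-> ->]|[[-> ->]|[[-> ->]|[-> ->]]]]]] Fn On {p q pq q0 p2}.
- by case: (no_type313 Fn On).
- have [p5 [p6 [m1 [m2 [m3 [m4 [q1 [r1 [q2 [r2 [q3 [r3 J]]]]]]]]]]]] := type322 Fn On.
  have [eps [He K]] := robust_T322 (robust_iso J rob).
  by exists eps; split=> //; right; apply: isomorphic_trans J K.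
- have [a [b [c [d [e [f [g [h J]]]]]]]] := type331 Fn On.
  by case: (T331_not_robust (robust_iso J rob)).
- have [a0 [a1 [c0 [c1 [d0 [d1 [e0 [e1 [f0 [f1 J]]]]]]]]]] := type412 Fn On.
  have [eps [He K]] := robust_T412 (robust_iso J rob).
  by exists eps; split=> //; right; apply: isomorphic_trans J K.
- have [eps [He K]] := robust_type421 Fn On rob.
  by exists eps; split=> //; left.
have [a1 [a2 [a3 [w1 [w2 [w3 J]]]]]] := type511 Fn On.
have [eps [He K]] := robust_T511 (robust_iso J rob).
by exists eps; split=> //; left; apply: isomorphic_trans J K.
Qed.

End Reduction.

(** * The two families of models *)

Section Models.
Variable F : fieldType.
Local Notation V := 'cV[F]_7.
Local Notation E i := (evec F (o7 i)).
Implicit Types (mu nu : bilin F 7) (eps : F) (x y z u v w : V).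

Lemma N137_level eps u z : low 4 u -> bracket (N137 eps) u z = vec7
  [:: 0; 0; 0; 0; 0; 0; - (u (o7 4) 0 * z (o7 0) 0 + eps * (u (o7 5) 0 * z (o7 1) 0))].
Proof.
move=> H; rewrite N137E; coords;
  rewrite /minor2 ?(H 0%N) ?(H 1%N) ?(H 2%N) ?(H 3%N) //; ring.
Qed.

Lemma N137_low eps x y : low 4 (bracket (N137 eps) x y).
Proof. by rewrite N137E; low_tac. Qed.

Lemma N137_nil eps : nil_variety 3 (N137 eps).
Proof.
split; first (split; first exact: alternating_of_table).
  move=> x y z; rewrite /jacobiator ![bracket _ (bracket _ _ _) _]N137_level; try exact: N137_low.
  by rewrite !N137E; coords; rewrite ?vec7_coord //= /minor2; ring.
apply: (nil3_low (p := 4) (q := 6)) => [x y|x y lx|x y lx]; first exact: N137_low.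
  by rewrite N137_level //; low_tac.
rewrite N137_level; last exact: low_le lx.
by rewrite (lx 4%N) // (lx 5%N) //; coords; ring.
Qed.

Lemma N247_level eps u z : low 3 u -> bracket (N247 eps) u z = vec7
  [:: 0; 0; 0; 0; 0; - (u (o7 3) 0 * (z (o7 0) 0 + z (o7 1) 0) + eps * (u (o7 4) 0 * z (o7 2) 0));
   - (u (o7 4) 0 * z (o7 1) 0 + u (o7 3) 0 * z (o7 2) 0)].
Proof.
move=> H; rewrite N247E; coords;
  rewrite /minor2 ?(H 0%N) ?(H 1%N) ?(H 2%N) //; ring.
Qed.

Lemma N247_low eps x y : low 3 (bracket (N247 eps) x y).
Proof. by rewrite N247E; low_tac. Qed.

Lemma N247_nil eps : nil_variety 3 (N247 eps).
Proof.
split; first (split; first exact: alternating_of_table).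
  move=> x y z; rewrite /jacobiator ![bracket _ (bracket _ _ _) _]N247_level; try exact: N247_low.
  by rewrite !N247E; coords; rewrite ?vec7_coord //= /minor2; ring.
apply: (nil3_low (p := 3) (q := 5)) => [x y|x y lx|x y lx]; first exact: N247_low.
  by rewrite N247_level //; low_tac.
rewrite N247_level; last exact: low_le lx.
by rewrite (lx 3%N) // (lx 4%N) //; coords; ring.
Qed.

Lemma N137_step eps : nil_step 3 (N137 eps).
Proof.
split; first exact: N137_nil.
case=> _ /(_ (fun i => nth 0 [:: E 0; E 2; E 0] i)) /=.
rewrite N137_level; last exact: N137_low.
move=> /(congr1 (fun u : V => u (o7 6) 0)); rewrite vec7_coord //= ent0 N137E !vec7_coord //=.
by rewrite !minor2E //= !Ecoord //= !zsimp => /eqP; rewrite oppr_eq0 oner_eq0.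
Qed.

Lemma N247_step eps : nil_step 3 (N247 eps).
Proof.
split; first exact: N247_nil.
case=> _ /(_ (fun i => nth 0 [:: E 0; E 1; E 0] i)) /=.
rewrite N247_level; last exact: N247_low.
move=> /(congr1 (fun u : V => u (o7 5) 0)); rewrite vec7_coord //= ent0 N247E !vec7_coord //=.
by rewrite !minor2E //= !Ecoord //= !zsimp => /eqP; rewrite oppr_eq0 oner_eq0.
Qed.

(** The two families differ by the dimension of the last step. *)
Definition collinear_triples mu := exists w, forall x y z, exists c : F,
  bracket mu (bracket mu x y) z = c *: w.

Lemma collinear_triples_iso mu nu : isomorphic mu nu -> collinear_triples mu -> collinear_triples nu.
Proof.
move=> [g gu H] [w Hw]; exists (g *m w) => x y z.
have [c Hc] := Hw (invmx g *m x) (invmx g *m y) (invmx g *m z).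
by exists c; rewrite scalemxAr -Hc !H !mulKVmx.
Qed.

Lemma N137_collinear eps : collinear_triples (N137 eps).
Proof.
exists (E 6) => x y z; eexists; rewrite N137_level; last exact: N137_low.
by coords; rewrite ?mulr0 // mulr1.
Qed.

Lemma N247_not_collinear eps : ~ collinear_triples (N247 eps).
Proof.
move=> [w Hw]; have [c Hc] := Hw (E 0) (E 1) (E 0); have [d Hd] := Hw (E 0) (E 1) (E 2).
rewrite N247_level in Hc; last exact: N247_low; rewrite N247_level in Hd; last exact: N247_low.
have C k : (k < 7)%N -> _ := fun k7 => congr1 (fun u : V => u (o7 k) 0) Hc.
have D k : (k < 7)%N -> _ := fun k7 => congr1 (fun u : V => u (o7 k) 0) Hd.
move: (C 5%N isT) (D 5%N isT) (D 6%N isT).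
rewrite !vec7_coord //= N247E !vec7_coord //= !minor2E //= !Ecoord //= !entE !zsimp.
move=> c5 /esym/eqP; rewrite mulf_eq0 => /orP[/eqP ->|/eqP w5].
  by rewrite mul0r => /eqP; rewrite oppr_eq0 oner_eq0.
by move/eqP: c5; rewrite w5 mulr0 oppr_eq0 oner_eq0.
Qed.

(** The sign in each family is detected by two zero divisors of the quadratic algebra
    which acts on the algebra. *)
Definition split_pair mu x y :=
  [/\ exists t, bracket mu x (bracket mu x t) <> 0, exists t, bracket mu y (bracket mu y t) <> 0,
      forall t, bracket mu x (bracket mu y t) = 0 & forall t, bracket mu y (bracket mu x t) = 0].

Definition has_split_pair mu := exists x y, split_pair mu x y.

Lemma has_split_pair_iso mu nu : isomorphic mu nu -> has_split_pair mu -> has_split_pair nu.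
Proof.
move=> [g gu H] [x [y [[t xt] [s ys] xy yx]]]; exists (g *m x), (g *m y).
have g0 u : g *m u = 0 -> u = 0 by move=> E0; apply: (can_inj (mulKmx gu)); rewrite E0 mulmx0.
split.
- by exists (g *m t); rewrite -!H => /g0.
- by exists (g *m s); rewrite -!H => /g0.
- by move=> u; rewrite -(mulKVmx gu u) -!H xy mulmx0.
- by move=> u; rewrite -(mulKVmx gu u) -!H yx mulmx0.
Qed.

Lemma N137_levelr eps x u : low 4 u -> bracket (N137 eps) x u = vec7
  [:: 0; 0; 0; 0; 0; 0; u (o7 4) 0 * x (o7 0) 0 + eps * (u (o7 5) 0 * x (o7 1) 0)].
Proof.
move=> H; rewrite (alternatingC _ _ (alternating_of_table _)) N137_level //; coords; ring.
Qed.

Lemma N247_levelr eps x u : low 3 u -> bracket (N247 eps) x u = vec7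
  [:: 0; 0; 0; 0; 0; u (o7 3) 0 * (x (o7 0) 0 + x (o7 1) 0) + eps * (u (o7 4) 0 * x (o7 2) 0);
   u (o7 4) 0 * x (o7 1) 0 + u (o7 3) 0 * x (o7 2) 0].
Proof.
move=> H; rewrite (alternatingC _ _ (alternating_of_table _)) N247_level //; coords; ring.
Qed.

Lemma N137_double eps x y t : bracket (N137 eps) x (bracket (N137 eps) y t) = vec7
  [:: 0; 0; 0; 0; 0; 0; (minor2 y t 0 2 + eps * minor2 y t 1 3) * x (o7 0) 0
     + eps * ((minor2 y t 0 3 + minor2 y t 1 2) * x (o7 1) 0)].
Proof. by rewrite N137_levelr; [rewrite N137E !vec7_coord|exact: N137_low]. Qed.

Lemma N247_double eps x y t : bracket (N247 eps) x (bracket (N247 eps) y t) = vec7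
  [:: 0; 0; 0; 0; 0; minor2 y t 0 1 * (x (o7 0) 0 + x (o7 1) 0) + eps * (minor2 y t 0 2 * x (o7 2) 0);
   minor2 y t 0 2 * x (o7 1) 0 + minor2 y t 0 1 * x (o7 2) 0].
Proof. by rewrite N247_levelr; [rewrite N247E !vec7_coord|exact: N247_low]. Qed.

End Models.

Section RealModels.
Variable R : realType.
Local Notation V := 'cV[R]_7.
Local Notation E i := (evec R (o7 i)).

Lemma two_neq0 : (2 : R) <> 0. Proof. by apply/eqP; rewrite pnatr_eq0. Qed.

Lemma N137_split : has_split_pair (N137 (1 : R)).
Proof.
exists (E 0 + E 1), (E 0 - E 1); split.
- exists (E 2) => /(congr1 (fun u : V => u (o7 6) 0)); rewrite N137_double vec7_coord //= /minor2.
  by rewrite !entE !Ecoord //= => H; apply: two_neq0; rewrite -[RHS]H; ring.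
- exists (E 2) => /(congr1 (fun u : V => u (o7 6) 0)); rewrite N137_double vec7_coord //= /minor2.
  by rewrite !entE !Ecoord //= => H; apply: two_neq0; rewrite -[RHS]H; ring.
- move=> t; rewrite N137_double; coords; rewrite /minor2 !entE !Ecoord //=; ring.
- move=> t; rewrite N137_double; coords; rewrite /minor2 !entE !Ecoord //=; ring.
Qed.

Lemma N247_split : has_split_pair (N247 (1 : R)).
Proof.
exists (E 1 + E 2), (E 1 - E 2); split.
- exists (E 0) => /(congr1 (fun u : V => - u (o7 6) 0)); rewrite N247_double vec7_coord //= /minor2.
  by rewrite !entE !Ecoord //= oppr0 => H; apply: two_neq0; rewrite -[RHS]H; ring.
- exists (E 0) => /(congr1 (fun u : V => u (o7 6) 0)); rewrite N247_double vec7_coord //= /minor2.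
  by rewrite !entE !Ecoord //= => H; apply: two_neq0; rewrite -[RHS]H; ring.
- move=> t; rewrite N247_double; coords; rewrite /minor2 !entE !Ecoord //=; ring.
- move=> t; rewrite N247_double; coords; rewrite /minor2 !entE !Ecoord //=; ring.
Qed.

(** This says that the complex numbers have no zero divisors. *)
Lemma complex_domain (a b c d : R) : a * c - b * d = 0 -> a * d + b * c = 0 ->
  (a = 0 /\ b = 0) \/ (c = 0 /\ d = 0).
Proof.
move=> H K; have : (a ^+ 2 + b ^+ 2) * (c ^+ 2 + d ^+ 2) = 0.
  have -> : (a ^+ 2 + b ^+ 2) * (c ^+ 2 + d ^+ 2) = (a * c - b * d) ^+ 2 + (a * d + b * c) ^+ 2 by ring.
  by rewrite H K !expr0n addr0.
move/eqP; rewrite mulf_eq0 !paddr_eq0 ?sqr_ge0 // !sqrf_eq0.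
by case/orP => /andP[/eqP -> /eqP ->]; [left|right].
Qed.

Lemma N137_not_split : ~ has_split_pair (N137 (-1 : R)).
Proof.
move=> [x [y [[t xt] [s ys] xy _]]].
have C (u : V) : _ := congr1 (fun u : V => u (o7 6) 0) (xy u).
move: (C (E 2)) (C (E 3)); rewrite !N137_double !vec7_coord //= /minor2 !Ecoord //= !entE.
move=> h2 h3.
have [|||] := @complex_domain (x (o7 0) 0) (x (o7 1) 0) (y (o7 0) 0) (y (o7 1) 0).
- by rewrite -[RHS]h2; ring.
- by rewrite -[RHS]oppr0 -[in RHS]h3 ; ring.
- by move=> [x0 x1]; apply: xt; rewrite N137_double x0 x1; coords; ring.
by move=> [y0 y1]; apply: ys; rewrite N137_double y0 y1; coords; ring.
Qed.

Lemma N247_not_split : ~ has_split_pair (N247 (-1 : R)).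
Proof.
move=> [x [y [[t xt] [s ys] xy yx]]].
have z0 (u v : V) : u (o7 0) 0 = 0 -> u (o7 1) 0 = 0 -> u (o7 2) 0 = 0 ->
    bracket (N247 (-1 : R)) u (bracket (N247 (-1 : R)) u v) = 0.
  by move=> u0 u1 u2; rewrite N247_double u0 u1 u2; coords; ring.
have C5 (u : V) : _ := congr1 (fun u : V => u (o7 5) 0) (xy u).
have C6 (u : V) : _ := congr1 (fun u : V => u (o7 6) 0) (xy u).
have first (u v : V) (Huv : forall w, bracket (N247 (-1 : R)) u (bracket (N247 (-1 : R)) v w) = 0)
    (Hu : exists w, bracket (N247 (-1 : R)) u (bracket (N247 (-1 : R)) u w) <> 0) : v (o7 0) 0 = 0.
  apply/eqP/negPn/negP => v0.
  have C5' (w' : V) : _ := congr1 (fun u : V => u (o7 5) 0) (Huv w').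
  have C6' (w' : V) : _ := congr1 (fun u : V => u (o7 6) 0) (Huv w').
  move: (C5' (E 1)) (C6' (E 1)) (C6' (E 2)).
  rewrite !N247_double !vec7_coord //= /minor2 !Ecoord //= !entE !zsimp.
  move=> /eqP; rewrite mulf_eq0 (negbTE v0) /= => /eqP h1.
  move=> /eqP; rewrite mulf_eq0 (negbTE v0) /= => /eqP h2.
  move=> /eqP; rewrite mulf_eq0 (negbTE v0) /= => /eqP h3.
  case: Hu => w; apply; apply: z0 => //.
  by rewrite -[RHS]h1 h3 addr0.
have y0 : y (o7 0) 0 = 0 by apply: (first x y) => //; exists t.
have x0 : x (o7 0) 0 = 0 by apply: (first y x) => //; exists s.
move: (C5 (E 0)) (C6 (E 0)).
rewrite !N247_double !vec7_coord //= /minor2 !Ecoord //= !entE x0 y0 => h5 h6.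
have [|||] := @complex_domain (x (o7 1) 0) (x (o7 2) 0) (y (o7 1) 0) (y (o7 2) 0).
- by rewrite -[RHS]oppr0 -[in RHS]h5; ring.
- by rewrite -[RHS]oppr0 -[in RHS]h6; ring.
- by move=> [x1 x2]; apply: xt; apply: z0.
by move=> [y1 y2]; apply: ys; apply: z0.
Qed.

Lemma g137BE x y : bracket (g137B R) x y = vec7 [:: 0; 0; 0; 0; minor2 x y 0 1; minor2 x y 2 3;
  minor2 x y 0 4 + minor2 x y 2 5 + minor2 x y 1 3].
Proof.
rewrite bracket_of_table !big_cons big_nil /= -!/(minor2 x y _ _).
by coords; ring.
Qed.

Lemma g137B1E x y : bracket (g137B1 R) x y = vec7 [:: 0; 0; 0; 0; minor2 x y 0 2 + minor2 x y 1 3;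
  minor2 x y 0 3 - minor2 x y 1 2; minor2 x y 0 4 + minor2 x y 1 5 + minor2 x y 2 3].
Proof.
rewrite bracket_of_table !big_cons big_nil /= -!/(minor2 x y _ _).
by coords; ring.
Qed.

(** The quadratic algebra splits for eps = 1. The vectors 0 and 2 of the table are its
    idempotents, so that 1 and j are their sum and their difference. *)
Lemma N137_g137B : isomorphic (N137 (1 : R)) (g137B R).
Proof.
apply: (@N137_iso _ 1 (g137B R) (vec7 [:: 1; 0; 1; 0; 0; 0; 0]) (vec7 [:: 1; 0; -1; 0; 0; 0; 0])
  (vec7 [:: 0; -1; 0; -1; 0; 0; 0]) (vec7 [:: 0; -1; 0; 1; 0; 0; 0]) (vec7 [:: 0; 0; 0; 0; -1; -1; 0])
  (vec7 [:: 0; 0; 0; 0; -1; 1; 0]) (vec7 [:: 0; 0; 0; 0; 0; 0; - 2%:R])).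
- exact: oner_neq0.
- exact: alternating_of_table.
- by move=> y; tbl g137BE; ring.
- apply/eqP => /(congr1 (fun u : V => u (o7 6) 0)); rewrite vec7_coord //= ent0 => /eqP.
  by rewrite oppr_eq0 pnatr_eq0.
all: tbl g137BE; ring.
Qed.

Lemma N137_g137B1 : isomorphic (N137 (-1 : R)) (g137B1 R).
Proof.
apply: (@N137_iso _ (-1) (g137B1 R) (vec7 [:: 1; 0; 0; 0; 0; 0; 0]) (vec7 [:: 0; -1; 0; 0; 0; 0; 0])
  (vec7 [:: 0; 0; 1; 0; 0; 0; 0]) (vec7 [:: 0; 0; 0; 1; 0; 0; 0]) (vec7 [:: 0; 0; 0; 0; 1; 0; 0])
  (vec7 [:: 0; 0; 0; 0; 0; 1; 0]) (vec7 [:: 0; 0; 0; 0; 0; 0; 1])).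
- by rewrite oppr_eq0 oner_neq0.
- exact: alternating_of_table.
- by move=> y; tbl g137B1E; ring.
- apply/eqP => /(congr1 (fun u : V => u (o7 6) 0)); rewrite vec7_coord //= ent0 => /eqP.
  by rewrite oner_eq0.
all: tbl g137B1E; ring.
Qed.

Lemma g247H_N247 : g247H R = N247 1.
Proof. by rewrite /N247 scale1r. Qed.

End RealModels.

(** * Complexification *)

Section Multilinear.
Variables (F : fieldType) (n : nat).
Implicit Types (mu s : bilin F n).

Let br := (@bracketDl F n, @bracketDr F n, @bracketZl F n, @bracketZr F n).

Lemma d2_linear1 mu s y z : linear (fun x => d2 mu s x y z).
Proof. by move=> a u v; rewrite /d2 !br; vring. Qed.
Lemma d2_linear2 mu s x z : linear (fun y => d2 mu s x y z).
Proof. by move=> a u v; rewrite /d2 !br; vring. Qed.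
Lemma d2_linear3 mu s x y : linear (fun z => d2 mu s x y z).
Proof. by move=> a u v; rewrite /d2 !br; vring. Qed.

Definition dn3 mu s a b c d :=
  bracket s (bracket mu (bracket mu a b) c) d
  + bracket mu (bracket s (bracket mu a b) c + bracket mu (bracket s a b) c) d.

Lemma dn3E mu s x : dnbracket 3 mu s x = dn3 mu s (x 0%N) (x 1%N) (x 2%N) (x 3%N).
Proof. by rewrite /= bracket0l addr0. Qed.

Lemma dn3_linear1 mu s b c d : linear (fun a => dn3 mu s a b c d).
Proof. by move=> k u v; rewrite /dn3 !br; vring. Qed.
Lemma dn3_linear2 mu s a c d : linear (fun b => dn3 mu s a b c d).
Proof. by move=> k u v; rewrite /dn3 !br; vring. Qed.
Lemma dn3_linear3 mu s a b d : linear (fun c => dn3 mu s a b c d).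
Proof. by move=> k u v; rewrite /dn3 !br; vring. Qed.
Lemma dn3_linear4 mu s a b c : linear (fun d => dn3 mu s a b c d).
Proof. by move=> k u v; rewrite /dn3 !br; vring. Qed.

Lemma defect_linear1 (g : 'M[F]_n) mu nu y :
  linear (fun x => g *m bracket mu x y - bracket nu (g *m x) (g *m y)).
Proof. by move=> k u v; rewrite !(mulmxDr, br, =^~ scalemxAr); vring. Qed.
Lemma defect_linear2 (g : 'M[F]_n) mu nu x :
  linear (fun y => g *m bracket mu x y - bracket nu (g *m x) (g *m y)).
Proof. by move=> k u v; rewrite !(mulmxDr, br, =^~ scalemxAr); vring. Qed.

End Multilinear.

(** Multiply e_2, e_4 and e_6 by a square root of -1. *)
Lemma N247_change_sign (F : fieldType) (i : F) : i * i = -1 -> isomorphic (N247 (-1)) (N247 (1 : F)).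
Proof.
move=> ii.
have i0 : i != 0 by apply/eqP => H; move/eqP: ii; rewrite H mul0r eq_sym oppr_eq0 oner_eq0.
apply: (@N247_iso _ (-1) (N247 1) (vec7 [:: 1; 0; 0; 0; 0; 0; 0]) (vec7 [:: 0; 1; 0; 0; 0; 0; 0])
  (vec7 [:: 0; 0; i; 0; 0; 0; 0]) (vec7 [:: 0; 0; 0; 1; 0; 0; 0]) (vec7 [:: 0; 0; 0; 0; i; 0; 0])
  (vec7 [:: 0; 0; 0; 0; 0; 1; 0]) (vec7 [:: 0; 0; 0; 0; 0; 0; i])).
- exact: alternating_of_table.
- by move=> y; tbl (@N247E F); ring.
- by move=> y; tbl (@N247E F); ring.
- move=> s t H; split.
    by have := congr1 (fun u : 'cV[F]_7 => u (o7 5) 0) H; rewrite !entE !vec7_coord //= !zsimp.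
  have := congr1 (fun u : 'cV[F]_7 => u (o7 6) 0) H; rewrite !entE !vec7_coord //= !zsimp.
  by move/eqP; rewrite mulf_eq0 (negbTE i0) orbF => /eqP.
all: tbl (@N247E F); try ring.
by rewrite -ii; ring.
Qed.

Section Complexification.
Variable R : realType.
Local Notation C := R[i].
Local Notation rc := (real_complex R).

Definition re_mx m n (A : 'M[C]_(m, n)) : 'M[R]_(m, n) := map_mx (@complex.Re R) A.
Definition im_mx m n (A : 'M[C]_(m, n)) : 'M[R]_(m, n) := map_mx (@complex.Im R) A.

Lemma re_sum (I : Type) (r : seq I) (f : I -> C) :
  complex.Re (\sum_(i <- r) f i) = \sum_(i <- r) complex.Re (f i).
Proof. by elim/big_rec2: _ => // i x y _ <-; case: (f i); case: y. Qed.

Lemma re_mulmx m n p (A : 'M[R]_(m, n)) (B : 'M[C]_(n, p)) :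
  re_mx (map_mx rc A *m B) = A *m re_mx B.
Proof.
apply/matrixP => i j; rewrite !mxE re_sum; apply: eq_bigr => k _; rewrite !mxE.
by case: (B k j) => a b /=; rewrite mul0r subr0.
Qed.

Lemma re_mulmxr m n p (A : 'M[C]_(m, n)) (B : 'M[R]_(n, p)) :
  re_mx (A *m map_mx rc B) = re_mx A *m B.
Proof.
apply/matrixP => i j; rewrite !mxE re_sum; apply: eq_bigr => k _; rewrite !mxE.
by case: (A i k) => a b /=; rewrite mulr0 subr0.
Qed.

Lemma re_map m n (A : 'M[R]_(m, n)) : re_mx (map_mx rc A) = A.
Proof. by apply/matrixP => i j; rewrite !mxE. Qed.

Lemma re_mxB m n (A B : 'M[C]_(m, n)) : re_mx (A - B) = re_mx A - re_mx B.
Proof. by apply/matrixP => i j; rewrite !mxE; case: (A i j); case: (B i j). Qed.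

Lemma complex_decomp n (x : 'cV[C]_n) :
  x = 'i%C *: map_mx rc (im_mx x) + map_mx rc (re_mx x).
Proof.
apply/colP => i; rewrite !mxE; case: (x i 0) => a b.
by apply/eqP; rewrite eq_complex /=; apply/andP; split; apply/eqP; ring.
Qed.

(** Multilinear identities are checked on real vectors, one argument at a time. *)
Lemma linear_real_ext n m (f : 'cV[C]_n -> 'cV[C]_m) : linear f ->
  (forall u, f (map_mx rc u) = 0) -> forall x, f x = 0.
Proof. by move=> lf H x; rewrite (complex_decomp x) lf !H scaler0 addr0. Qed.

Section Bilin.
Variable n : nat.
Implicit Types (mu s h : bilin R n).

Lemma bracket_complex mu x y :
  bracket (complexification mu) (map_mx rc x) (map_mx rc y) = map_mx rc (bracket mu x y).
Proof. by rewrite /bracket /complexification matrix.map_trmx -map_mxM -map_mxvec matrix.map_trmx -map_mxM. Qed.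

Lemma bracket_re mu x w :
  re_mx (bracket (complexification mu) (map_mx rc x) w) = bracket mu x (re_mx w).
Proof.
rewrite /bracket /complexification re_mulmx /re_mx -matrix.map_trmx map_mxvec.
by rewrite -/(re_mx _) re_mulmx /re_mx -matrix.map_trmx.
Qed.

Lemma alternating_complex s : alternating s -> alternating (complexification s).
Proof.
move=> A x; rewrite (complex_decomp x) !(bracketDl, bracketDr, bracketZl, bracketZr).
rewrite !bracket_complex !A (alternatingC (im_mx x) (re_mx x) A).
by rewrite !map_mx0 !scaler0 add0r addr0 map_mxN scalerN addNr.
Qed.

Lemma d2_complex mu s : (forall x y z, d2 mu s x y z = 0) ->
  forall x y z, d2 (complexification mu) (complexification s) x y z = 0.
Proof.
move=> H x y z.
apply: (linear_real_ext (d2_linear1 _ _ y z)) => {}x.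
apply: (linear_real_ext (d2_linear2 _ _ _ z)) => {}y.
apply: (linear_real_ext (d2_linear3 _ _ _ _)) => {}z.
by rewrite /d2 !bracket_complex -!(map_mxB, map_mxD) -/(d2 _ _ _ _ _) H map_mx0.
Qed.

Lemma dn3_complex mu s : (forall a b c d, dn3 mu s a b c d = 0) ->
  forall a b c d, dn3 (complexification mu) (complexification s) a b c d = 0.
Proof.
move=> H a b c d.
apply: (linear_real_ext (dn3_linear1 _ _ b c d)) => {}a.
apply: (linear_real_ext (dn3_linear2 _ _ _ c d)) => {}b.
apply: (linear_real_ext (dn3_linear3 _ _ _ _ d)) => {}c.
apply: (linear_real_ext (dn3_linear4 _ _ _ _ _)) => {}d.
by rewrite /dn3 !bracket_complex -map_mxD bracket_complex -map_mxD -/(dn3 _ _ _ _ _ _) H map_mx0.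
Qed.

Lemma cocycle_complex mu s : cocycle 3 mu s ->
  cocycle 3 (complexification mu) (complexification s).
Proof.
case=> A D N; split; [exact: alternating_complex|exact: d2_complex|move=> x].
rewrite dn3E; apply: dn3_complex => a b c d.
by have := N (fun i => nth 0 [:: a; b; c; d] i); rewrite dn3E.
Qed.

(** The real part of a complex potential of a real cocycle is a real potential. *)
Lemma rigid_cocycles_real mu :
  rigid_cocycles 3 (complexification mu) -> rigid_cocycles 3 mu.
Proof.
move=> H s /cocycle_complex/H[X _ HX]; exists (re_mx X) => //; apply: bracket_inj => x y.
have E : bracket (d1 (complexification mu) X) (map_mx rc x) (map_mx rc y)
  = bracket (complexification s) (map_mx rc x) (map_mx rc y) by rewrite HX.
rewrite d1E (bracket_complex mu) (bracket_complex s) in E.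
have := congr1 (@re_mx n 1) E; rewrite re_map => <-.
rewrite d1E.
rewrite (re_mxB (bracket _ _ _ - bracket _ _ _) (_ *m _)).
rewrite (re_mxB (bracket _ _ _) (bracket _ _ _)).
have part u v : re_mx (bracket (complexification mu) (map_mx rc u) (X *m map_mx rc v))
    = bracket mu u (re_mx X *m v).
  exact: etrans (bracket_re mu u (X *m map_mx rc v)) (congr1 (bracket mu u) (re_mulmxr X v)).
have sub (a b c a' b' c' : 'cV[R]_n) : a = a' -> b = b' -> c = c' -> a' - b' - c' = a - b - c.
  by move=> -> -> ->.
exact: sub (part x y) (part y x) (re_mulmxr X _).
Qed.

Lemma nbracket_complex k mu (x : nat -> 'cV[R]_n) :
  nbracket k (complexification mu) (fun i => map_mx rc (x i)) = map_mx rc (nbracket k mu x).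
Proof. by elim: k => //= k ->; rewrite bracket_complex. Qed.

Lemma map_rc_inj m p : injective (map_mx rc : 'M[R]_(m, p) -> 'M[C]_(m, p)).
Proof. exact: (can_inj (@re_map m p)). Qed.

Lemma nil_variety_real k mu : nil_variety k (complexification mu) -> nil_variety k mu.
Proof.
move=> [[A J] N]; split; [split|] => [x|x y z|x]; apply: map_rc_inj; rewrite map_mx0.
- by rewrite -bracket_complex A.
- rewrite /jacobiator !map_mxD -!bracket_complex; exact: J.
by rewrite -nbracket_complex N.
Qed.

Lemma nil2_complex mu : nil_variety 2 mu ->
  forall x : nat -> 'cV[C]_n, nbracket 2 (complexification mu) x = 0.
Proof.
move=> [_ N] x /=; move: (x 0%N) (x 1%N) (x 2%N) => a b c.
have br := (bracketDl, bracketDr, bracketZl, bracketZr).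
pose D (a b c : 'cV[C]_n) := bracket (complexification mu) (bracket (complexification mu) a b) c.
have la b' c' : linear (fun a => D a b' c') by move=> k u v; rewrite /D !br.
have lb a' c' : linear (fun b => D a' b c') by move=> k u v; rewrite /D !br.
have lc a' b' : linear (fun c => D a' b' c) by move=> k u v; rewrite /D !br.
apply: (linear_real_ext (la b c)) => {}a; apply: (linear_real_ext (lb _ c)) => {}b.
apply: (linear_real_ext (lc _ _)) => {}c.
rewrite /D !bracket_complex; have := N (fun i => nth 0 [:: a; b; c] i).
by rewrite /= => ->; rewrite map_mx0.
Qed.

Lemma isomorphic_complex mu nu : isomorphic mu nu ->
  isomorphic (complexification mu) (complexification nu).
Proof.
move=> [g gu H]; exists (map_mx rc g) => [|x y]; first by rewrite map_unitmx.
apply/eqP; rewrite -subr_eq0; apply/eqP.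
apply: (linear_real_ext (defect_linear1 _ _ _ y)) => {}x.
apply: (linear_real_ext (defect_linear2 _ _ _ _)) => {}y.
by rewrite -!map_mxM !bracket_complex -map_mxM H subrr.
Qed.

End Bilin.

Lemma vec7_complex (l : seq R) : map_mx rc (vec7 l) = vec7 (map rc l).
Proof.
apply/colP => i; rewrite !mxE; case: (ltnP i (size l)) => il; first by rewrite (nth_map 0).
by rewrite !nth_default ?size_map // raddf0.
Qed.

Lemma minor2_complex (x y : 'cV[R]_7) i j :
  minor2 (map_mx rc x) (map_mx rc y) i j = rc (minor2 x y i j).
Proof. by rewrite /minor2 !mxE rmorphB !rmorphM. Qed.

Lemma N247_complex (eps : R) : complexification (N247 eps) = N247 (rc eps).
Proof.
apply: bracket_ext => i j; rewrite -!(map_delta_mx rc) bracket_complex !N247E vec7_complex /=.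
by rewrite !minor2_complex -!rmorphM -!rmorphD; congr vec7; rewrite rmorph0.
Qed.

Lemma N137_complex (eps : R) : complexification (N137 eps) = N137 (rc eps).
Proof.
apply: bracket_ext => i j; rewrite -!(map_delta_mx rc) bracket_complex !N137E vec7_complex /=.
by rewrite !minor2_complex -!rmorphM -!rmorphD; congr vec7; rewrite rmorph0.
Qed.

End Complexification.

(** * The four algebras *)

Section Tables.
Variable F : fieldType.

Lemma N247_table1 : of_lits F (t247 false) = N247 1.
Proof. by rewrite /N247 scale1r /of_lits /t247 /map /fst /snd. Qed.

Lemma N247_tableN1 : of_lits F (t247 true) = N247 (-1).
Proof. by rewrite /N247 scaleN1r /of_lits /t247 /map /fst /snd. Qed.

Lemma g137B_table : of_lits F t137B = g137B F.
Proof. by rewrite /of_lits /t137B /map /fst /snd. Qed.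

Lemma g137B1_table : of_lits F t137B1 = g137B1 F.
Proof. by rewrite /of_lits /t137B1 /map /fst /snd. Qed.

End Tables.

Section FourAlgebras.
Variable F : numFieldType.

Lemma rigid_of_slice m k (mu : bilin F 7) : slice m k mu -> rigid_cocycles k mu.
Proof. by move=> [X [_ HX]] s /HX[u ->]; exists (X u). Qed.

Lemma slice_N247 : slice 38 3 (N247 (1 : F)).
Proof.
rewrite -(N247_table1 F).
apply: (slice_of_check (t := t247 false) (P := P247H) isT check247H); [by vm_compute|by vm_compute|].
by rewrite N247_table1; apply: N247_nil.
Qed.

Lemma slice_N247' : slice 38 3 (N247 (-1 : F)).
Proof.
rewrite -(N247_tableN1 F).
apply: (slice_of_check (t := t247 true) (P := P247H1) isT check247H1); [by vm_compute|by vm_compute|].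
by rewrite N247_tableN1; apply: N247_nil.
Qed.

End FourAlgebras.

Section Main.
Variable R : realType.
Local Notation C := R[i].

Lemma slice_g137B : slice 36 3 (g137B R).
Proof.
rewrite -g137B_table.
apply: (slice_of_check (t := t137B) (P := P137B) isT check137B); [by vm_compute|by vm_compute|].
rewrite g137B_table; exact: nil_variety_iso (N137_g137B R) (N137_nil _).
Qed.

Lemma slice_g137B1 : slice 36 3 (g137B1 R).
Proof.
rewrite -g137B1_table.
apply: (slice_of_check (t := t137B1) (P := P137B1) isT check137B1); [by vm_compute|by vm_compute|].
rewrite g137B1_table; exact: nil_variety_iso (N137_g137B1 R) (N137_nil _).
Qed.

Lemma complex_g247H : complexification (g247H R) = N247 (1 : C).
Proof. by rewrite g247H_N247 N247_complex rmorph1. Qed.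

Lemma N247_is_g247H1 : is_g247H1 (N247 (-1 : R)).
Proof.
split; first by case: (N247_nil (-1 : R)).
  move=> /isomorphic_sym/has_split_pair_iso; rewrite g247H_N247 => /(_ (N247_split R)).
  exact: N247_not_split.
rewrite complex_g247H N247_complex rmorphN rmorph1; apply: (N247_change_sign (i := 'i%C)).
by rewrite -expr2 sqr_i.
Qed.

(** A real form of the third algebra inherits the vanishing of the cohomology from
    its complexification, hence is one of the four by the classification; the dimension
    of the last step and the hypothesis leave one. *)
Lemma g247H1_unique (h : bilin R 7) : is_g247H1 h -> isomorphic h (N247 (-1)).
Proof.
case=> _ ni; rewrite complex_g247H => iso; have iso' := isomorphic_sym iso.
have Nc : nil_variety 3 (complexification h) := nil_variety_iso iso' (N247_nil _).
have Zh : rigid_cocycles 3 h.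
  apply/rigid_cocycles_real/(rigid_cocycles_iso iso')/rigid_of_slice; exact: slice_N247.
have Sh : nil_step 3 h.
  split=> [|N2]; first exact: nil_variety_real Nc.
  have [_] := N247_step (1 : C); apply; apply: nil_variety_iso iso _.
  by split; [case: Nc|apply: nil2_complex].
have [eps [He [I|I]]] := classification Sh Zh.
  case: (@N247_not_collinear C 1); apply: collinear_triples_iso iso _.
  apply: collinear_triples_iso (isomorphic_sym (isomorphic_complex I)) _.
  by rewrite N137_complex; apply: N137_collinear.
case: He I => -> // I; case: ni; rewrite g247H_N247; exact: I.
Qed.

End Main.

Theorem mainTheorem8 (R : realType) :
  exists g247H1 : bilin R 7,
    is_g247H1 g247H1 /\
    (forall h : bilin R 7, is_g247H1 h -> isomorphic h g247H1) /\
    let L := [tuple g137B R; g137B1 R; g247H R; g247H1] in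
    (forall mu : bilin R 7,
       nil_step 3 mu /\ H2_nil_eq0 3 mu <->
       exists i : 'I_4, isomorphic mu (tnth L i)) /\
    (forall i j : 'I_4, isomorphic (tnth L i) (tnth L j) -> i = j) /\
    (forall i : 'I_4, rigid 3 (tnth L i)) /\
    submanifold 36 (gl_orbit (g137B R)) /\
    submanifold 36 (gl_orbit (g137B1 R)) /\
    submanifold 38 (gl_orbit (g247H R)) /\
    submanifold 38 (gl_orbit g247H1).
Proof.
exists (N247 (-1)); split; first exact: N247_is_g247H1.
split; first exact: g247H1_unique.
move=> L.
have cases (P : bilin R 7 -> nat -> Prop) : P (g137B R) 0%N -> P (g137B1 R) 1%N ->
    P (g247H R) 2%N -> P (N247 (-1)) 3%N -> forall i : 'I_4, P (tnth L i) i.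
  by move=> p0 p1 p2 p3 [[|[|[|[|//]]]] Hi]; rewrite (tnth_nth (g137B R)).
have step i : nil_step 3 (tnth L i).
  apply: (cases (fun mu _ => nil_step 3 mu)).
  - exact: nil_step_iso (N137_g137B R) (N137_step _).
  - exact: nil_step_iso (N137_g137B1 R) (N137_step _).
  - by rewrite g247H_N247; apply: N247_step.
  - exact: N247_step.
have s247 : slice 38 3 (g247H R) by rewrite g247H_N247; apply: slice_N247.
have coh i : rigid_cocycles 3 (tnth L i).
  apply: (cases (fun mu _ => rigid_cocycles 3 mu)); apply: rigid_of_slice.
  - exact: slice_g137B.
  - exact: slice_g137B1.
  - exact: s247.
  - exact: slice_N247'.
have nil i : nil_variety 3 (tnth L i) by case: (step i).
split.
  move=> mu; rewrite H2_nil_eq0P; split=> [[S Z]|[i I]]; last first.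
    by split; [apply: nil_step_iso (isomorphic_sym I) _|apply: rigid_cocycles_iso (isomorphic_sym I) _].
  have [eps [He J]] := classification S Z.
  case: He J => -> [J|J].
  - exists (inord 0); rewrite (tnth_nth 0) inordK //=; exact: isomorphic_trans J (N137_g137B R).
  - by exists (inord 2); rewrite (tnth_nth 0) inordK //= g247H_N247.
  - exists (inord 1); rewrite (tnth_nth 0) inordK //=; exact: isomorphic_trans J (N137_g137B1 R).
  - by exists (inord 3); rewrite (tnth_nth 0) inordK.
split.
  have col i : collinear_triples (tnth L i) <-> (i < 2)%N.
    apply: (cases (fun mu k => collinear_triples mu <-> (k < 2)%N)); split=> //.
    - move=> _; exact: collinear_triples_iso (N137_g137B R) (N137_collinear _).
    - move=> _; exact: collinear_triples_iso (N137_g137B1 R) (N137_collinear _).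
    - by rewrite g247H_N247 => /N247_not_collinear.
    - by move/N247_not_collinear.
  have spl i : has_split_pair (tnth L i) <-> ~~ odd i.
    apply: (cases (fun mu k => has_split_pair mu <-> ~~ odd k)); split=> //.
    - move=> _; exact: has_split_pair_iso (N137_g137B R) (N137_split R).
    - by move=> /(has_split_pair_iso (isomorphic_sym (N137_g137B1 R)))/N137_not_split.
    - by move=> _; rewrite g247H_N247; apply: N247_split.
    - by move/N247_not_split.
  move=> i j I; have J := isomorphic_sym I.
  have e1 : (i < 2)%N = (j < 2)%N.
    by apply/idP/idP => /col H; apply/col; [apply: collinear_triples_iso I H|apply: collinear_triples_iso J H].
  have e2 : odd i = odd j.
    apply: negb_inj; apply/idP/idP => /spl H; apply/spl; [exact: has_split_pair_iso I H|exact: has_split_pair_iso J H].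
  apply: val_inj; move: e1 e2 {I J}.
  by case: i => [[|[|[|[|//]]]] ?]; case: j => [[|[|[|[|//]]]] ?].
split; first by move=> i; apply: rigid_of_rigid_cocycles.
have sub m k mu : tnth L (inord k) = mu -> slice m 3 mu -> submanifold m (gl_orbit mu).
  by move=> <- /(orbit_submanifold (nil _)).
split; first by apply: (sub 36 0) (slice_g137B R); rewrite (tnth_nth 0) inordK.
split; first by apply: (sub 36 1) (slice_g137B1 R); rewrite (tnth_nth 0) inordK.
split; first by apply: (sub 38 2) s247; rewrite (tnth_nth 0) inordK.
exact: orbit_submanifold (N247_nil _) (slice_N247' R).
Qed.
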